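(* For every $j\in\mathbb{N}$, $j\ge1$, and every $b>\frac{j+1}{2(2j+1)}$ there is a constant $C>0$ depending only on $b$ and $j$ such that for all $f\in X^{0,b}$ $$\|f\|_{L^4(\mathbb{R}\times\mathbb{T})}\le C\,\|f\|_{X^{0,b}}.$$
   Context: $\mathbb{T}=\mathbb{R}/2\pi\mathbb{Z}$, $\langle\cdot\rangle=(1+|\cdot|^2)^{1/2}$, and $\widetilde f(\tau,k)=\frac1{2\pi}\int_{\mathbb{R}}\int_{\mathbb{T}}e^{-it\tau}e^{-ikx}f(t,x)\,dx\,dt$ for $\tau\in\mathbb{R}$, $k\in\mathbb{Z}$ is the space-time Fourier transform. For $s,b\in\mathbb{R}$, the space $X^{s,b}$ (depending on $j$) is the closure of the Schwartz functions $\mathcal{S}_{t,x}(\mathbb{R}\times\mathbb{T})$ under the norm $$\|f\|_{X^{s,b}}^2=\frac1{2\pi}\sum_{k\in\mathbb{Z}}\int_{\mathbb{R}}\langle k\rangle^{2s}\langle\tau-k^{2j+1}\rangle^{2b}|\widetilde f(\tau,k)|^2\,d\tau.$$ *)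

(* Defs.v *)
From HB Require Import structures.
From mathcomp Require Import all_boot all_order all_algebra.
From mathcomp Require Import all_classical all_reals all_analysis.
From mathcomp Require Import complex.

Set Implicit Arguments.
Unset Strict Implicit.
Unset Printing Implicit Defensive.

Import Order.TTheory GRing.Theory Num.Theory.
Import numFieldNormedType.Exports.
Import Normc.

Local Open Scope classical_set_scope.
Local Open Scope ring_scope.
Local Open Scope complex_scope.

(* A function on R x T, T = R / 2 pi Z, is a function of (t, x) in R * R that
   is 2 pi-periodic in x; it is integrated over R x [0, 2 pi), with T carrying
   the unnormalized Lebesgue measure (total mass 2 pi). *)
Definition xperiodic (R : realType) (f : R * R -> R[i]) : Prop :=
  forall t x : R, f (t, x + 2 * pi) = f (t, x).

Definition dtdx (R : realType) :
    {measure set (measurableTypeR R * measurableTypeR R) -> \bar R} :=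
  (@lebesgue_measure R \x @lebesgue_measure R)%E.

Definition strip (R : realType) : set (R * R) :=
  [set: R] `*` [set x | 0 <= x < 2 * pi].
Arguments strip R : clear implicits.

Definition cintegral (R : realType) (f : R * R -> R[i]) : R[i] :=
  (\int[dtdx R]_(z in strip R) complex.Re (f z))
    +i* (\int[dtdx R]_(z in strip R) complex.Im (f z)).

Definition expi (R : realType) (a : R) : R[i] := cos a +i* sin a.

Definition jap (R : realType) (x : R) : R := Num.sqrt (1 + x ^+ 2).

Definition basis_dir (R : realType) (d : bool) : R * R :=
  if d then (0, 1) else (1, 0).

(* The mixed partial derivative along a word of directions. *)
Definition partials (R : realType) (w : seq bool) (g : R * R -> R) :
    R * R -> R :=
  foldr (fun d (h : R * R -> R) z => 'D_(basis_dir R d) h z) g w.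

(* All mixed partials, in any order, exist and decay rapidly in t. Each partial
   is then Lipschitz, hence jointly continuous, so that g is C^oo. *)
Definition real_schwartz (R : realType) (g : R * R -> R) : Prop :=
  forall w : seq bool,
    (forall (d : bool) (z : R * R), derivable (partials w g) z (basis_dir R d))
    /\ (forall N : nat, exists M : R, forall z : R * R,
          `|z.1| ^+ N * `|partials w g z| <= M).

Record schwartzFun (R : realType) := SchwartzFun {
  schwartz_fun :> R * R -> R[i];
  schwartz_periodic : xperiodic schwartz_fun;
  schwartz_Re : real_schwartz (fun z => complex.Re (schwartz_fun z));
  schwartz_Im : real_schwartz (fun z => complex.Im (schwartz_fun z)) }.

Definition stFourier (R : realType) (f : R * R -> R[i]) (tau : R) (k : int) :
    R[i] :=
  ((2 * pi)^-1)%:C *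
  cintegral (fun z : R * R =>
    expi (- (z.1 * tau)) * expi (- (k%:~R * z.2)) * f z).

Definition Xnorm_fun (R : realType) (j : nat) (s b : R) (f : R * R -> R[i]) :
    \bar R :=
  sqrte (((2 * pi)^-1)%:E *
    \esum_(k in [set: int])
      \int[@lebesgue_measure R]_(tau in [set: R])
        (jap (k%:~R : R) `^ (2 * s)
         * jap (tau - k%:~R ^+ (2 * j + 1)) `^ (2 * b)
         * normc (stFourier f tau k) ^+ 2)%:E)%E.

(* The completion of the Schwartz functions is realized inside the space of
   tempered distributions on R x T, seen as functionals on Schwartz functions.
   Linearity and continuity are not required here: they are automatic for the
   distributional limits that occur below. *)
Definition distr (R : realType) := schwartzFun R -> R[i].

Definition distr_of (R : realType) (f : R * R -> R[i]) : distr R :=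
  fun psi => cintegral (fun z => f z * psi z).

Definition Xapprox (R : realType) (j : nat) (s b : R)
    (phi : nat -> schwartzFun R) (u : distr R) : Prop :=
  (forall e : R, 0 < e -> exists N : nat, forall m n : nat,
     (N <= m)%N -> (N <= n)%N ->
     (Xnorm_fun j s b (fun z => phi m z - phi n z)%R < e%:E)%E)
  /\ (forall psi : schwartzFun R,
        (fun n : nat => normc (distr_of (phi n) psi - u psi)) @ \oo --> (0 : R)).

Definition Xspace (R : realType) (j : nat) (s b : R) : set (distr R) :=
  [set u | exists phi, Xapprox j s b phi u].

(* Extension of the norm by continuity. All the limits in the set below agree,
   because a Cauchy sequence for the norm that tends to 0 as distributions also
   tends to 0 in norm; the infimum is a choice-free way of naming their common
   value (and is +oo outside of the space). *)
Definition Xnorm (R : realType) (j : nat) (s b : R) (u : distr R) : \bar R :=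
  ereal_inf [set l | exists phi : nat -> schwartzFun R, Xapprox j s b phi u /\
    (fun n : nat => Xnorm_fun j s b (phi n)) @ \oo --> l].

Definition represents (R : realType) (f : R * R -> R[i]) (u : distr R) : Prop :=
  [/\ xperiodic f,
      measurable_fun [set: R * R] (fun z => complex.Re (f z)),
      measurable_fun [set: R * R] (fun z => complex.Im (f z)) &
      forall psi : schwartzFun R,
        (dtdx R).-integrable (strip R) (fun z => (normc (f z * psi z))%:E)
        /\ u psi = distr_of f psi].

Definition L4norm_fun (R : realType) (f : R * R -> R[i]) : \bar R :=
  Lnorm (dtdx R) 4%:E ((fun z => (normc (f z))%:E) \_ (strip R)).

(* A representing function is unique almost everywhere, so this is its L^4
   norm; it is +oo when the distribution is not a function. *)
Definition L4norm (R : realType) (u : distr R) : \bar R :=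
  ereal_inf [set L4norm_fun f | f in [set f | represents f u]].

(* Main.v *)
(* The L^4 norm of f is controlled by that of the squares of its parts with
   nonnegative and with negative frequencies in x. At frequency k, the square
   of such a part only involves the finitely many interactions k = k1 + k2 with
   k1, k2 of one sign. Plancherel in (t, x) and Cauchy-Schwarz, with the weights
   of the X^{0,b} norm, then reduce the estimate to the boundedness in (tau, k)
   of
     sum_{k1 + k2 = k} \int <s - k1^m>^{-2b} <tau - s - k2^m>^{-2b} ds,
   where m = 2j + 1. The integral decays like a power of
   <tau - k1^m - k2^m>, and by convexity the values of k1^m + (k - k1)^m are as
   far apart as m-th powers; the sum is bounded as soon as
   b > (1 + 1/m) / 4 = (j + 1) / (2 (2j + 1)).

   The estimate is proved for Fejer means in x and Poisson means in t of a
   Schwartz function, for which all sums are finite and all integrals converge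
   absolutely, and passes to the limit by Fatou's lemma. Hence a sequence that is
   Cauchy in X^{0,b} is Cauchy in L^4, and its limit there represents the
   limiting distribution. *)

From HB Require Import structures.
Require Import Defs.
From mathcomp Require Import all_boot all_order all_algebra.
From mathcomp Require Import all_classical all_reals all_analysis.
From mathcomp Require Import complex measurable_realfun ring lra zify.

Set Implicit Arguments.
Unset Strict Implicit.
Unset Printing Implicit Defensive.

Import Order.TTheory GRing.Theory Num.Theory.
Import numFieldNormedType.Exports.
Import Normc.

Local Open Scope classical_set_scope.
Local Open Scope ring_scope.

(** * Integration of complex-valued functions *)

(** The signs of the frequencies are separated because [m] is odd: at output frequency [0] every
    mixed pair [(k1, - k1)] has [k1^m + k2^m = 0], and the sum to be bounded would consist of
    infinitely many equal positive terms. The threshold on [b] comes from two demands on one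
    exponent [g]. With [p = min(2b, 1)], a product of two factors of decay [p] is traded for decay
    [g] in the resonance function and decay [2p - g] in [s]. The integral in [s] requires
    [2p - g > 1], the sum over values spaced like [m]-th powers requires [m g > 1], and such a [g]
    exists exactly when [1 + 1/m < 2p]. The cap at [1] ensures [g <= p] and only lowers the weight.
    Fourier inversion would require decay of the transform of a Schwartz function. Damping the
    transform by [exp(- e |tau|)] makes it integrable at no cost, and Fubini then identifies its
    inverse transform with a Poisson mean, so inversion is never invoked. Since only upper bounds
    are sought, Plancherel is needed as an inequality, and the damping and the Fejer coefficients,
    all at most [1], drop out of the estimate. *)

Section complex_facts.
Context {R : realType}.
Implicit Types z w : R[i].

Lemma normc_sqr z : normc z ^+ 2 = complex.Re z ^+ 2 + complex.Im z ^+ 2.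
Proof. by case: z => a b /=; rewrite sqr_sqrtr// addr_ge0// sqr_ge0. Qed.

Lemma normc_nneg z : 0 <= normc z.
Proof. by case: z => a b; rewrite sqrtr_ge0. Qed.

Lemma normc_triangle z w : normc (z + w) <= normc z + normc w.
Proof. exact: le_normcD. Qed.

Lemma normc_opp z : normc (- z) = normc z.
Proof. exact: normcN. Qed.

Lemma normc_conj z : normc (conjc z) = normc z.
Proof. by case: z => a b /=; rewrite sqrrN. Qed.

Lemma conjcM z w : conjc (z * w) = conjc z * conjc w.
Proof. exact: (rmorphM (@conjc R)). Qed.

Lemma normc_real (a : R) : normc (real_complex R a) = `|a|.
Proof. by rewrite /= expr0n addr0 sqrtr_sqr. Qed.

Lemma Re_le_normc z : `|complex.Re z| <= normc z.
Proof.
by case: z => a b /=; rewrite -sqrtr_sqr ler_wsqrtr// lerDl sqr_ge0.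
Qed.

Lemma Im_le_normc z : `|complex.Im z| <= normc z.
Proof.
by case: z => a b /=; rewrite -sqrtr_sqr ler_wsqrtr// lerDr sqr_ge0.
Qed.

Lemma normc_le_ReIm z : normc z <= `|complex.Re z| + `|complex.Im z|.
Proof.
rewrite -(@ler_pXn2r _ 2)// ?nnegrE ?normc_nneg ?addr_ge0//.
rewrite normc_sqr sqrrD !real_normK ?num_real//.
by rewrite -addrA lerD2l lerDr mulrn_wge0// mulr_ge0.
Qed.

Lemma normc_mul_conj z : z * conjc z = real_complex R (normc z ^+ 2).
Proof.
rewrite normc_sqr; case: z => a b.
by apply/eqP; rewrite eq_complex/=; apply/andP; split; apply/eqP; ring.
Qed.

Lemma normc_sum I (r : seq I) (P : pred I) (F : I -> R[i]) :
  normc (\sum_(i <- r | P i) F i) <= \sum_(i <- r | P i) normc (F i).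
Proof.
elim/big_ind2 : _ => [|x1 x2 y1 y2 h1 h2|//]; first by rewrite normc0.
by rewrite (le_trans (normc_triangle _ _))// lerD.
Qed.

Lemma normcX z n : normc (z ^+ n) = normc z ^+ n.
Proof. by elim: n => [|n ih]; rewrite ?expr0 ?normc1// !exprS normcM ih. Qed.

Lemma expiD (a b : R) : expi (a + b) = expi a * expi b.
Proof.
rewrite /expi cosD sinD; apply/eqP; rewrite eq_complex/=.
by apply/andP; split; apply/eqP; ring.
Qed.

Lemma expi0 : expi (0 : R) = 1.
Proof. by rewrite /expi cos0 sin0. Qed.

Lemma conj_expi (a : R) : conjc (expi a) = expi (- a).
Proof. by rewrite /expi cosN sinN. Qed.

Lemma normc_expi (a : R) : normc (expi a) = 1.
Proof. by rewrite /= cos2Dsin2 sqrtr1. Qed.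

Lemma expi_natmul (a : R) n : expi (a * n%:R) = expi a ^+ n.
Proof.
elim: n => [|n ih]; first by rewrite mulr0 expi0 expr0.
by rewrite -natr1 mulrDr mulr1 expiD ih exprSr.
Qed.

End complex_facts.

Section cint.
Context d (T : measurableType d) (R : realType).
Implicit Types (f g : T -> R[i]) (h : T -> R).

Definition cmeasurable f :=
  measurable_fun [set: T] (fun x => complex.Re (f x)) /\
  measurable_fun [set: T] (fun x => complex.Im (f x)).

Lemma cmeasurable_cst (c : R[i]) : cmeasurable (fun=> c).
Proof. by split; exact: measurable_cst. Qed.

Lemma cmeasurable_real h : measurable_fun [set: T] h ->
  cmeasurable (fun x => real_complex R (h x)).
Proof. by move=> mh; split => //; exact: measurable_cst. Qed.

Lemma cmeasurableD f g : cmeasurable f -> cmeasurable g ->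
  cmeasurable (fun x => f x + g x).
Proof.
move=> [f1 f2] [g1 g2]; split.
- apply: eq_measurable_fun (measurable_funD f1 g1) => x _ /=.
  by case: (f x) (g x) => [? ?] [? ?].
- apply: eq_measurable_fun (measurable_funD f2 g2) => x _ /=.
  by case: (f x) (g x) => [? ?] [? ?].
Qed.

Lemma cmeasurableM f g : cmeasurable f -> cmeasurable g ->
  cmeasurable (fun x => f x * g x).
Proof.
move=> [f1 f2] [g1 g2]; split.
- apply: eq_measurable_fun
    (measurable_funB (measurable_funM f1 g1) (measurable_funM f2 g2)) => x _ /=.
  by case: (f x) (g x) => [? ?] [? ?].
- apply: eq_measurable_fun
    (measurable_funD (measurable_funM f1 g2) (measurable_funM f2 g1)) => x _ /=.
  by case: (f x) (g x) => [? ?] [? ?].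
Qed.

Lemma cmeasurable_conj f : cmeasurable f -> cmeasurable (fun x => conjc (f x)).
Proof.
move=> [f1 f2]; split.
- by apply: eq_measurable_fun f1 => x _ /=; case: (f x).
  apply: eq_measurable_fun (measurable_funN f2) => x _ /=; by case: (f x).
Qed.

Lemma cmeasurable_expi h : measurable_fun [set: T] h ->
  cmeasurable (fun x => expi (h x)).
Proof.
move=> mh; split => /=.
- apply: measurableT_comp => //; apply: continuous_measurable_fun.
  exact: continuous_cos.
- apply: measurableT_comp => //; apply: continuous_measurable_fun.
  exact: continuous_sin.
Qed.

Lemma cmeasurable_sum I (r : seq I) (P : pred I) (F : I -> T -> R[i]) :
  (forall i, cmeasurable (F i)) ->
  cmeasurable (fun x => \sum_(i <- r | P i) F i x).
Proof.
move=> mF; elim: r => [|i r ih].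
  by under eq_fun do rewrite big_nil; exact: cmeasurable_cst.
under eq_fun do rewrite big_cons; case: (P i) => //.
by apply: cmeasurableD => //; exact: mF.
Qed.

Lemma measurable_normc f : cmeasurable f ->
  measurable_fun [set: T] (fun x => normc (f x)).
Proof.
move=> [f1 f2].
have -> : (fun x => normc (f x)) =
    (fun x => Num.sqrt (complex.Re (f x) ^+ 2 + complex.Im (f x) ^+ 2)).
  by apply/funext => x; case: (f x).
apply: measurableT_comp; first by apply: continuous_measurable_fun; exact: sqrt_continuous.
by apply: measurable_funD; exact: measurable_funX.
Qed.

Variable mu : {measure set T -> \bar R}.

Definition cintable f :=
  cmeasurable f /\ (\int[mu]_x (normc (f x))%:E < +oo)%E.

Definition cint f : R[i] :=
  Complex (\int[mu]_x complex.Re (f x)) (\int[mu]_x complex.Im (f x)).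

Lemma measurable_normcE f : cmeasurable f ->
  measurable_fun [set: T] (fun x => (normc (f x))%:E).
Proof. by move=> mf; apply/measurable_EFinP; exact: measurable_normc. Qed.

Lemma cintable_normc f : cintable f ->
  mu.-integrable [set: T] (fun x => (normc (f x))%:E).
Proof.
move=> [mf foo]; apply/integrableP; split; first exact: measurable_normcE.
by under eq_integral do rewrite gee0_abs ?lee_fin ?normc_nneg//.
Qed.

Lemma cintable_Re f : cintable f ->
  mu.-integrable [set: T] (fun x => (complex.Re (f x))%:E).
Proof.
move=> fi; have [[mf _] _] := fi.
apply: le_integrable (cintable_normc fi) => //; first exact/measurable_EFinP.
by move=> x _; rewrite lee_fin [leRHS]ger0_norm ?normc_nneg// Re_le_normc.
Qed.

Lemma cintable_Im f : cintable f ->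
  mu.-integrable [set: T] (fun x => (complex.Im (f x))%:E).
Proof.
move=> fi; have [[_ mf] _] := fi.
apply: le_integrable (cintable_normc fi) => //; first exact/measurable_EFinP.
by move=> x _; rewrite lee_fin [leRHS]ger0_norm ?normc_nneg// Im_le_normc.
Qed.

Lemma cintable_le f h : cmeasurable f -> (forall x, normc (f x) <= h x) ->
  mu.-integrable [set: T] (fun x => (h x)%:E) -> cintable f.
Proof.
move=> mf fh /integrableP[mh hoo]; split => //.
apply: le_lt_trans hoo; apply: ge0_le_integral => //.
- by move=> x _; rewrite lee_fin normc_nneg.
- exact: measurable_normcE.
- exact: measurableT_comp.
- by move=> x _; rewrite lee_fin (le_trans (fh x)) ?ler_norm.
Qed.

Lemma cintableD f g : cintable f -> cintable g -> cintable (fun x => f x + g x).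
Proof.
move=> fi gi; apply: (@cintable_le _ (fun x => normc (f x) + normc (g x))).
- by apply: cmeasurableD; [exact: fi.1|exact: gi.1].
- by move=> x; exact: normc_triangle.
- by apply: (integrableD measurableT (cintable_normc fi) (cintable_normc gi)).
Qed.

Lemma cintableZ (c : R[i]) f : cintable f -> cintable (fun x => c * f x).
Proof.
move=> fi; apply: (@cintable_le _ (fun x => normc c * normc (f x))).
- by apply: cmeasurableM; [exact: cmeasurable_cst|exact: fi.1].
- by move=> x; rewrite normcM.
- exact: (integrableZl measurableT _ (cintable_normc fi)).
Qed.

Lemma cintable_conj f : cintable f -> cintable (fun x => conjc (f x)).
Proof.
move=> [mf fi]; split; first exact: cmeasurable_conj.
by under eq_integral do rewrite normc_conj.
Qed.

Lemma cintable0 : cintable (fun=> 0).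
Proof.
split; first exact: cmeasurable_cst.
by under eq_integral do rewrite normc0; rewrite integral0.
Qed.

Lemma cintable_sum I (r : seq I) (P : pred I) (F : I -> T -> R[i]) :
  (forall i, cintable (F i)) ->
  cintable (fun x => \sum_(i <- r | P i) F i x).
Proof.
move=> mF; elim: r => [|i r ih].
  by under eq_fun do rewrite big_nil; exact: cintable0.
under eq_fun do rewrite big_cons; case: (P i) => //.
by apply: cintableD => //; exact: mF.
Qed.

Lemma cintableM f g M : cintable f -> cmeasurable g ->
  (forall x, normc (g x) <= M) -> cintable (fun x => g x * f x).
Proof.
move=> fi mg gM; apply: (@cintable_le _ (fun x => M * normc (f x))).
- by apply: cmeasurableM => //; exact: fi.1.
- by move=> x; rewrite normcM ler_wpM2r// normc_nneg.
- exact: (integrableZl measurableT _ (cintable_normc fi)).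
Qed.

Lemma eq_cint f g : f =1 g -> cint f = cint g.
Proof. by move=> fg; congr cint; apply/funext. Qed.

Lemma cint0 : cint (fun=> 0) = 0.
Proof. by rewrite /cint /Rintegral/= integral0. Qed.

Lemma cintD f g : cintable f -> cintable g ->
  cint (fun x => f x + g x) = cint f + cint g.
Proof.
move=> fi gi; apply/eqP; rewrite eq_complex/=; apply/andP; split; apply/eqP.
- rewrite -RintegralD//; [|exact: cintable_Re|exact: cintable_Re].
  by apply: eq_Rintegral => x _; case: (f x) (g x) => [? ?] [? ?].
- rewrite -RintegralD//; [|exact: cintable_Im|exact: cintable_Im].
  by apply: eq_Rintegral => x _; case: (f x) (g x) => [? ?] [? ?].
Qed.

Lemma cintZ (c : R[i]) f : cintable f -> cint (fun x => c * f x) = c * cint f.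
Proof.
move=> fi; have fR := cintable_Re fi; have fI := cintable_Im fi.
case: c => a b; apply/eqP; rewrite eq_complex/=; apply/andP; split; apply/eqP.
- rewrite -!RintegralZl// -RintegralB//; last 2 first.
    exact: (integrableZl measurableT a fR).
    exact: (integrableZl measurableT b fI).
  by apply: eq_Rintegral => x _; case: (f x).
- rewrite -!RintegralZl// -RintegralD//; last 2 first.
    exact: (integrableZl measurableT a fI).
    exact: (integrableZl measurableT b fR).
  by apply: eq_Rintegral => x _; case: (f x).
Qed.

Lemma cintZr (c : R[i]) f : cintable f -> cint (fun x => f x * c) = cint f * c.
Proof.
by move=> fi; rewrite mulrC -cintZ//; apply: eq_cint => x; rewrite mulrC.
Qed.

Lemma cintN f : cintable f -> cint (fun x => - f x) = - cint f.
Proof.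
move=> fi; rewrite -mulN1r -cintZ//; apply: eq_cint => x; by rewrite mulN1r.
Qed.

Lemma cintB f g : cintable f -> cintable g ->
  cint (fun x => f x - g x) = cint f - cint g.
Proof.
move=> fi gi; rewrite cintD// ?cintN//.
have := cintableZ (-1) gi; congr cintable; apply/funext => x.
by rewrite mulN1r.
Qed.

Lemma cint_conj f : cintable f -> cint (fun x => conjc (f x)) = conjc (cint f).
Proof.
move=> fi; apply/eqP; rewrite eq_complex/=; apply/andP; split; apply/eqP.
- by apply: eq_Rintegral => x _; case: (f x).
- rewrite -mulN1r -RintegralZl//; last exact: cintable_Im.
  by apply: eq_Rintegral => x _; case: (f x) => a b /=; rewrite mulN1r.
Qed.

Lemma cint_sum I (r : seq I) (P : pred I) (F : I -> T -> R[i]) :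
  (forall i, cintable (F i)) ->
  cint (fun x => \sum_(i <- r | P i) F i x) = \sum_(i <- r | P i) cint (F i).
Proof.
move=> mF; elim: r => [|i r ih].
  by under eq_fun do rewrite big_nil; rewrite big_nil cint0.
under eq_fun do rewrite big_cons.
rewrite big_cons; case: (P i) => //.
by rewrite cintD ?ih//; exact: cintable_sum.
Qed.

Lemma cint_real h : cint (fun x => real_complex R (h x)) =
  real_complex R (\int[mu]_x h x).
Proof. by rewrite /cint /=; congr Complex; rewrite /Rintegral/= integral0. Qed.

Lemma normc_cint_le f : cintable f ->
  normc (cint f) <= \int[mu]_x normc (f x).
Proof.
move=> fi; set I := cint f.
have [I0|I0] := eqVneq (normc I) 0; first by rewrite I0 Rintegral_ge0// => x _; rewrite normc_nneg.
(* Rotating the integral onto the positive axis reduces to the real case. *)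
pose c : R[i] := conjc I * real_complex R (normc I)^-1.
have c1 : normc c = 1.
  by rewrite /c normcM normc_conj normc_real ger0_norm ?invr_ge0 ?normc_nneg// mulfV.
have -> : normc I = complex.Re (cint (fun x => c * f x)).
  rewrite cintZ// -/I /c mulrC mulrA normc_mul_conj -rmorphM /=.
  by rewrite expr2 -mulrA mulfV// mulr1.
rewrite /=; apply: le_Rintegral => //.
- by apply: cintable_Re; exact: cintableZ.
- exact: cintable_normc.
- move=> x _; rewrite (le_trans (ler_norm _))// (le_trans (Re_le_normc _))//.
  by rewrite normcM c1 mul1r.
Qed.

Lemma normc_cint_leE f : cintable f ->
  ((normc (cint f))%:E <= \int[mu]_x (normc (f x))%:E)%E.
Proof.
move=> fi; rewrite -[leRHS]fineK; first by rewrite lee_fin; exact: normc_cint_le.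
rewrite ge0_fin_numE; first exact: fi.2.
by apply: integral_ge0 => x _; rewrite lee_fin normc_nneg.
Qed.

End cint.

Section cint_fubini.
Context d1 d2 (T1 : measurableType d1) (T2 : measurableType d2) (R : realType).
Variables (m1 : {sigma_finite_measure set T1 -> \bar R}).
Variables (m2 : {sigma_finite_measure set T2 -> \bar R}).
Variable f : T1 * T2 -> R[i].
Hypothesis fi : cintable (m1 \x m2)%E f.
Hypothesis fi1 : forall x, cintable m2 (fun y => f (x, y)).
Hypothesis fi2 : forall y, cintable m1 (fun x => f (x, y)).

(** Every section is assumed integrable, not just almost every one: [fine] then loses nothing, and
    the inner integrals agree pointwise with the Fubini functions, whose measurability is known. *)
Let FR : (fun x => (complex.Re (cint m2 (fun y => f (x, y))))%:E) =
  fubini_F m2 (fun z => (complex.Re (f z))%:E).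
Proof.
apply/funext => x; rewrite /cint /= /Rintegral fineK//.
by apply: integrable_fin_num => //; exact: (cintable_Re (fi1 x)).
Qed.

Let FI : (fun x => (complex.Im (cint m2 (fun y => f (x, y))))%:E) =
  fubini_F m2 (fun z => (complex.Im (f z))%:E).
Proof.
apply/funext => x; rewrite /cint /= /Rintegral fineK//.
by apply: integrable_fin_num => //; exact: (cintable_Im (fi1 x)).
Qed.

Let GR : (fun y => (complex.Re (cint m1 (fun x => f (x, y))))%:E) =
  fubini_G m1 (fun z => (complex.Re (f z))%:E).
Proof.
apply/funext => x; rewrite /cint /= /Rintegral fineK//.
by apply: integrable_fin_num => //; exact: (cintable_Re (fi2 x)).
Qed.

Let GI : (fun y => (complex.Im (cint m1 (fun x => f (x, y))))%:E) =
  fubini_G m1 (fun z => (complex.Im (f z))%:E).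
Proof.
apply/funext => x; rewrite /cint /= /Rintegral fineK//.
by apply: integrable_fin_num => //; exact: (cintable_Im (fi2 x)).
Qed.

Lemma cmeasurable_cint : cmeasurable (fun x => cint m2 (fun y => f (x, y))).
Proof.
split; apply/measurable_EFinP.
- by rewrite [EFin \o _]FR; exact: (measurable_fubini_F (cintable_Re fi)).
- by rewrite [EFin \o _]FI; exact: (measurable_fubini_F (cintable_Im fi)).
Qed.

Lemma cintable_cint : cintable m1 (fun x => cint m2 (fun y => f (x, y))).
Proof.
split; first exact: cmeasurable_cint.
have mf := fi.1; have foo := fi.2.
have mn := measurable_normcE mf.
have n0 z : (0 <= (normc (f z))%:E)%E by rewrite lee_fin normc_nneg.
rewrite (fubini_tonelli1 _ mn n0) in foo.
apply: le_lt_trans foo; apply: ge0_le_integral => //.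
- by move=> x _; rewrite lee_fin normc_nneg.
- apply: measurable_normcE; exact: cmeasurable_cint.
- exact: (measurable_fun_fubini_tonelli_F _ mn n0).
- by move=> x _; exact: normc_cint_leE.
Qed.

Lemma cmeasurable_cint2 : cmeasurable (fun y => cint m1 (fun x => f (x, y))).
Proof.
split; apply/measurable_EFinP.
- by rewrite [EFin \o _]GR; exact: (measurable_fubini_G (cintable_Re fi)).
- by rewrite [EFin \o _]GI; exact: (measurable_fubini_G (cintable_Im fi)).
Qed.

Lemma cintable_cint2 : cintable m2 (fun y => cint m1 (fun x => f (x, y))).
Proof.
split; first exact: cmeasurable_cint2.
have mf := fi.1; have foo := fi.2.
have mn := measurable_normcE mf.
have n0 z : (0 <= (normc (f z))%:E)%E by rewrite lee_fin normc_nneg.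
rewrite (fubini_tonelli2 _ mn n0) in foo.
apply: le_lt_trans foo; apply: ge0_le_integral => //.
- by move=> x _; rewrite lee_fin normc_nneg.
- apply: measurable_normcE; exact: cmeasurable_cint2.
- exact: (measurable_fun_fubini_tonelli_G _ mn n0).
- by move=> x _; exact: normc_cint_leE.
Qed.

Lemma cint_fubini1 :
  cint (m1 \x m2)%E f = cint m1 (fun x => cint m2 (fun y => f (x, y))).
Proof.
apply/eqP; rewrite eq_complex; apply/andP; split; apply/eqP.
- rewrite {1}/cint {1}/complex.Re /Rintegral.
  rewrite -(integral12_prod_meas1 (cintable_Re fi)) -FR.
  by rewrite {2}/cint.
- rewrite {1}/cint {1}/complex.Im /Rintegral.
  rewrite -(integral12_prod_meas1 (cintable_Im fi)) -FI.
  by rewrite {2}/cint.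
Qed.

Lemma cint_fubini2 :
  cint (m1 \x m2)%E f = cint m2 (fun y => cint m1 (fun x => f (x, y))).
Proof.
apply/eqP; rewrite eq_complex; apply/andP; split; apply/eqP.
- rewrite {1}/cint {1}/complex.Re /Rintegral.
  rewrite -(integral21_prod_meas1 (cintable_Re fi)) -GR.
  by rewrite {2}/cint.
- rewrite {1}/cint {1}/complex.Im /Rintegral.
  rewrite -(integral21_prod_meas1 (cintable_Im fi)) -GI.
  by rewrite {2}/cint.
Qed.

Lemma cint_fubini : cint m1 (fun x => cint m2 (fun y => f (x, y))) =
  cint m2 (fun y => cint m1 (fun x => f (x, y))).
Proof. by rewrite -cint_fubini1 cint_fubini2. Qed.

End cint_fubini.

(** * The Fourier transform on the line *)

Section lebesgue_invariance.
Context {R : realType}.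
Notation leb := (@lebesgue_measure R).

Lemma lebesgue_pushforward_shift (c : R) A : measurable A ->
  leb A = pushforward leb (fun x : R => x + c) A.
Proof.
have mc : measurable_fun [set: measurableTypeR R] (fun x : measurableTypeR R => (x + c : measurableTypeR R)).
  by apply: measurable_funD => //; exact: measurable_cst.
pose M : {mfun measurableTypeR R >-> measurableTypeR R} :=
  HB.pack (fun x : measurableTypeR R => (x + c : measurableTypeR R)) (isMeasurableFun.Build _ _ _ _ _ mc).
move=> mA; apply: (@lebesgue_measure_unique R (pushforward leb M) _ A mA).
move=> X [[a b] /= _ <-].
rewrite /pushforward.
have -> : (fun x : R => x + c) @^-1` `]a, b] = `](a - c), (b - c)]%classic.
  by apply/seteqP; split => x /=; rewrite !in_itv/= ltrBlDr lerBrDr.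
rewrite !lebesgue_measure_itv/= !lte_fin ltrD2r.
by case: ifPn => // _; rewrite -!EFinB; congr EFin; ring.
Qed.

(** By uniqueness of Lebesgue measure only half-open intervals matter; reflection turns one into an
    interval open at the other end, of the same length. *)
Lemma lebesgue_pushforward_opp A : measurable A ->
  leb A = pushforward leb (fun x : R => - x) A.
Proof.
have mc : measurable_fun [set: measurableTypeR R] (fun x : measurableTypeR R => (- x : measurableTypeR R)).
  exact: measurable_funN.
pose M : {mfun measurableTypeR R >-> measurableTypeR R} :=
  HB.pack (fun x : measurableTypeR R => (- x : measurableTypeR R)) (isMeasurableFun.Build _ _ _ _ _ mc).
move=> mA; apply: (@lebesgue_measure_unique R (pushforward leb M) _ A mA).
move=> X [[a b] /= _ <-].
rewrite /pushforward.
have -> : (fun x : R => - x) @^-1` `]a, b] = `[(- b), (- a)[%classic.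
  by apply/seteqP; split => x /=; rewrite !in_itv/= => /andP[h1 h2]; apply/andP; split; lra.
rewrite !lebesgue_measure_itv/= !lte_fin ltrN2.
by case: ifPn => // _; rewrite -!EFinB; congr EFin; ring.
Qed.

Section invariant_map.
Variable phi : R -> R.
Hypothesis mphi : measurable_fun [set: measurableTypeR R] (phi : measurableTypeR R -> measurableTypeR R).
Hypothesis inv : forall A, measurable A -> leb A = pushforward leb phi A.

Lemma ge0_integral_invariant (f : R -> \bar R) :
  measurable_fun [set: R] f -> (forall x, 0 <= f x)%E ->
  (\int[leb]_x f (phi x) = \int[leb]_x f x)%E.
Proof.
move=> mf f0.
pose M : {mfun measurableTypeR R >-> measurableTypeR R} :=
  HB.pack phi (isMeasurableFun.Build _ _ _ _ _ mphi).
rewrite [RHS](@eq_measure_integral _ _ _ _ (pushforward leb M)); last first.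
  by move=> A mA _; exact: inv.
by rewrite (@ge0_integral_pushforward _ _ _ _ _ M)//= preimage_setT.
Qed.

Lemma integrable_invariant (f : R -> \bar R) :
  leb.-integrable [set: R] f -> leb.-integrable [set: R] (fun x => f (phi x)).
Proof.
move=> /integrableP[mf foo]; apply/integrableP; split.
  exact: (measurableT_comp mf mphi).
rewrite (@ge0_integral_invariant (fun x => `|f x|%E))//.
exact: measurableT_comp.
Qed.

Lemma integral_invariant (f : R -> \bar R) :
  leb.-integrable [set: R] f -> (\int[leb]_x f (phi x) = \int[leb]_x f x)%E.
Proof.
move=> fi.
pose M : {mfun measurableTypeR R >-> measurableTypeR R} :=
  HB.pack phi (isMeasurableFun.Build _ _ _ _ _ mphi).
rewrite [RHS](@eq_measure_integral _ _ _ _ (pushforward leb M)); last first.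
  by move=> A mA _; exact: inv.
rewrite (@integral_pushforward _ _ _ _ _ M)//= ?preimage_setT//.
- exact: measurable_int fi.
- exact: (integrable_invariant fi).
Qed.

Lemma cintable_invariant (f : R -> R[i]) :
  cintable leb f -> cintable leb (fun x => f (phi x)).
Proof.
move=> [[f1 f2] foo]; split.
  by split; [exact: (measurableT_comp f1 mphi)|exact: (measurableT_comp f2 mphi)].
rewrite (@ge0_integral_invariant (fun x => (normc (f x))%:E))//.
- exact: measurable_normcE.
- by move=> x; rewrite lee_fin normc_nneg.
Qed.

Lemma cint_invariant (f : R -> R[i]) :
  cintable leb f -> cint leb (fun x => f (phi x)) = cint leb f.
Proof.
move=> fi; rewrite /cint /Rintegral.
rewrite (integral_invariant (cintable_Re fi)).
by rewrite (integral_invariant (cintable_Im fi)).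
Qed.

End invariant_map.

Lemma measurable_shiftr (c : R) :
  measurable_fun [set: measurableTypeR R] (fun x : measurableTypeR R => (x + c : measurableTypeR R)).
Proof. by apply: measurable_funD => //; exact: measurable_cst. Qed.

Lemma ge0_integral_shift (c : R) (f : R -> \bar R) :
  measurable_fun [set: R] f -> (forall x, 0 <= f x)%E ->
  (\int[leb]_x f (x + c)%R = \int[leb]_x f x)%E.
Proof.
exact: ge0_integral_invariant (measurable_shiftr c) (@lebesgue_pushforward_shift c) f.
Qed.

Lemma cintable_shift (c : R) (f : R -> R[i]) :
  cintable leb f -> cintable leb (fun x => f (x + c)).
Proof.
exact: cintable_invariant (measurable_shiftr c) (@lebesgue_pushforward_shift c) f.
Qed.

Lemma cint_shift (c : R) (f : R -> R[i]) :
  cintable leb f -> cint leb (fun x => f (x + c)) = cint leb f.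
Proof.
exact: cint_invariant (measurable_shiftr c) (@lebesgue_pushforward_shift c) f.
Qed.

Lemma cint_opp (f : R -> R[i]) :
  cintable leb f -> cint leb (fun x => f (- x)) = cint leb f.
Proof.
by apply: (cint_invariant _ lebesgue_pushforward_opp); exact: measurable_funN.
Qed.

End lebesgue_invariance.

(** * The Abel weight and its Fourier transform, the Poisson kernel *)

Section abel_kernel.
Context {R : realType}.
Notation leb := (@lebesgue_measure R).

(** Poisson kernel of the half-plane with total mass [2 * pi], which is the normalization that makes
    it the Fourier transform of [abel e]. *)
Definition pois (e tau : R) : R := 2 * e / (e ^+ 2 + tau ^+ 2).

Definition abel (e t : R) : R := expR (- (e * `|t|)).

Lemma pois_ge0 e tau : 0 <= e -> 0 <= pois e tau.
Proof. by move=> e0; rewrite divr_ge0 ?mulr_ge0// addr_ge0 ?sqr_ge0. Qed.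

Lemma abel_ge0 e t : 0 <= abel e t.
Proof. exact: expR_ge0. Qed.

Lemma continuous_abel e : continuous (abel e).
Proof.
move=> t; apply: continuous_comp; last exact: continuous_expR.
by apply: cvgN; apply: cvgM; [exact: cvg_cst|exact: norm_continuous].
Qed.

Lemma continuous_pois e : 0 < e -> continuous (pois e).
Proof.
move=> e0 t; apply: cvgM; first exact: cvg_cst.
apply: cvgV; first by rewrite gt_eqF// ltr_pwDl ?exprn_gt0// sqr_ge0.
by apply: cvgD; [exact: cvg_cst|exact: exprn_continuous].
Qed.

(* The summand [1] makes the integrand nonnegative, as [ge0_continuous_FTC2y]
   requires. *)
Lemma integral_abel_cos_itvy (e tau : R) (b : R) : 0 < e -> `|b| <= 1 ->
  (\int[leb]_(t in `[0%R, +oo[) (expR (- (e * t)) * (1 + b * cos (t * tau)))%:E =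
   (e^-1 + b * e / (e ^+ 2 + tau ^+ 2))%:E)%E.
Proof.
move=> e0 b1.
have D0 : e ^+ 2 + tau ^+ 2 != 0 by rewrite gt_eqF// ltr_pwDl ?exprn_gt0// sqr_ge0.
(* Primitive read off from the real part of the integral of [exp (- (e - i tau) t)]. *)
pose F t : R := expR (- (e * t)) *
  (- e^-1 + b * (tau * sin (t * tau) - e * cos (t * tau)) / (e ^+ 2 + tau ^+ 2)).
have dF (t : R) : is_derive t (1 : R) F (expR (- (e * t)) * (1 + b * cos (t * tau))).
  rewrite /F; apply: is_derive_eq.
  by rewrite /GRing.scale/=; field; rewrite D0 gt_eqF.
have FE : expR (- (e * t)) @[t --> +oo] --> (0 : R).
  apply: (@cvg_comp _ _ _ (fun t => e * t) (fun t => expR (- t)) _ (pinfty_nbhs R)).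
    apply/cvgryPge => A; near=> t; rewrite -ler_pdivrMl//.
  exact: cvgr_expR.
have F0 : F t @[t --> +oo] --> (0 : R).
  pose K := e^-1 + `|b| * (`|tau| + e) / (e ^+ 2 + tau ^+ 2).
  have FK t : `|F t| <= K * expR (- (e * t)).
    rewrite /F normrM ger0_norm ?expR_ge0// mulrC ler_wpM2r ?expR_ge0//.
    apply: (le_trans (ler_normD _ _)); apply: lerD.
      by rewrite normrN gtr0_norm ?invr_gt0.
    rewrite !normrM [X in _ * X <= _]ger0_norm ?invr_ge0 ?addr_ge0 ?sqr_ge0//.
    rewrite ler_wpM2r ?invr_ge0 ?addr_ge0 ?sqr_ge0// ler_wpM2l//.
    rewrite (le_trans (ler_normB _ _))// !normrM lerD//.
      by rewrite ler_piMr// sin_max.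
    by rewrite (ger0_norm (ltW e0)) ler_piMr ?cos_max// ltW.
  have K0 : K * expR (- (e * t)) @[t --> +oo] --> (0 : R).
    by rewrite -(mulr0 K); apply: cvgM => //; exact: cvg_cst.
  apply: (@squeeze_cvgr _ _ _ _ (fun t => - (K * expR (- (e * t)))) (fun t => K * expR (- (e * t)))) => //.
    by near=> t; rewrite -ler_norml.
  by rewrite -oppr0; exact: cvgN.
rewrite (@ge0_continuous_FTC2y R (fun t => expR (- (e * t)) * (1 + b * cos (t * tau))) F 0 0)//.
- rewrite -EFinB /F mulr0 oppr0 expR0 mul0r sin0 cos0; congr EFin.
  by field; rewrite D0 gt_eqF.
- move=> t _; rewrite mulr_ge0 ?expR_ge0//.
  have : `|b * cos (t * tau)| <= 1 by rewrite normrM mulr_ile1// cos_max.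
  by rewrite ler_norml => /andP[]; lra.
- apply: continuous_subspaceT => t; apply: cvgM.
    apply: continuous_comp; last exact: continuous_expR.
    by apply: cvgN; apply: cvgM; [exact: cvg_cst|exact: cvg_id].
  apply: cvgD; first exact: cvg_cst.
  apply: cvgM; first exact: cvg_cst.
  apply: continuous_comp; last exact: continuous_cos.
  by apply: cvgM; [exact: cvg_id|exact: cvg_cst].
- have : derivable F 0 1 by have [] := dF 0.
  by move=> /derivable1_diffP/differentiable_continuous/cvg_at_right_filter.
- by move=> t _; rewrite derive1E; have [_] := dF t; apply.
Unshelve. all: by end_near. Qed.

Lemma integral_abel_cos (e tau b : R) : 0 < e -> `|b| <= 1 ->
  (\int[leb]_t (abel e t * (1 + b * cos (t * tau)))%:E =
   (2 * (e^-1 + b * e / (e ^+ 2 + tau ^+ 2)))%:E)%E.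
Proof.
move=> e0 b1; rewrite ge0_symfun_integralT.
- rewrite -set_itvcy EFinM -(integral_abel_cos_itvy _ e0 b1); congr (_ * _)%E.
  apply: eq_integral => t; rewrite inE/= in_itv/= andbT => t0.
  by rewrite /abel ger0_norm.
- move=> t; rewrite mulr_ge0 ?expR_ge0//.
  have : `|b * cos (t * tau)| <= 1 by rewrite normrM mulr_ile1// cos_max.
  by rewrite ler_norml => /andP[]; lra.
- move=> t; apply: cvgM; first exact: continuous_abel.
  apply: cvgD; first exact: cvg_cst.
  apply: cvgM; first exact: cvg_cst.
  apply: continuous_comp; last exact: continuous_cos.
  by apply: cvgM; [exact: cvg_id|exact: cvg_cst].
- by move=> t /=; rewrite /abel normrN mulNr cosN.
Qed.

Lemma integral_abel (e : R) : 0 < e -> (\int[leb]_t (abel e t)%:E = (2 / e)%:E)%E.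
Proof.
move=> e0; have := @integral_abel_cos e 0 0 e0.
rewrite normr0 ler01 => /(_ isT); rewrite !mul0r addr0 => <-.
by apply: eq_integral => t _; rewrite mul0r addr0 mulr1.
Qed.

Lemma measurable_abel e : measurable_fun [set: R] (abel e).
Proof. by apply: continuous_measurable_fun; exact: continuous_abel. Qed.

Lemma integrable_abel (e : R) : 0 < e ->
  leb.-integrable [set: R] (fun t => (abel e t)%:E).
Proof.
move=> e0; apply/integrableP; split; first by apply/measurable_EFinP; exact: measurable_abel.
under eq_integral do rewrite gee0_abs ?lee_fin ?abel_ge0//.
by rewrite integral_abel// ltry.
Qed.

Lemma cintable_abel_expi (e tau : R) : 0 < e ->
  cintable leb (fun t => real_complex R (abel e t) * expi (t * tau)).
Proof.
move=> e0; apply: (cintable_le _ _ (integrable_abel e0)).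
- apply: cmeasurableM; first by apply: cmeasurable_real; exact: measurable_abel.
  by apply: cmeasurable_expi; apply: measurable_funM => //; exact: measurable_cst.
- by move=> t; rewrite normcM normc_real normc_expi mulr1 ger0_norm ?abel_ge0.
Qed.

Lemma cint_abel_expi (e tau : R) : 0 < e ->
  cint leb (fun t => real_complex R (abel e t) * expi (t * tau)) =
  real_complex R (pois e tau).
Proof.
move=> e0; have fi := cintable_abel_expi tau e0.
(* Conjugation amounts to the reflection of [t], which preserves both [abel e] and Lebesgue measure,
   so the integral is real. *)
have Im0 : complex.Im (cint leb (fun t => real_complex R (abel e t) * expi (t * tau))) = 0.
  have : conjc (cint leb (fun t => real_complex R (abel e t) * expi (t * tau))) =
      cint leb (fun t => real_complex R (abel e t) * expi (t * tau)).
    rewrite -cint_conj// -[RHS]cint_opp//; apply: eq_cint => t.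
    by rewrite conjcM conjc_real conj_expi /abel normrN mulNr.
  case: (cint _ _) => u v /= [] /eqP; rewrite eq_sym -subr_eq0 opprK => /eqP h.
  lra.
have : complex.Re (cint leb (fun t => real_complex R (abel e t) * expi (t * tau))) = pois e tau.
  (* The oscillating integral is the difference of the two nonnegative cases [b = 1] and [b = 0]
     computed above. *)
  have h : \int[leb]_t (abel e t * cos (t * tau)) =
      \int[leb]_t (abel e t * (1 + 1 * cos (t * tau))) - \int[leb]_t abel e t.
    rewrite -RintegralB//.
    - by apply: eq_Rintegral => t _; ring.
    - have := integrableD measurableT (integrable_abel e0) (cintable_Re fi).
      apply: eq_integrable => // t _ /=.
      by rewrite -EFinD; congr EFin; rewrite mul0r subr0; ring.
    - exact: integrable_abel.
  transitivity (\int[leb]_t (abel e t * cos (t * tau))).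
    by apply: eq_Rintegral => t _ /=; rewrite mul0r subr0.
  rewrite h /Rintegral integral_abel_cos ?normr1// integral_abel//=.
  rewrite /pois; field; rewrite !gt_eqF//.
  by rewrite ltr_pwDl ?exprn_gt0// sqr_ge0.
by move: Im0; case: (cint _ _) => u v /= -> ->.
Qed.

Lemma integral_pois (e : R) : 0 < e -> (\int[leb]_t (pois e t)%:E = (2 * pi)%:E)%E.
Proof.
move=> e0; rewrite ge0_symfun_integralT; last 3 first.
- by move=> t; rewrite pois_ge0 ?ltW.
- exact: continuous_pois.
- by move=> t; rewrite /pois /= sqrrN.
rewrite -set_itvcy EFinM; congr (_ * _)%E.
pose F (t : R) : R := 2 * atan (e^-1 * t).
have dF (t : R) : is_derive t (1 : R) F (pois e t).
  rewrite /F; apply: is_derive_eq; rewrite /GRing.scale/= /pois.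
  by field; rewrite gt_eqF ?gt_eqF//= ltr_pwDl ?exprn_gt0// sqr_ge0.
have F0 : F t @[t --> +oo] --> (pi : R).
  have -> : pi = 2 * (pi / 2) :> R by field.
  apply: cvgM; first exact: cvg_cst.
  apply: (@cvg_comp _ _ _ (fun t => e^-1 * t) atan _ (pinfty_nbhs R)).
    by apply/cvgryPge => A; near=> t; rewrite -ler_pdivrMl ?invr_gt0// invrK.
  exact: cvgy_atan.
rewrite (@ge0_continuous_FTC2y R (pois e) F 0 pi)//.
- by rewrite /F mulr0 atan0 mulr0 sube0.
- by move=> t _; rewrite pois_ge0 ?ltW.
- by apply: continuous_subspaceT; exact: continuous_pois.
- have : derivable F 0 1 by have [] := dF 0.
  by move=> /derivable1_diffP/differentiable_continuous/cvg_at_right_filter.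
- by move=> t _; rewrite derive1E; have [_] := dF t; apply.
Unshelve. all: by end_near. Qed.

Lemma measurable_pois e : 0 < e -> measurable_fun [set: R] (pois e).
Proof. by move=> e0; apply: continuous_measurable_fun; exact: continuous_pois. Qed.

End abel_kernel.

(** * Upper bounds under pointwise limits *)

Section fatou_bound.
Context d (T : measurableType d) (R : realType).
Variable mu : {measure set T -> \bar R}.
Local Open Scope ereal_scope.

Lemma limn_einf_le (u : (\bar R)^nat) K : (forall n, u n <= K) -> limn_einf u <= K.
Proof.
move=> uK; rewrite limn_einf_lim; apply: lime_le.
  exact: is_cvg_einfs.
apply: nearW => n; apply: le_trans (uK n).
by apply: ereal_inf_lbound; exists n => //=.
Qed.

Lemma fatou_cvg_le (f : (T -> \bar R)^nat) (g : T -> \bar R) K :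
  (forall n, measurable_fun [set: T] (f n)) -> (forall n x, 0 <= f n x) ->
  (forall x, (f n x) @[n --> \oo] --> g x) ->
  (forall n, \int[mu]_x f n x <= K) -> \int[mu]_x g x <= K.
Proof.
move=> mf f0 fg fK; apply: le_trans (limn_einf_le fK).
apply: le_trans (fatou mu measurableT mf (fun n x _ => f0 n x)).
rewrite (@eq_integral _ _ _ _ _ (fun x => limn_einf (f ^~ x)))// => x _.
by have [] := cvg_limn_einf_sup (fg x).
Qed.

Lemma ge0_integralZl_fin (k : R) (f : T -> R) : (0 <= k)%R ->
  measurable_fun [set: T] f -> (forall x, (0 <= f x)%R) ->
  \int[mu]_x (k * f x)%:E = k%:E * \int[mu]_x (f x)%:E.
Proof.
move=> k0 mf f0; rewrite -ge0_integralZl//; first exact/measurable_EFinP.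
by move=> x _; rewrite lee_fin.
Qed.

Lemma integrableZl_fin (k : R) (f : T -> R) :
  mu.-integrable [set: T] (fun x => (f x)%:E) ->
  mu.-integrable [set: T] (fun x => (k * f x)%:E).
Proof. exact: integrableZl. Qed.

Lemma integrable_ge0_lty (f : T -> R) : (forall x, (0 <= f x)%R) ->
  mu.-integrable [set: T] (fun x => (f x)%:E) -> \int[mu]_x (f x)%:E < +oo.
Proof.
move=> f0 /integrableP[_].
by under eq_integral do rewrite gee0_abs ?lee_fin//.
Qed.

End fatou_bound.

(** * Criteria for absolute integrability on a product *)

Section product_bound.
Context d1 d2 (T1 : measurableType d1) (T2 : measurableType d2) (R : realType).
Variables (m1 : {sigma_finite_measure set T1 -> \bar R}).
Variables (m2 : {sigma_finite_measure set T2 -> \bar R}).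
Variable f : T1 * T2 -> R[i].

Lemma cmeasurable_pair1 y : cmeasurable f -> cmeasurable (fun x => f (x, y)).
Proof.
by move=> [f1 f2]; split;
  [exact: (measurable_fun_pair1 (f := fun z => complex.Re (f z)) y f1)
  |exact: (measurable_fun_pair1 (f := fun z => complex.Im (f z)) y f2)].
Qed.

Lemma cmeasurable_pair2 x : cmeasurable f -> cmeasurable (fun y => f (x, y)).
Proof.
by move=> [f1 f2]; split;
  [exact: (measurable_fun_pair2 (f := fun z => complex.Re (f z)) x f1)
  |exact: (measurable_fun_pair2 (f := fun z => complex.Im (f z)) x f2)].
Qed.

Lemma cintable_tonelli1 : cmeasurable f ->
  (\int[m1]_x \int[m2]_y (normc (f (x, y)))%:E < +oo)%E ->
  cintable (m1 \x m2)%E f.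
Proof.
move=> mf foo; split=> //.
rewrite (fubini_tonelli1 (fun z => (normc (f z))%:E))//; first exact: measurable_normcE.
by move=> z; rewrite lee_fin normc_nneg.
Qed.

Lemma cintable_tonelli2 : cmeasurable f ->
  (\int[m2]_y \int[m1]_x (normc (f (x, y)))%:E < +oo)%E ->
  cintable (m1 \x m2)%E f.
Proof.
move=> mf foo; split=> //.
rewrite (fubini_tonelli2 (fun z => (normc (f z))%:E))//; first exact: measurable_normcE.
by move=> z; rewrite lee_fin normc_nneg.
Qed.

Variables (a : T1 -> R) (b : T2 -> R).
Hypothesis mf : cmeasurable f.
Hypothesis ai : m1.-integrable [set: T1] (fun x => (a x)%:E).
Hypothesis bi : m2.-integrable [set: T2] (fun x => (b x)%:E).
Hypothesis a0 : forall x, 0 <= a x.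
Hypothesis b0 : forall x, 0 <= b x.
Hypothesis fab : forall x y, normc (f (x, y)) <= a x * b y.

(** Domination by a tensor product of integrable functions controls every section as well as the
    whole function, which yields all the hypotheses of [cint_fubini] at once. *)
Lemma cintable_section1 x : cintable m2 (fun y => f (x, y)).
Proof.
apply: (cintable_le _ (fab x)); first exact: cmeasurable_pair2.
exact: (integrableZl measurableT (a x) bi).
Qed.

Lemma cintable_section2 y : cintable m1 (fun x => f (x, y)).
Proof.
apply: (cintable_le _ (fun x => fab x y)); first exact: cmeasurable_pair1.
apply: eq_integrable (integrableZl measurableT (b y) ai) => // x _.
by rewrite -EFinM mulrC.
Qed.

Lemma cintable_prod : cintable (m1 \x m2)%E f.
Proof.
apply: cintable_tonelli1 => //.
have [ma aoo] := integrableP _ _ _ ai.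
have [mb boo] := integrableP _ _ _ bi.
apply: (@le_lt_trans _ _ (\int[m1]_x ((a x)%:E * \int[m2]_y (b y)%:E))%E).
  apply: ge0_le_integral => //.
  - by move=> x _; apply: integral_ge0 => y _; rewrite lee_fin normc_nneg.
  - apply: (measurable_fun_fubini_tonelli_F (fun z => (normc (f z))%:E)).
      exact: measurable_normcE.
    by move=> z; rewrite lee_fin normc_nneg.
  - by apply: emeasurable_funM => //; exact: measurable_cst.
  - move=> x _; rewrite -ge0_integralZl_fin//; last exact/measurable_EFinP.
    apply: ge0_le_integral => //.
    + by move=> y _; rewrite lee_fin normc_nneg.
    + by apply: measurable_normcE; exact: cmeasurable_pair2.
    + apply/measurable_EFinP; apply: measurable_funM; first exact: measurable_cst.
      exact/measurable_EFinP.
    + by move=> y _; rewrite lee_fin.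
have ioo := integrable_ge0_lty b0 bi.
have i0 : (0 <= \int[m2]_y (b y)%:E)%E by apply: integral_ge0 => y _; rewrite lee_fin.
rewrite -(@fineK _ (\int[m2]_y (b y)%:E)%E) ?ge0_fin_numE//.
under eq_integral do rewrite -EFinM mulrC.
rewrite ge0_integralZl_fin ?fine_ge0//; last exact/measurable_EFinP.
apply: lte_mul_pinfty; [by rewrite lee_fin fine_ge0|by []|].
exact: integrable_ge0_lty.
Qed.

End product_bound.

(** * Fourier integrals, and Schur's test for the Poisson kernel *)

Section fourier.
Context {R : realType}.
Notation leb := (@lebesgue_measure R).
Notation RR := (measurableTypeR R * measurableTypeR R)%type.
Implicit Types (A B : R -> R[i]).

(** Inverse Fourier transform in time, without the factor [1 / (2 pi)]. *)
Definition ftr A (t : R) : R[i] := cint leb (fun tau => expi (t * tau) * A tau).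

Lemma measurable_mulr2 : measurable_fun [set: RR] (fun z : RR => z.1 * z.2).
Proof.
by apply: (@measurable_funM _ _ _ _ (fun z : RR => z.1) (fun z : RR => z.2));
  [exact: measurable_fst|exact: measurable_snd].
Qed.

Lemma cmeasurable_fst d1 d2 (T1 : measurableType d1) (T2 : measurableType d2)
  (f : T1 -> R[i]) : cmeasurable f -> cmeasurable (fun z : T1 * T2 => f z.1).
Proof.
by move=> [f1 f2]; split; [exact: (measurableT_comp f1 measurable_fst)|
  exact: (measurableT_comp f2 measurable_fst)].
Qed.

Lemma cmeasurable_snd d1 d2 (T1 : measurableType d1) (T2 : measurableType d2)
  (f : T2 -> R[i]) : cmeasurable f -> cmeasurable (fun z : T1 * T2 => f z.2).
Proof.
by move=> [f1 f2]; split; [exact: (measurableT_comp f1 measurable_snd)|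
  exact: (measurableT_comp f2 measurable_snd)].
Qed.

Lemma cintable_ftr A t : cintable leb A ->
  cintable leb (fun tau => expi (t * tau) * A tau).
Proof.
move=> Ai; apply: (cintableM Ai (M := 1)); last by move=> x; rewrite normc_expi.
by apply: cmeasurable_expi; apply: measurable_funM => //; exact: measurable_cst.
Qed.

Lemma normc_ftr_le A t : cintable leb A ->
  normc (ftr A t) <= \int[leb]_x normc (A x).
Proof.
move=> Ai; apply: (le_trans (normc_cint_le (cintable_ftr t Ai))).
by under eq_Rintegral do rewrite normcM normc_expi mul1r.
Qed.

(** Fubini gives the measurability of a parametric integral, but [expi (t * tau) * A tau] is not
    integrable in [t]. The factor [abel 1 t] makes it so, and is divided out afterwards. *)
Lemma cmeasurable_ftr A : cintable leb A -> cmeasurable (ftr A).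
Proof.
move=> Ai.
pose F (z : RR) := real_complex R (abel 1 z.1) * (expi (z.1 * z.2) * A z.2).
have mF : cmeasurable F.
  apply: cmeasurableM.
    by apply: (@cmeasurable_fst _ _ _ _ (fun t => real_complex R (abel 1 t)));
       apply: cmeasurable_real; exact: measurable_abel.
  apply: cmeasurableM; last by apply: cmeasurable_snd; exact: Ai.1.
  by apply: cmeasurable_expi; exact: measurable_mulr2.
have FB x y : normc (F (x, y)) <= abel 1 x * normc (A y).
  by rewrite /F !normcM normc_real normc_expi mul1r ger0_norm ?abel_ge0.
have ai := integrable_abel (@ltr01 R).
have bi := cintable_normc Ai.
have a0 := abel_ge0 (1 : R).
have b0 x := normc_nneg (A x).
have := cmeasurable_cint (cintable_prod mF ai bi a0 b0 FB)
  (cintable_section1 mF bi FB).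
have mI : @cmeasurable _ (measurableTypeR R) _ (fun t : R => real_complex R (expR `|t|)).
  apply: cmeasurable_real; apply: continuous_measurable_fun => t.
  by apply: continuous_comp; [exact: norm_continuous|exact: continuous_expR].
move=> /(cmeasurableM mI); congr cmeasurable; apply/funext => t.
rewrite /F /= cintZ; last exact: cintable_ftr.
rewrite mulrA -rmorphM /abel /= -expRD mul1r subrr expR0.
by rewrite -/(real_complex R 1) rmorph1 mul1r.
Qed.

Lemma poisBC (e t s : R) : pois e (t - s) = pois e (s - t).
Proof. by rewrite /pois -(sqrrN (t - s)) opprB. Qed.

Lemma integral_pois_sub (e t : R) : 0 < e ->
  (\int[leb]_s (pois e (t - s))%:E = (2 * pi)%:E)%E.
Proof.
move=> e0; rewrite -(integral_pois e0) -[RHS](@ge0_integral_shift _ (- t) (fun s => (pois e s)%:E)).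
- by apply: eq_integral => s _; rewrite poisBC.
- by apply/measurable_EFinP; exact: measurable_pois.
- by move=> s; rewrite lee_fin pois_ge0 ?ltW.
Qed.

Lemma measurable_pois_sub (e t : R) : 0 < e ->
  measurable_fun [set: R] (fun s => pois e (t - s)).
Proof.
move=> e0; apply: (measurableT_comp (measurable_pois e0)).
by apply: measurable_funB => //; exact: measurable_cst.
Qed.

Lemma measurable_pois_sub2 (e : R) : 0 < e ->
  measurable_fun [set: RR] (fun z : RR => pois e (z.1 - z.2)).
Proof.
move=> e0; apply: (measurableT_comp (measurable_pois e0)).
by apply: (@measurable_funB _ _ _ _ (fun z : RR => z.1) (fun z : RR => z.2));
  [exact: measurable_fst|exact: measurable_snd].
Qed.

Lemma pois_le (e t : R) : 0 < e -> pois e t <= 2 * e / e ^+ 2.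
Proof.
move=> e0; have e2 : 0 <= 2 * e by rewrite mulr_ge0 ?ltW.
rewrite /pois ler_wpM2l//.
by rewrite lef_pV2 ?posrE ?lerDl ?sqr_ge0// ?ltr_pwDl ?exprn_gt0// sqr_ge0.
Qed.

(** Schur's test: [g t * g s] is at most the mean of the two squares, and the kernel is symmetric
    with mass [2 * pi] in either variable. *)
Lemma schur_pois (e : R) (g : R -> R) : 0 < e -> measurable_fun [set: R] g ->
  (forall x, 0 <= g x) ->
  (\int[leb]_t \int[leb]_s (g t * (g s * pois e (t - s)))%:E <=
   (2 * pi)%:E * \int[leb]_t (g t ^+ 2)%:E)%E.
Proof.
move=> e0 mg g0.
have p0 t : 0 <= pois e t by rewrite pois_ge0 ?ltW.
have mg2 : measurable_fun [set: R] (fun t => g t ^+ 2) by exact: measurable_funX.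
have mp := measurable_pois_sub2 e0.
pose h1 (z : RR) := (2^-1 * (g z.1 ^+ 2 * pois e (z.1 - z.2)))%:E.
pose h2 (z : RR) := (2^-1 * (g z.2 ^+ 2 * pois e (z.1 - z.2)))%:E.
have mh1 : measurable_fun [set: RR] h1.
  apply/measurable_EFinP/measurable_funM; first exact: measurable_cst.
  apply: measurable_funM => //.
  exact: (measurableT_comp mg2 measurable_fst).
have mh2 : measurable_fun [set: RR] h2.
  apply/measurable_EFinP/measurable_funM; first exact: measurable_cst.
  apply: measurable_funM => //.
  exact: (measurableT_comp mg2 measurable_snd).
have h10 z : (0 <= h1 z)%E by rewrite lee_fin mulr_ge0 ?invr_ge0// mulr_ge0 ?sqr_ge0.
have h20 z : (0 <= h2 z)%E by rewrite lee_fin mulr_ge0 ?invr_ge0// mulr_ge0 ?sqr_ge0.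
have I1 : (\int[leb]_t \int[leb]_s h1 (t, s) =
    (2^-1 * (2 * pi))%:E * \int[leb]_t (g t ^+ 2)%:E)%E.
  rewrite -ge0_integralZl_fin ?mulr_ge0 ?pi_ge0//; last by move=> x; rewrite sqr_ge0.
  apply: eq_integral => t _; rewrite /h1 /=.
  under eq_integral do rewrite mulrA.
  rewrite ge0_integralZl_fin ?mulr_ge0 ?sqr_ge0//; last exact: measurable_pois_sub.
  by rewrite integral_pois_sub// -EFinM; congr EFin; ring.
have I2 : (\int[leb]_t \int[leb]_s h2 (t, s) =
    (2^-1 * (2 * pi))%:E * \int[leb]_t (g t ^+ 2)%:E)%E.
  rewrite (fubini_tonelli h2 mh2 h20).
  rewrite -I1; apply: eq_integral => t _; apply: eq_integral => s _.
  by rewrite /h1 /h2 /= poisBC.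
have -> : ((2 * pi)%:E * \int[leb]_t (g t ^+ 2)%:E =
    \int[leb]_t \int[leb]_s (h1 (t, s) + h2 (t, s)))%E.
  transitivity (\int[leb]_t (\int[leb]_s h1 (t, s) + \int[leb]_s h2 (t, s)))%E.
    rewrite ge0_integralD//.
    - rewrite I1 I2 -ge0_muleDl ?lee_fin ?mulr_ge0 ?pi_ge0//.
      by rewrite -EFinD; congr (_%:E * _)%E; field.
    - by move=> x _; apply: integral_ge0.
    - exact: (measurable_fun_fubini_tonelli_F h1).
    - by move=> x _; apply: integral_ge0.
    - exact: (measurable_fun_fubini_tonelli_F h2).
  apply: eq_integral => t _; rewrite ge0_integralD//.
  - exact: (measurable_fun_pair2 (f := h1) t).
  - exact: (measurable_fun_pair2 (f := h2) t).
pose h3 (z : RR) := (g z.1 * (g z.2 * pois e (z.1 - z.2)))%:E.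
have mh3 : measurable_fun [set: RR] h3.
  apply/measurable_EFinP/measurable_funM.
    exact: (measurableT_comp mg measurable_fst).
  apply: measurable_funM => //.
  exact: (measurableT_comp mg measurable_snd).
have h30 z : (0 <= h3 z)%E by rewrite lee_fin mulr_ge0// mulr_ge0.
have mh12 : measurable_fun [set: RR] (fun z => h1 z + h2 z)%E.
  exact: emeasurable_funD.
have h120 z : (0 <= h1 z + h2 z)%E by exact: adde_ge0.
apply: ge0_le_integral => //.
- by move=> x _; apply: integral_ge0 => s _; exact: (h30 (x, s)).
- exact: (measurable_fun_fubini_tonelli_F h3).
- exact: (measurable_fun_fubini_tonelli_F (fun z => h1 z + h2 z)%E).
- move=> t _; apply: ge0_le_integral => //.
  + by move=> s _; exact: (h30 (t, s)).
  + exact: (measurable_fun_pair2 (f := h3) t).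
  + exact: (measurable_fun_pair2 (f := fun z => h1 z + h2 z)%E t).
  + move=> s _; rewrite /h1 /h2 -EFinD lee_fin /=.
    have := sqr_ge0 (g t - g s); have := p0 (t - s).
    nra.
Qed.

End fourier.

Local Arguments normc : simpl never.
Local Arguments expi : simpl never.

(** * Plancherel's inequality *)

Section plancherel.
Context {R : realType}.
Notation leb := (@lebesgue_measure R).
Notation RR := (measurableTypeR R * measurableTypeR R)%type.
Implicit Types (A B : R -> R[i]).

Lemma cintable_conj_pois (e : R) B y : 0 < e -> cintable leb B ->
  cintable leb (fun s => conjc (B s) * real_complex R (pois e (y - s))).
Proof.
move=> e0 Bi; have [K poisK] : exists K, forall t, pois e t <= K.
  by exists (2 * e / e ^+ 2) => t; exact: pois_le.
  apply: (@cintable_le _ (measurableTypeR R) _ leb _ (fun s => K * normc (B s))).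
  - apply: cmeasurableM; first by apply: cmeasurable_conj; exact: Bi.1.
    by apply: cmeasurable_real; exact: measurable_pois_sub.
  - move=> s; rewrite normcM normc_conj normc_real (ger0_norm (pois_ge0 _ (ltW e0))).
    by rewrite mulrC ler_wpM2r ?normc_nneg.
  - exact: integrableZl_fin (cintable_normc Bi).
Qed.

Lemma normc_cint_pois_le (e : R) B : 0 < e -> cintable leb B ->
  cintable leb (fun y => B y *
    cint leb (fun s => conjc (B s) * real_complex R (pois e (y - s)))) ->
  ((normc (cint leb (fun y => B y *
    cint leb (fun s => conjc (B s) * real_complex R (pois e (y - s))))))%:E <=
   (2 * pi)%:E * \int[leb]_t (normc (B t) ^+ 2)%:E)%E.
Proof.
move=> e0 Bi Ji; have Hi y := cintable_conj_pois y e0 Bi.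
apply: le_trans (normc_cint_leE Ji) _.
apply: le_trans (schur_pois e0 (measurable_normc Bi.1) (fun x => normc_nneg (B x))).
apply: ge0_le_integral => [//|y _|||y _].
- by rewrite lee_fin normc_nneg.
- exact: measurable_normcE Ji.1.
- apply: (measurable_fun_fubini_tonelli_F (fun z : RR =>
    (normc (B z.1) * (normc (B z.2) * pois e (z.1 - z.2)))%:E)).
    have mB : measurable_fun [set: measurableTypeR R] (fun x => normc (B x)) := measurable_normc Bi.1.
    apply/measurable_EFinP/measurable_funM.
      exact: (measurableT_comp mB measurable_fst).
    apply: measurable_funM; last exact: measurable_pois_sub2.
    exact: (measurableT_comp mB measurable_snd).
  move=> z; rewrite lee_fin mulr_ge0 ?normc_nneg// mulr_ge0 ?normc_nneg//.
  by rewrite pois_ge0 ?ltW.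
rewrite normcM EFinM ge0_integralZl_fin ?normc_nneg//.
- apply: lee_wpmul2l; first by rewrite lee_fin normc_nneg.
  apply: (le_trans (normc_cint_leE (Hi y))); rewrite le_eqVlt; apply/orP; left.
  apply/eqP; apply: eq_integral => s _; rewrite normcM normc_conj normc_real.
  by rewrite ger0_norm// pois_ge0// ltW.
- apply: measurable_funM; last exact: measurable_pois_sub.
  exact: measurable_normc Bi.1.
- by move=> s; rewrite mulr_ge0 ?normc_nneg ?pois_ge0 ?ltW.
Qed.

(** The weight makes the left side finite before anything is known about [B] in L^2. Expanding the
    square and integrating in [t] first produces the quadratic form of [B] with kernel
    [pois e (y - s)], to which Schur's test applies. *)
Lemma plancherel_abel (e : R) B : 0 < e -> cintable leb B ->
  (\int[leb]_t (abel e t * normc (ftr B t) ^+ 2)%:E <=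
   (2 * pi)%:E * \int[leb]_t (normc (B t) ^+ 2)%:E)%E.
Proof.
move=> e0 Bi; set V := ftr B.
have mV : cmeasurable V by exact: cmeasurable_ftr.
pose N := \int[leb]_x normc (B x).
have VN t : normc (V t) <= N by exact: normc_ftr_le.
have N0 : 0 <= N by rewrite (le_trans (normc_nneg (V 0))).
clearbody N.
have ai := integrable_abel e0.
have a0 := abel_ge0 e.
have b0 x : 0 <= N * normc (B x) by rewrite mulr_ge0 ?normc_nneg.
have bi : leb.-integrable [set: measurableTypeR R] (fun x => (N * normc (B x))%:E).
  exact: integrableZl_fin (cintable_normc Bi).
have b'0 x := normc_nneg (B x).
have b'i := cintable_normc Bi.
have ma : cmeasurable (fun z : RR => real_complex R (abel e z.1)).
  apply: (@cmeasurable_fst _ _ _ _ _ (fun t => real_complex R (abel e t))).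
  by apply: cmeasurable_real; exact: measurable_abel.
have mexp : cmeasurable (fun z : RR => expi (z.1 * z.2)).
  by apply: cmeasurable_expi; exact: measurable_mulr2.
have mB2 : cmeasurable (fun z : RR => B z.2).
  by apply: cmeasurable_snd; exact: Bi.1.
pose F (z : RR) := real_complex R (abel e z.1) * conjc (V z.1) *
  (expi (z.1 * z.2) * B z.2).
have mF : cmeasurable F.
  apply: cmeasurableM; last exact: cmeasurableM.
  apply: cmeasurableM => //; apply: cmeasurable_conj.
  exact: (@cmeasurable_fst _ _ _ _ _ V).
have FB x y : normc (F (x, y)) <= abel e x * (N * normc (B y)).
  rewrite /F !normcM normc_real normc_expi mul1r ger0_norm// normc_conj -mulrA.
  by rewrite ler_wpM2l// ler_wpM2r ?normc_nneg.
have F1 x := cintable_section1 mF bi FB x.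
have F2 y := cintable_section2 mF ai FB y.
have Fub := cint_fubini (cintable_prod mF ai bi a0 b0 FB) F1 F2.
have lhs : cint leb (fun x => cint leb (fun y => F (x, y))) =
    real_complex R (\int[leb]_t (abel e t * normc (V t) ^+ 2)).
  rewrite -cint_real; apply: eq_cint => t.
  transitivity (cint leb (fun y => real_complex R (abel e t) * conjc (V t) *
      (expi (t * y) * B y))); first by [].
  rewrite cintZ; last exact: cintable_ftr.
  by rewrite -/(ftr B t) -/(V t) -mulrA (mulrC (conjc _)) normc_mul_conj -rmorphM.
(* A second use of Fubini, for fixed [y]: the conjugate of [V] is expanded as an integral in [s],
   and the remaining integral in [t] is the transform of [abel e]. *)
have rhs y : cint leb (fun x => F (x, y)) =
    B y * cint leb (fun s => conjc (B s) * real_complex R (pois e (y - s))).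
  pose G (z : RR) := real_complex R (abel e z.1) * expi (z.1 * (y - z.2)) *
    conjc (B z.2).
  have mG : cmeasurable G.
    apply: cmeasurableM; last exact: cmeasurable_conj.
    apply: cmeasurableM; first exact: ma.
    apply: cmeasurable_expi.
    apply: measurable_funM; first exact: measurable_fst.
    by apply: measurable_funB; [exact: measurable_cst|exact: measurable_snd].
  have GB x s : normc (G (x, s)) <= abel e x * normc (B s).
    rewrite /G normcM normcM normc_real normc_expi mulr1 normc_conj.
    by rewrite (ger0_norm (a0 x)).
  have G1 x := cintable_section1 mG b'i GB x.
  have G2 s := cintable_section2 mG ai GB s.
  have FubG := cint_fubini (cintable_prod mG ai b'i a0 b'0 GB) G1 G2.
  transitivity (B y * cint leb (fun x => cint leb (fun s => G (x, s)))).
    rewrite -cintZ; last exact: (cintable_cint (cintable_prod mG ai b'i a0 b'0 GB) G1).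
    apply: eq_cint => x.
    have -> : F (x, y) = real_complex R (abel e x) * conjc (V x) * (expi (x * y) * B y) by [].
    rewrite /V /ftr -cint_conj; last exact: cintable_ftr.
    have -> (c v w b : R[i]) : c * v * (w * b) = b * (c * w * v) by ring.
    congr (_ * _); rewrite -cintZ; last by apply: cintable_conj; exact: cintable_ftr.
    apply: eq_cint => s.
    have -> : G (x, s) = real_complex R (abel e x) * expi (x * (y - s)) * conjc (B s) by [].
    rewrite conjcM conj_expi mulrA -(mulrA _ (expi (x * y))) -expiD.
    by congr (_ * expi _ * _); ring.
  rewrite FubG; congr (_ * _); apply: eq_cint => s.
  rewrite -(cint_abel_expi (y - s) e0) -cintZ; last exact: cintable_abel_expi.
  by apply: eq_cint => x; rewrite mulrC.
have IE : \int[leb]_t (abel e t * normc (V t) ^+ 2) = normc (cint leb (fun y =>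
    B y * cint leb (fun s => conjc (B s) * real_complex R (pois e (y - s))))).
  transitivity (normc (real_complex R (\int[leb]_t (abel e t * normc (V t) ^+ 2)))); last first.
    by congr normc; rewrite -lhs Fub; apply: eq_cint => y; exact: rhs.
  have : 0 <= \int[leb]_t (abel e t * normc (V t) ^+ 2).
    by apply: Rintegral_ge0 => t _; rewrite mulr_ge0 ?sqr_ge0.
  by move: (\int[leb]_t _) => I I0; rewrite normc_real ger0_norm.
(* A real-valued integral could hide an infinite one behind the default value of [fine];
   integrability rules this out. *)
have Ifin : leb.-integrable [set: measurableTypeR R]
    (fun t => (abel e t * normc (V t) ^+ 2)%:E).
  have gi : leb.-integrable [set: measurableTypeR R] (fun t => (N ^+ 2 * abel e t)%:E).
    exact: integrableZl_fin ai.
  apply: (le_integrable measurableT _ _ gi).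
  - apply/measurable_EFinP/measurable_funM; first exact: measurable_abel.
    by apply: measurable_funX; exact: measurable_normc.
  - move=> t _; rewrite lee_fin /=.
    move: (normc (V t)) (VN t) (normc_nneg (V t)) (abel e t) (a0 t) => v vN v0 a a'0.
    have {}N0 := le_trans v0 vN.
    clear -vN v0 a'0 N0; rewrite !ger0_norm ?mulr_ge0 ?sqr_ge0//.
    by rewrite mulrC ler_wpM2r//; apply: lerXn2r.
rewrite -[leLHS]fineK; last exact: integrable_fin_num.
rewrite -/(Rintegral leb setT (fun t => abel e t * normc (V t) ^+ 2)) IE.
have Ji : cintable leb (fun y => B y * cint leb (fun s => conjc (B s) * real_complex R (pois e (y - s)))).
  have := cintable_cint2 (cintable_prod mF ai bi a0 b0 FB) F2.
  by congr cintable; apply/funext => y; exact: rhs.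
exact: normc_cint_pois_le.
Qed.

(** Removing the weight by Fatou as [e] tends to [0] yields only an inequality, which suffices for
    an upper bound. *)
Lemma plancherel_le B : cintable leb B ->
  (\int[leb]_t (normc (ftr B t) ^+ 2)%:E <=
   (2 * pi)%:E * \int[leb]_t (normc (B t) ^+ 2)%:E)%E.
Proof.
move=> Bi; have mV := cmeasurable_ftr Bi.
apply: (@fatou_cvg_le _ (measurableTypeR R) _ leb (fun n t => (abel n.+1%:R^-1 t * normc (ftr B t) ^+ 2)%:E)).
- move=> n; apply/measurable_EFinP/measurable_funM; first exact: measurable_abel.
  by apply: measurable_funX; exact: measurable_normc.
- by move=> n x; rewrite lee_fin mulr_ge0 ?abel_ge0 ?sqr_ge0.
- move=> t; apply: cvg_EFin; first exact: nearW.
  have h : (fun n : nat => - (n.+1%:R^-1 * `|t|)) @ \oo --> (0 : R).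
    rewrite -oppr0 -(mul0r `|t|); apply: cvgN; apply: cvgMr_tmp.
    exact: cvg_harmonic.
  rewrite -[X in _ --> X]mul1r; apply: cvgMr_tmp; rewrite -[X in _ --> X]expR0.
  by apply: cvg_comp h _; exact: continuous_expR.
- by move=> n; exact: plancherel_abel.
Qed.

End plancherel.

(** * The convolution theorem *)

Section convolution.
Context {R : realType}.
Notation leb := (@lebesgue_measure R).
Notation RR := (measurableTypeR R * measurableTypeR R)%type.
Implicit Types (A B : R -> R[i]).

Definition conv A B (tau : R) : R[i] := cint leb (fun s => A s * B (tau - s)).

Lemma measurable_subr2 : measurable_fun [set: RR] (fun z : RR => z.1 - z.2).
Proof.
by apply: (@measurable_funB _ _ _ _ (fun z : RR => z.1) (fun z : RR => z.2));
  [exact: measurable_fst|exact: measurable_snd].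
Qed.

Lemma cmeasurable_subr2 B : cmeasurable B -> cmeasurable (fun z : RR => B (z.1 - z.2)).
Proof.
by move=> [B1 B2]; split; [exact: (measurableT_comp B1 measurable_subr2)|
  exact: (measurableT_comp B2 measurable_subr2)].
Qed.

Variables (A B : R -> R[i]) (M : R).
Hypothesis (Ai : cintable leb A) (Bi : cintable leb B).
Hypothesis BM : forall t, normc (B t) <= M.

Let F t (z : RR) := expi (t * z.1) * (A z.2 * B (z.1 - z.2)).

Let mF t : cmeasurable (F t).
Proof.
apply: cmeasurableM.
  apply: cmeasurable_expi; apply: measurable_funM; first exact: measurable_cst.
  exact: measurable_fst.
apply: cmeasurableM; first by apply: cmeasurable_snd; exact: Ai.1.
by apply: cmeasurable_subr2; exact: Bi.1.
Qed.

(** The bound on [B] makes the convolution integral converge at every point and not only almost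
    everywhere. *)
Let F1 t x : cintable leb (fun y => F t (x, y)).
Proof.
apply: (@cintable_le _ (measurableTypeR R) _ leb _ (fun s => M * normc (A s))).
- exact: cmeasurable_pair2.
- move=> s; rewrite /F !normcM normc_expi mul1r mulrC.
  by rewrite ler_wpM2r ?normc_nneg.
- exact: (integrableZl_fin M (cintable_normc Ai)).
Qed.

Let F2 t y : cintable leb (fun x => F t (x, y)).
Proof.
apply: (@cintable_le _ (measurableTypeR R) _ leb _ (fun s => normc (A y) * normc (B (s - y)))).
- exact: cmeasurable_pair1.
- by move=> s; rewrite /F !normcM normc_expi mul1r.
- exact: (integrableZl_fin _ (cintable_normc (cintable_shift (- y) Bi))).
Qed.

(** Tonelli with the shifted variable inside factors the double integral into the product of the two
    L^1 norms. *)
Let Fi t : cintable (leb \x leb)%E (F t).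
Proof.
apply: cintable_tonelli2 => //.
pose N := (\int[leb]_x (normc (B x))%:E)%E.
have mBn : measurable_fun [set: measurableTypeR R] (fun x => normc (B x)) := measurable_normc Bi.1.
rewrite (@eq_integral _ (measurableTypeR R) _ _ _ (fun y => ((fine N) * normc (A y))%:E)).
  rewrite ge0_integralZl_fin.
  - apply: lte_mul_pinfty; [|by []|exact: Ai.2].
    by rewrite lee_fin fine_ge0// integral_ge0// => x _; rewrite lee_fin normc_nneg.
  - by rewrite fine_ge0// integral_ge0// => x _; rewrite lee_fin normc_nneg.
  - exact: measurable_normc Ai.1.
  - by move=> x; exact: normc_nneg.
move=> y _.
transitivity (\int[leb]_x (normc (A y) * normc (B (x - y)))%:E)%E.
  by apply: eq_integral => x _; rewrite /F !normcM normc_expi mul1r.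
rewrite ge0_integralZl_fin ?normc_nneg//; last 2 first.
- exact: (measurableT_comp mBn (measurable_shiftr (- y))).
- by move=> x; exact: normc_nneg.
rewrite (ge0_integral_shift (- y) (f := fun x => (normc (B x))%:E)).
- rewrite -/N -[X in (_ * X)%E]fineK ?ge0_fin_numE; last 2 first.
  + exact: Bi.2.
  + by apply: integral_ge0 => x _; rewrite lee_fin normc_nneg.
  by rewrite -EFinM mulrC.
- exact/measurable_EFinP.
- by move=> x; rewrite lee_fin normc_nneg.
Qed.

Lemma cintable_conv_section x : cintable leb (fun s => A s * B (x - s)).
Proof.
have := F1 0 x; congr cintable; apply/funext => y.
by rewrite /F mul0r expi0 mul1r.
Qed.

Lemma cintable_conv : cintable leb (conv A B).
Proof.
have := cintable_cint (Fi 0) (F1 0); congr cintable; apply/funext => x.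
by apply: eq_cint => y; rewrite /F mul0r expi0 mul1r.
Qed.

Lemma ftr_conv t : ftr (conv A B) t = ftr A t * ftr B t.
Proof.
transitivity (cint leb (fun x => cint leb (fun y => F t (x, y)))).
  apply: eq_cint => x; rewrite /conv -cintZ//; exact: cintable_conv_section.
rewrite (cint_fubini (Fi t) (F1 t) (F2 t)) /ftr -cintZr; last exact: cintable_ftr.
apply: eq_cint => y.
transitivity (cint leb (fun x => (expi (t * y) * A y) * (expi (t * (x - y)) * B (x - y)))).
  apply: eq_cint => x; rewrite /F /=.
  have -> : t * x = t * y + t * (x - y) by ring.
  by rewrite expiD; ring.
rewrite cintZ; last exact: (cintable_shift (- y) (cintable_ftr t Bi)).
by rewrite (cint_shift (- y) (cintable_ftr t Bi)).
Qed.

End convolution.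

Lemma real_complexM (R : realType) (a b : R) :
  real_complex R (a * b) = real_complex R a * real_complex R b.
Proof. exact: (rmorphM (real_complex R)). Qed.

Lemma real_complex_sum (R : realType) I (r : seq I) (P : pred I) (F : I -> R) :
  real_complex R (\sum_(i <- r | P i) F i) = \sum_(i <- r | P i) real_complex R (F i).
Proof. exact: (rmorph_sum (real_complex R)). Qed.

Lemma conjc_sum (R : realType) I (r : seq I) (P : pred I) (F : I -> R[i]) :
  conjc (\sum_(i <- r | P i) F i) = \sum_(i <- r | P i) conjc (F i).
Proof. exact: (raddf_sum (@conjc R)). Qed.

(** * The bilinear estimate *)

Section circle.
Context {R : realType}.
Notation leb := (@lebesgue_measure R).

Definition circ : set R := [set x | 0 <= x < 2 * pi].

Lemma circE : circ = `[0, 2 * pi[%classic.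
Proof. by apply/seteqP; split => x /=; rewrite in_itv. Qed.

Lemma measurable_circ : measurable (circ : set (measurableTypeR R)).
Proof. by rewrite circE. Qed.

Lemma indic_circ_ge0 x : 0 <= (\1_circ x : R).
Proof. by rewrite indicE ler0n. Qed.

Lemma measurable_indic_circ : measurable_fun [set: measurableTypeR R] (\1_circ : R -> R).
Proof. by apply: measurable_indic; exact: measurable_circ. Qed.

Lemma lebesgue_circ : (leb circ = (2 * pi)%:E)%E.
Proof. by rewrite circE lebesgue_measure_itv/= lte_fin mulr_gt0 ?pi_gt0// oppr0 adde0. Qed.

Lemma integral_indic_circ : (\int[leb]_x (\1_circ x)%:E = (2 * pi)%:E)%E.
Proof. by rewrite (integral_indic leb measurableT measurable_circ) setIT; exact: lebesgue_circ. Qed.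

Lemma integrable_indic_circ : leb.-integrable [set: measurableTypeR R] (fun x => (\1_circ x)%:E).
Proof.
apply/integrableP; split; first by apply/measurable_EFinP; exact: measurable_indic_circ.
under eq_integral do rewrite gee0_abs ?lee_fin ?indic_circ_ge0//.
by rewrite integral_indic_circ ltry.
Qed.

Lemma integral_circ_mkcond (f : R -> \bar R) :
  (\int[leb]_(x in circ) f x = \int[leb]_x ((\1_circ x)%:E * f x))%E.
Proof.
rewrite integral_mkcond; apply: eq_integral => x _; rewrite patchE indicE.
by case: (x \in circ); rewrite ?mul1e ?mul0e.
Qed.

Lemma Rintegral_circ_mkcond (f : R -> R) :
  \int[leb]_(x in circ) f x = \int[leb]_x (\1_circ x * f x).
Proof. by rewrite /Rintegral integral_circ_mkcond. Qed.

Lemma expi2pi (z : int) : expi (z%:~R * (2 * pi)) = 1 :> R[i].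
Proof.
have e1 : expi (2 * pi) = 1 :> R[i].
  by rewrite mulr_natl /expi cos2pi sin2pi.
have en (n : nat) : expi (n%:R * (2 * pi)) = 1 :> R[i].
  by rewrite mulrC expi_natmul e1 expr1n.
case: z => n; first exact: en.
rewrite NegzE mulrNz mulNr -conj_expi.
by rewrite (en n.+1) conjc1.
Qed.

Lemma integral_circ_cos_sin (z : int) : z != 0 ->
  \int[leb]_(x in circ) cos (z%:~R * x) = 0 :> R /\
  \int[leb]_(x in circ) sin (z%:~R * x) = 0 :> R.
Proof.
move=> z0; set m : R := z%:~R.
have m0 : m != 0 by rewrite intr_eq0.
have [c1 s1] : cos (m * (2 * pi)) = 1 /\ sin (m * (2 * pi)) = 0.
  by have := expi2pi z; rewrite /expi => -[].
have pi0 : 0 < 2 * pi :> R by rewrite mulr_gt0 ?pi_gt0.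
have FTC (f F : R -> R) : (forall x : R, is_derive x (1 : R) F (f x)) -> continuous f ->
    F (2 * pi) = F 0 -> \int[leb]_(x in circ) f x = 0.
  move=> dF cf Fe.
  have cF : continuous F.
    move=> x; have [d _] := dF x.
    by move/derivable1_diffP/differentiable_continuous : d.
  rewrite /Rintegral circE integral_itv_bndo_bndc; last first.
    by apply/measurable_EFinP/measurable_funTS; exact: continuous_measurable_fun.
  rewrite (@continuous_FTC2 R f F 0 (2 * pi) pi0).
  - by rewrite -EFinB /= Fe subrr.
  - exact: continuous_subspaceT.
  - split; first by move=> x _; have [] := dF x.
    + by apply: cvg_at_right_filter; exact: cF.
    + by apply: cvg_at_left_filter; exact: cF.
  - by move=> x _; rewrite derive1E; have [_] := dF x; apply.
have cm : continuous (fun x : R => m * x).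
  by move=> x; apply: cvgM; [exact: cvg_cst|exact: cvg_id].
split.
- apply: (FTC _ (fun x => m^-1 * sin (m * x))).
  + by move=> x; apply: is_derive_eq; rewrite /GRing.scale/=; field.
  + by move=> x; apply: continuous_comp; [exact: cm|exact: continuous_cos].
  + by rewrite mulr0 sin0 s1.
- apply: (FTC _ (fun x => - m^-1 * cos (m * x))).
  + by move=> x; apply: is_derive_eq; rewrite /GRing.scale/=; field.
  + by move=> x; apply: continuous_comp; [exact: cm|exact: continuous_sin].
  + by rewrite mulr0 cos0 c1.
Qed.

Lemma measurable_mull (c : R) : measurable_fun [set: measurableTypeR R] (fun x : measurableTypeR R => c * x).
Proof. by apply: measurable_funM => //; exact: measurable_cst. Qed.

Lemma cintable_circ_expi (c : R) :
  cintable leb (fun x => real_complex R (\1_circ x) * expi (c * x)).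
Proof.
apply: (@cintable_le _ (measurableTypeR R) _ leb _ (\1_circ) _ _ integrable_indic_circ).
- apply: cmeasurableM; first by apply: cmeasurable_real; exact: measurable_indic_circ.
  by apply: cmeasurable_expi; exact: measurable_mull.
- by move=> x; rewrite normcM normc_real normc_expi mulr1 ger0_norm ?indic_circ_ge0.
Qed.

Lemma cint_circ_expi (z : int) :
  cint leb (fun x => real_complex R (\1_circ x) * expi (z%:~R * x)) =
  real_complex R ((z == 0)%:R * (2 * pi)).
Proof.
have [->|z0] := eqVneq z 0.
  rewrite mul1r -[in RHS](_ : \int[leb]_x (\1_circ x) = 2 * pi); last first.
    by rewrite /Rintegral integral_indic_circ.
  by rewrite -cint_real; apply: eq_cint => x; rewrite mul0r expi0 mulr1.
have [h1 h2] := integral_circ_cos_sin z0.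
rewrite mul0r /cint; congr Complex.
- rewrite -[RHS]h1 Rintegral_circ_mkcond; apply: eq_Rintegral => x _.
  by rewrite /expi /= mul0r subr0.
- rewrite -[RHS]h2 Rintegral_circ_mkcond; apply: eq_Rintegral => x _.
  by rewrite /expi /= mul0r addr0.
Qed.

(** The factor [s] allows one statement to serve for nonnegative and for nonpositive frequencies;
    being nonzero, it keeps the frequencies distinct. *)
Lemma parseval_circ (s : int) n (V : nat -> R[i]) : s != 0 ->
  (\int[leb]_(x in circ)
     (normc (\sum_(k < n) expi ((s * k%:Z)%:~R * x) * V k) ^+ 2)%:E =
   (2 * pi * \sum_(k < n) normc (V k) ^+ 2)%:E)%E.
Proof.
move=> s0.
pose f x := \sum_(k < n) expi ((s * k%:Z)%:~R * x) * V k.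
pose g x := real_complex R (\1_circ x * normc (f x) ^+ 2).
pose G (k l : 'I_n) x := (V k * conjc (V l)) * (real_complex R (\1_circ x) * expi ((s * k%:Z - s * l%:Z)%:~R * x)).
have gE x : g x = \sum_(k < n) \sum_(l < n) G k l x.
  rewrite /g real_complexM -normc_mul_conj /f conjc_sum big_distrlr mulr_sumr.
  apply: eq_bigr => k _; rewrite mulr_sumr; apply: eq_bigr => l _.
  rewrite conjcM conj_expi /G intrB mulrBl expiD /=.
  ring.
have Gi k l : cintable leb (G k l) by apply: cintableZ; exact: cintable_circ_expi.
have gi : cintable leb g.
  rewrite (_ : g = (fun x => \sum_(k < n) \sum_(l < n) G k l x)); last exact/funext.
  by apply: cintable_sum => k; apply: cintable_sum => l; exact: Gi.
have : cint leb g = real_complex R (2 * pi * \sum_(k < n) normc (V k) ^+ 2).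
  have -> : cint leb g = cint leb (fun x => \sum_(k < n) \sum_(l < n) G k l x).
    by apply: eq_cint => x; exact: gE.
  rewrite cint_sum; last by move=> k; apply: cintable_sum => l; exact: Gi.
  rewrite real_complexM real_complex_sum mulr_sumr.
  apply: eq_bigr => k _; rewrite cint_sum; last exact: Gi.
  rewrite (bigD1 k)//= big1 ?addr0; last first.
    move=> l lk; rewrite /G cintZ; last exact: cintable_circ_expi.
    rewrite cint_circ_expi -mulrBr mulf_eq0 (negbTE s0) subr_eq0 eqz_nat.
    rewrite (_ : (val k == val l) = false) ?mul0r ?mulr0//.
    by apply/negbTE; rewrite eq_sym.
  rewrite /G cintZ; last exact: cintable_circ_expi.
  rewrite cint_circ_expi; by rewrite subrr eqxx mul1r normc_mul_conj -!real_complexM mulrC.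
rewrite cint_real => /complexI <-.
rewrite integral_circ_mkcond /Rintegral fineK.
  by apply: eq_integral => x _; rewrite EFinM.
apply: integrable_fin_num => //.
by have := cintable_Re gi.
Qed.

End circle.

(** Both sides are values at [z] of the square of a polynomial. As [r] vanishes from [n] on, the
    Cauchy products can run over all [i <= k] without truncation. *)
Lemma sqr_antidiag (F : comNzRingType) (r : nat -> F) n z :
  (forall k, (n <= k)%N -> r k = 0) ->
  (\sum_(k < n) r k * z ^+ k) ^+ 2 =
  \sum_(k < n + n) (\sum_(i < k.+1) r i * r (k - i)%N) * z ^+ k.
Proof.
move=> rn; pose p := \poly_(i < n) r i.
have cp i : p`_i = r i by rewrite coef_poly; case: ltnP => // /rn.
rewrite -(horner_poly n r) -/p expr2 -hornerM.
rewrite (@horner_coef_wide _ (n + n)); last first.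
  rewrite (leq_trans (size_polyMleq _ _))// (leq_trans (leq_pred _))//.
  by rewrite leq_add// size_poly.
apply: eq_bigr => k _; congr (_ * _); rewrite coefM.
by apply: eq_bigr => i _; rewrite !cp.
Qed.

(** For finite values this is [sqr_antidiag] at [z = 1]; if the sum is infinite, so is the right
    side. *)
Lemma sum_antidiag_le (R : realType) (a : nat -> \bar R) n :
  (forall k, 0 <= a k)%E -> (forall k, (n <= k)%N -> a k = 0%E) ->
  (\sum_(k < n + n) \sum_(i < k.+1) a i * a (k - i)%N <=
   (\sum_(k < n) a k) * (\sum_(k < n) a k))%E.
Proof.
move=> a0 an; have [foo|] := ltP (\sum_(k < n) a k)%E +oo%E; last first.
  by rewrite leye_eq => /eqP ->; rewrite mulyy leey.
have afin k : a k \is a fin_num.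
  rewrite ge0_fin_numE//; have [/an -> //|kn] := leqP n k.
  by apply: le_lt_trans foo; rewrite (bigD1 (Ordinal kn))//= leeDl// sume_ge0.
pose r k := fine (a k).
have ra k : a k = (r k)%:E by rewrite /r fineK.
under eq_bigr do under eq_bigr do rewrite !ra -EFinM.
under eq_bigr do rewrite sumEFin.
under [in leRHS]eq_bigr do rewrite ra.
rewrite !sumEFin -EFinM lee_fin.
have := @sqr_antidiag _ r n 1 (fun k kn => congr1 fine (an k kn)).
under eq_bigr do rewrite expr1n mulr1.
under [in RHS]eq_bigr do rewrite expr1n mulr1.
by move=> <-; rewrite expr2.
Qed.

(* Cauchy-Schwarz is used in its AM-GM form, which makes sense even if [P] is
   infinite. *)
Lemma sqr_le_of_amgm (R : realType) (X S : R) (P : \bar R) :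
  0 <= X -> 0 < S -> (0 <= P)%E ->
  (forall l : R, 0 < l -> (X%:E <= (l / 2)%:E * P + (S / (2 * l))%:E)%E) ->
  ((X ^+ 2)%:E <= S%:E * P)%E.
Proof.
move=> X0 S0 P0 h; case: P P0 h => [r| |//]; last first.
  by move=> _ _; rewrite gt0_muley ?lte_fin// leey.
rewrite lee_fin => r0 h; rewrite -EFinM lee_fin.
have {}h l : 0 < l -> X <= l / 2 * r + S / (2 * l).
  by move=> /h; rewrite -EFinM -EFinD lee_fin.
have [->|Xn0] := eqVneq X 0; first by rewrite expr0n /= mulr_ge0// ltW.
have X1 : 0 < X by rewrite lt_neqAle eq_sym Xn0.
have [r1|rn0] := eqVneq r 0.
  (* This [l] reduces the bound to [X <= X / 2], which contradicts [0 < X]. *)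
  have := h (S / X) (divr_gt0 S0 X1); rewrite r1 mulr0 add0r.
  have -> : S / (2 * (S / X)) = X / 2 by field; rewrite !gt_eqF.
  lra.
have r1 : 0 < r by rewrite lt_neqAle eq_sym rn0.
(* With this [l] the first term equals [X / 2], and what remains is [X ^+ 2 <= S * r]. *)
have := h (X / r) (divr_gt0 X1 r1).
have -> : X / r / 2 * r + S / (2 * (X / r)) = (X ^+ 2 + S * r) / (2 * X).
  by field; rewrite !gt_eqF.
by rewrite ler_pdivlMr ?mulr_gt0//; lra.
Qed.

Lemma ge0_integral_lin d (T : measurableType d) (R : realType)
    (mu : {measure set T -> \bar R}) (c1 c2 : R) (f1 f2 : T -> R) :
  0 <= c1 -> 0 <= c2 ->
  measurable_fun [set: T] f1 -> measurable_fun [set: T] f2 ->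
  (forall x, 0 <= f1 x) -> (forall x, 0 <= f2 x) ->
  (\int[mu]_x (c1 * f1 x + c2 * f2 x)%:E =
   c1%:E * \int[mu]_x (f1 x)%:E + c2%:E * \int[mu]_x (f2 x)%:E)%E.
Proof.
move=> c10 c20 mf1 mf2 f10 f20.
rewrite -!ge0_integralZl_fin// -ge0_integralD//.
- by move=> x _; rewrite lee_fin mulr_ge0.
- by apply/measurable_EFinP/measurable_funM => //; exact: measurable_cst.
- by move=> x _; rewrite lee_fin mulr_ge0.
- by apply/measurable_EFinP/measurable_funM => //; exact: measurable_cst.
Qed.

(** AM-GM between the weighted squares and the inverse weights; the difference of the two sides is
    an exact square divided by a positive number. *)
Lemma amgm_weight (R : realFieldType) (l w1 w2 v1 v2 : R) : 0 < l -> 0 < w1 -> 0 < w2 ->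
  v1 * v2 <= l / 2 * (w1 * v1 ^+ 2 * (w2 * v2 ^+ 2)) + 1 / (2 * l) * (w1^-1 * w2^-1).
Proof.
move=> l0 w10 w20; rewrite -subr_ge0.
have -> : l / 2 * (w1 * v1 ^+ 2 * (w2 * v2 ^+ 2)) + 1 / (2 * l) * (w1^-1 * w2^-1) - v1 * v2 =
    (l * w1 * w2 * (v1 * v2) - 1) ^+ 2 / (2 * l * w1 * w2).
  by field; rewrite !gt_eqF.
by rewrite divr_ge0 ?sqr_ge0// !mulr_ge0// ltW.
Qed.

(** * The L^4 bound for frequencies of one sign *)

Section one_signed_frequencies.
Context {R : realType}.
Notation leb := (@lebesgue_measure R).
Notation RR := (measurableTypeR R * measurableTypeR R)%type.
Variables (s : int) (n : nat) (A : nat -> R -> R[i]) (w : nat -> R -> R) (S0 : R).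
Hypothesis s0 : s != 0.
Hypothesis Ai : forall k, cintable leb (A k).
Hypothesis Ab : forall k, exists M, forall t, normc (A k t) <= M.
Hypothesis An : forall k t, (n <= k)%N -> A k t = 0.
Hypothesis mw : forall k, measurable_fun [set: measurableTypeR R] (w k).
Hypothesis w0 : forall k t, 0 < w k t.
Hypothesis S00 : 0 < S0.
Hypothesis HK : forall k tau, (\sum_(i < k.+1)
  \int[leb]_s ((w i s)^-1 * (w (k - i)%N (tau - s))^-1)%:E <= S0%:E)%E.

Let h k tau := w k tau * normc (A k tau) ^+ 2.
Let a k : \bar R := (\int[leb]_tau (h k tau)%:E)%E.
(** [ftr (B k) t] is the coefficient at frequency [s * k] in the square of the trigonometric sum;
    [P k] is the convolution of weighted energies that controls [B k] once the kernel has been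
    extracted. *)
Let B k tau := \sum_(i < k.+1) conv (A i) (A (k - i)%N) tau.
Let P k tau : \bar R := (\sum_(i < k.+1) \int[leb]_s (h i s * h (k - i)%N (tau - s))%:E)%E.

Let h0 k t : 0 <= h k t.
Proof. by rewrite /h mulr_ge0 ?sqr_ge0// ltW. Qed.

Let mh k : measurable_fun [set: measurableTypeR R] (h k).
Proof.
apply: measurable_funM; first exact: mw.
by apply: measurable_funX; exact: (measurable_normc (Ai k).1).
Qed.

Let mh2 i k : measurable_fun [set: RR] (fun z : RR => (h i z.2 * h k (z.1 - z.2))%:E).
Proof.
apply/measurable_EFinP/measurable_funM.
  exact: (measurableT_comp (mh i) measurable_snd).
exact: (measurableT_comp (mh k) measurable_subr2).
Qed.

Let h20 i k (z : RR) : (0 <= (h i z.2 * h k (z.1 - z.2))%:E)%E.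
Proof. by rewrite lee_fin mulr_ge0. Qed.

Let conv_i i k : cintable leb (conv (A i) (A k)).
Proof. by have [M hM] := Ab k; exact: (cintable_conv (Ai i) (Ai k) hM). Qed.

Let Bi k : cintable leb (B k).
Proof. by apply: cintable_sum => i; exact: conv_i. Qed.

Let ftrB k t : ftr (B k) t = \sum_(i < k.+1) ftr (A i) t * ftr (A (k - i)%N) t.
Proof.
transitivity (\sum_(i < k.+1) ftr (conv (A i) (A (k - i)%N)) t).
  rewrite /ftr -cint_sum; last by move=> i; apply: cintable_ftr; exact: conv_i.
  by apply: eq_cint => tau; rewrite /B mulr_sumr.
apply: eq_bigr => i _; have [M hM] := Ab (k - i)%N.
exact: (ftr_conv (Ai _) (Ai _) hM).
Qed.

Let P0 k tau : (0 <= P k tau)%E.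
Proof.
by apply: sume_ge0 => i _; apply: integral_ge0 => t _; exact: (h20 _ _ (tau, t)).
Qed.

Let mP k : measurable_fun [set: measurableTypeR R] (P k).
Proof.
apply: emeasurable_sum => i.
exact: (measurable_fun_fubini_tonelli_F _ (mh2 i (k - i)) (h20 i (k - i))).
Qed.

Let intP k : (\int[leb]_tau P k tau = \sum_(i < k.+1) a i * a (k - i)%N)%E.
Proof.
rewrite ge0_integral_sum//; last 2 first.
- move=> i; exact: (measurable_fun_fubini_tonelli_F _ (mh2 i (k - i)) (h20 i (k - i))).
- by move=> i x _; apply: integral_ge0 => t _; exact: (h20 _ _ (x, t)).
apply: eq_bigr => i _.
rewrite (fubini_tonelli _ (mh2 i (k - i)) (h20 i (k - i))) /=.
rewrite muleC {2}/a -ge0_integralZl//; last 3 first.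
- exact/measurable_EFinP.
- by move=> x _; rewrite lee_fin.
- by apply: integral_ge0 => x _; rewrite lee_fin.
apply: eq_integral => y _.
rewrite ge0_integralZl_fin//; last exact: (measurableT_comp (mh _) (measurable_shiftr (- y))).
rewrite (ge0_integral_shift (- y) (f := fun x => (h (k - i)%N x)%:E)).
- by rewrite muleC.
- by apply/measurable_EFinP; exact: mh.
- by move=> x; rewrite lee_fin.
Qed.

Let winv_meas i k tau : measurable_fun [set: measurableTypeR R]
  (fun t => (w i t)^-1 * (w k (tau - t))^-1).
Proof.
have mV j : measurable_fun [set: measurableTypeR R] (fun t => (w j t)^-1).
  have := measurableT_comp (measurable_powR (-1)) (mw j).
  apply: eq_measurable_fun => t _ /=.
  by rewrite powR_inv1// ltW.
apply: measurable_funM; first exact: mV.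
have := measurable_fun_pair2 (f := fun z : RR => (w k (z.1 - z.2))^-1) tau.
by apply; exact: (measurableT_comp (mV k) measurable_subr2).
Qed.

Let hsub_meas i k tau : measurable_fun [set: measurableTypeR R] (fun t => h i t * h k (tau - t)).
Proof.
have := measurable_fun_pair2 (f := fun z : RR => (h i z.2 * h k (z.1 - z.2))%:E) tau (mh2 i k).
by move/measurable_EFinP.
Qed.

(** The same [l] serves for all pairs [(i, k - i)], so that the inverse weights add up to exactly
    the sum that [HK] bounds. *)
Let normB k tau : ((normc (B k tau) ^+ 2)%:E <= S0%:E * P k tau)%E.
Proof.
apply: sqr_le_of_amgm => //; first exact: normc_nneg.
move=> l l0.
have step (i : 'I_k.+1) : ((normc (conv (A i) (A (k - i)%N) tau))%:E <=
    (l / 2)%:E * \int[leb]_s (h i s * h (k - i)%N (tau - s))%:E +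
    (1 / (2 * l))%:E * \int[leb]_s ((w i s)^-1 * (w (k - i)%N (tau - s))^-1)%:E)%E.
  have [M hM] := Ab (k - i)%N.
  have ci := cintable_conv_section (Ai i) (Ai (k - i)%N) hM tau.
  apply: (le_trans (normc_cint_leE ci)).
  have l1 : 0 <= l / 2 by rewrite divr_ge0// ltW.
  have l2 : 0 <= 1 / (2 * l) by rewrite divr_ge0// mulr_ge0// ltW.
  rewrite -(ge0_integral_lin leb l1 l2).
  - apply: ge0_le_integral; first by [].
    + by move=> x _; rewrite lee_fin normc_nneg.
    + exact: measurable_normcE ci.1.
    + apply/measurable_EFinP/measurable_funD.
        by apply: measurable_funM; [exact: measurable_cst|exact: hsub_meas].
      by apply: measurable_funM; [exact: measurable_cst|exact: winv_meas].
    + by move=> x _; rewrite lee_fin normcM; exact: amgm_weight.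
  - exact: hsub_meas.
  - exact: winv_meas.
  - by move=> x; rewrite mulr_ge0.
  - by move=> x; rewrite mulr_ge0 ?invr_ge0 ?ltW.
apply: (@le_trans _ _ (\sum_(i < k.+1) (normc (conv (A i) (A (k - i)%N) tau))%:E)%E).
  by rewrite sumEFin lee_fin; exact: normc_sum.
apply: (le_trans (lee_sum _ (fun i _ => step i))).
rewrite big_split/= -!ge0_sume_distrr; first last.
- by move=> i _; apply: integral_ge0 => x _; exact: (h20 _ _ (tau, x)).
- by move=> i _; apply: integral_ge0 => x _; rewrite lee_fin mulr_ge0 ?invr_ge0 ?ltW.
apply: leeD; first by [].
apply: (@le_trans _ _ ((1 / (2 * l))%:E * S0%:E)%E).
  apply: lee_wpmul2l; last exact: HK.
  by rewrite lee_fin divr_ge0// mulr_ge0// ltW.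
by rewrite -EFinM lee_fin mulrC mulrA mulr1.
Qed.

Let a0 k : (0 <= a k)%E.
Proof. by apply: integral_ge0 => t _; rewrite lee_fin. Qed.

Let an k : (n <= k)%N -> a k = 0%E.
Proof.
move=> kn; rewrite /a; under eq_integral do rewrite /h An// normc0 expr0n/= mulr0.
by rewrite integral0.
Qed.

Lemma integral_strip_normc4 :
  (\int[leb]_t \int[leb]_(x in circ)
     (normc (\sum_(k < n) expi ((s * k%:Z)%:~R * x) * ftr (A k) t) ^+ 4)%:E <=
   ((2 * pi) ^+ 2 * S0)%:E *
   ((\sum_(k < n) \int[leb]_tau (w k tau * normc (A k tau) ^+ 2)%:E) *
    (\sum_(k < n) \int[leb]_tau (w k tau * normc (A k tau) ^+ 2)%:E)))%E.
Proof.
(* The fourth power is the squared modulus of the square, itself a trigonometric sum with fewer than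
   [n + n] frequencies, so Parseval in [x] applies for each [t]. *)
have xint t : (\int[leb]_(x in circ)
     (normc (\sum_(k < n) expi ((s * k%:Z)%:~R * x) * ftr (A k) t) ^+ 4)%:E =
     (2 * pi * \sum_(k < n + n) normc (ftr (B k) t) ^+ 2)%:E)%E.
  rewrite -(parseval_circ _ (fun k => ftr (B k) t) s0); apply: eq_integral => x _.
  congr EFin; rewrite (_ : 4 = 2 * 2)%N// exprM -normcX; congr (normc _ ^+ 2).
  have ez k : expi ((s * k%:Z)%:~R * x) = expi (s%:~R * x) ^+ k.
    by rewrite -expi_natmul; congr expi; rewrite intrM -pmulrn; ring.
  transitivity ((\sum_(k < n) ftr (A k) t * expi (s%:~R * x) ^+ k) ^+ 2).
    by congr (_ ^+ 2); apply: eq_bigr => k _; rewrite ez mulrC.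
  rewrite (@sqr_antidiag _ (fun k => ftr (A k) t)).
    by apply: eq_bigr => k _; rewrite ftrB ez mulrC.
  move=> k kn; rewrite /ftr -[RHS](cint0 leb); apply: eq_cint => x'.
  by rewrite An// mulr0.
under eq_integral do rewrite xint.
have mB2 k : measurable_fun [set: measurableTypeR R] (fun t => normc (ftr (B k) t) ^+ 2).
  by apply: measurable_funX; exact: (measurable_normc (cmeasurable_ftr (Bi k))).
have pi0 : 0 <= 2 * pi :> R by rewrite mulr_ge0 ?pi_ge0.
under eq_integral do rewrite mulr_sumr -sumEFin.
rewrite ge0_integral_sum//; last 2 first.
- by move=> k; apply/measurable_EFinP/measurable_funM => //; exact: measurable_cst.
- by move=> k x _; rewrite lee_fin mulr_ge0 ?sqr_ge0.
(* One factor [2 * pi] comes from Parseval in [x], the other from Plancherel in [t]. *)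
apply: (@le_trans _ _ (\sum_(k < n + n) ((2 * pi) ^+ 2 * S0)%:E * \sum_(i < k.+1) a i * a (k - i)%N)%E).
  apply: lee_sum => k _.
  rewrite ge0_integralZl_fin//; last by move=> x; rewrite sqr_ge0.
  have -> : (2 * pi) ^+ 2 * S0 = 2 * pi * (2 * pi * S0) by ring.
  rewrite (EFinM (2 * pi) (2 * pi * S0)) -muleA; apply: lee_wpmul2l; first by rewrite lee_fin.
  apply: (le_trans (plancherel_le (Bi k))).
  rewrite (EFinM (2 * pi) S0) -muleA; apply: lee_wpmul2l; first by rewrite lee_fin.
  rewrite -intP -ge0_integralZl//; last by rewrite lee_fin ltW.
  apply: ge0_le_integral => //.
  - by move=> x _; rewrite lee_fin sqr_ge0.
  - apply/measurable_EFinP/measurable_funX; exact: (measurable_normc (Bi k).1).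
  - by apply: emeasurable_funM => //; exact: measurable_cst.
rewrite -ge0_sume_distrr; last by move=> k _; apply: sume_ge0 => i _; rewrite mule_ge0.
apply: lee_wpmul2l; first by rewrite lee_fin mulr_ge0 ?sqr_ge0// ltW.
exact: sum_antidiag_le a0 an.
Qed.

End one_signed_frequencies.

(** * The resonance function *)

(** Quantitative convexity: the increment of the power over [[y, y + h]] exceeds the one over
    [[i, i + h]] by at least the power of [h]. The exponent starts at [2], where the claim reduces
    to [i + h <= y]; for exponent [1] the increments are equal. *)
Lemma second_difference_expn m (y i h : nat) : (i + h <= y)%N ->
  (y ^ m.+2 + (i + h) ^ m.+2 + h ^ m.+2 <= (y + h) ^ m.+2 + i ^ m.+2)%N.
Proof.
move=> ihy; elim: m => [|m ih].
  rewrite !expnS !expn0 !muln1; nia.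
have mono : (i ^ m.+2 <= y ^ m.+2)%N by rewrite leq_exp2r//; lia.
have mono2 : (y ^ m.+2 <= (y + h) ^ m.+2)%N by rewrite leq_exp2r//; lia.
have mono3 : (i ^ m.+2 <= (i + h) ^ m.+2)%N by rewrite leq_exp2r//; lia.
rewrite (expnS y m.+2) (expnS (i + h) m.+2) (expnS h m.+2) (expnS (y + h) m.+2) (expnS i m.+2).
move: ih mono mono2 mono3.
move: (y ^ m.+2)%N ((i + h) ^ m.+2)%N (h ^ m.+2)%N ((y + h) ^ m.+2)%N (i ^ m.+2)%N => a b c e f.
nia.
Qed.

(* The resonance function is strictly convex and symmetric about [k / 2], so
   on one half of [[0, k]] its values are as far apart as [m]-th powers. *)
Lemma resonance_gap m (k i i' : nat) : (1 < m)%N -> (i <= i')%N -> (i' + i' <= k)%N ->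
  ((i' - i) ^ m + (i' ^ m + (k - i') ^ m) <= i ^ m + (k - i) ^ m)%N.
Proof.
case: m => [|[|m]]// _ ii' i'k.
have := @second_difference_expn m (k - i') i (i' - i).
have -> : (i + (i' - i) = i')%N by lia.
have -> : (k - i' + (i' - i) = k - i)%N by lia.
have h : (i' <= k - i')%N by lia.
move=> /(_ h); lia.
Qed.

(** * Sums of negative powers over well-separated values *)

Section power_sums.
Context {R : realType}.
Implicit Types (x y z p q g r : R).

Lemma gt0_powRD x q r : 0 < x -> x `^ (q + r) = x `^ q * x `^ r.
Proof. by move=> x0; rewrite powRD// (gt_eqF x0) implybT. Qed.

Lemma powR_sum_bound r N : 1 < r ->
  \sum_(d < N) (1 + d%:R : R) `^ (- r) <= 1 + (r - 1)^-1.
Proof.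
move=> r1; set e := r - 1; have e0 : 0 < e by rewrite subr_gt0.
(* Telescoping form of the comparison with an integral. The mean value inequality behind it comes
   from [1 + x <= expR x], used once for the power and once for the logarithm. *)
have tele d : (1 + d.+1%:R : R) `^ (- r) <=
    e^-1 * ((1 + d%:R) `^ (- e) - (1 + d.+1%:R) `^ (- e)).
  set n : R := 1 + d.+1%:R.
  have dn : 1 + d%:R = n * (1 - n^-1).
    by rewrite mulrBr mulfV ?gt_eqF ?ltr_pwDl// mulr1 /n -natr1; ring.
  have n1 : 1 < n by rewrite ltrDl ltr0n.
  have n0 : 0 < n by rewrite (lt_trans _ n1).
  have n10 : 0 < 1 - n^-1 by rewrite subr_gt0 invf_lt1.
  rewrite dn (powRM _ (ltW n0) (ltW n10)) ler_pdivlMl//.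
  have -> : n `^ (- r) = n `^ (- e) * n^-1.
    rewrite -powR_inv1 ?ltW// -gt0_powRD//.
    by congr (_ `^ _); rewrite /e; ring.
  have -> : n `^ (- e) * (1 - n^-1) `^ (- e) - n `^ (- e) =
     n `^ (- e) * ((1 - n^-1) `^ (- e) - 1) by ring.
  rewrite mulrCA ler_wpM2l ?powR_ge0// /powR gt_eqF//.
  rewrite lerBrDl; apply: le_trans (expR_ge1Dx _).
  rewrite lerD2l mulNr -mulrN (ler_wpM2l (ltW e0))// lerNr.
  have := expR_ge1Dx (ln (1 - n^-1)); rewrite lnK ?posrE//; lra.
have H : forall M, \sum_(d < M) (1 + d.+1%:R : R) `^ (- r) <= e^-1 * (1 - (1 + M%:R) `^ (- e)).
  elim=> [|M ih]; first by rewrite big_ord0 addr0 powR1 subrr mulr0.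
  rewrite big_ord_recr/= (le_trans (lerD ih (tele M)))// -mulrDr.
  by rewrite le_eqVlt; apply/orP; left; apply/eqP; ring.
case: N => [|N]; first by rewrite big_ord0 addr_ge0// invr_ge0 ltW.
rewrite big_ord_recl addr0 powR1 lerD2l (le_trans (H N))//.
by rewrite -[leRHS]mulr1 ler_wpM2l ?invr_ge0 ?ltW//.
Qed.

Lemma powRN_le x y r : 0 <= r -> 0 < x -> x <= y -> y `^ (- r) <= x `^ (- r).
Proof.
move=> r0 x0 xy; rewrite !powRN lef_pV2 ?posrE ?powR_gt0//; last first.
  exact: lt_le_trans xy.
by rewrite ge0_ler_powR ?nnegrE// ltW// (lt_le_trans x0).
Qed.

(** The larger of [x] and [y] is at least [z / 2]. A part [g] of its exponent is spent on [z], and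
    the remaining [p - g] is handed to the smaller one; the sum on the right makes the bound
    symmetric. *)
Lemma powR_pair_le x y z p g : 1 <= x -> 1 <= y -> 0 < z -> z <= x + y ->
  0 <= g -> g <= p ->
  x `^ (- p) * y `^ (- p) <=
  2 `^ g * z `^ (- g) * (x `^ (- (2 * p - g)) + y `^ (- (2 * p - g))).
Proof.
wlog xy : x y / y <= x.
  move=> H x1 y1 z0 zxy g0 gp; have [xy|/ltW xy] := leP y x; first exact: H.
  by rewrite mulrC (addrC (x `^ _)) H// addrC.
move=> x1 y1 z0 zxy g0 gp.
have x0 : 0 < x by lra.
have y0 : 0 < y by lra.
have -> : 2 `^ g * z `^ (- g) = (z / 2) `^ (- g).
  by rewrite powRM ?ltW// ?invr_ge0// -powR_inv1// -powRrM mulN1r opprK mulrC.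
apply: (@le_trans _ _ (x `^ (- g) * y `^ (- (2 * p - g)))); last first.
  rewrite ler_pM ?powR_ge0// ?lerDr ?powR_ge0//.
  by rewrite powRN_le// ?divr_gt0//; lra.
have E1 u : 0 < u -> u `^ (- p) = u `^ (- g) * u `^ (- (p - g)).
  by move=> u0; rewrite -gt0_powRD//; congr (_ `^ _); ring.
have E2 : y `^ (- (2 * p - g)) = y `^ (- (p - g)) * (y `^ (- g) * y `^ (- (p - g))).
  by rewrite -!gt0_powRD//; congr (_ `^ _); ring.
rewrite (E1 x)// (E1 y)// E2 -[leLHS]mulrA ler_wpM2l ?powR_ge0//.
have h : x `^ (- (p - g)) <= y `^ (- (p - g)).
  by rewrite powRN_le// subr_ge0.
have a0 := powR_ge0 y (- g); have b0 := powR_ge0 y (- (p - g)).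
by rewrite ler_wpM2r// mulr_ge0.
Qed.

(** With truncated subtraction the argument of [f] is the distance from [i] to [i0], and each
    distance is attained at most twice. *)
Lemma sum_distn_le (f : nat -> R) N i0 : (forall d, 0 <= f d) -> (i0 < N)%N ->
  \sum_(i < N) f ((i - i0) + (i0 - i))%N <= 2 * \sum_(d < N) f d.
Proof.
move=> f0 i0N.
have mono M : (M <= N)%N -> \sum_(0 <= d < M) f d <= \sum_(0 <= d < N) f d.
  by move=> MN; rewrite (big_cat_nat (n := M) (p := N))//= lerDl sumr_ge0.
rewrite -(big_mkord xpredT (fun i => f ((i - i0) + (i0 - i))%N)).
rewrite -(big_mkord xpredT f) (big_cat_nat (n := i0))//=; last exact: ltnW.
rewrite mulr_natl mulr2n lerD//.
  rewrite big_nat_rev/= add0n.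
  apply: (@le_trans _ _ (\sum_(0 <= i < i0) f i.+1)).
    rewrite big_nat [leRHS]big_nat ler_sum// => i /andP[_ ii0].
    by rewrite (_ : (i0 - i.+1 - i0 + (i0 - (i0 - i.+1)) = i.+1)%N)//; lia.
  apply: le_trans (mono i0.+1 i0N).
  by rewrite [leRHS]big_nat_recl//= lerDr.
rewrite -{1}(add0n i0) big_addn.
apply: le_trans (mono (N - i0)%N (leq_subr _ _)).
rewrite big_nat [leRHS]big_nat ler_sum// => i _.
by rewrite (_ : (i + i0 - i0 + (i0 - (i + i0)) = i)%N)//; lia.
Qed.

(** For [d] positive, [1 + d <= 2 * d], so [(1 + d) ^+ m] is at most [2 ^+ m.+1] times [d ^+ m / 2];
    the summand [1] takes care of [d = 0]. The halved power is what a comparison with the nearest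
    value leaves of a gap. *)
Lemma half_power_bound m d g : 0 <= g ->
  (1 + (d ^ m)%:R / 2 : R) `^ (- g) <=
  (2 ^+ m.+1) `^ g * (1 + d%:R) `^ (- (m%:R * g)).
Proof.
move=> g0.
have -> : (1 + d%:R : R) `^ (- (m%:R * g)) = ((1 + d%:R) ^+ m) `^ (- g).
  by rewrite -mulrN powRrM powR_mulrn// addr_ge0.
have -> : (2 ^+ m.+1 : R) `^ g = (2 ^+ m.+1)^-1 `^ (- g).
  by rewrite -powR_inv1 ?exprn_ge0// -powRrM mulN1r opprK.
rewrite -powRM ?invr_ge0 ?exprn_ge0 ?addr_ge0//.
apply: powRN_le => //.
rewrite ler_pdivrMl ?exprn_gt0//.
have [d0|d0] := posnP d.
  rewrite d0 addr0 expr1n -[leLHS]mulr1 ler_pM//.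
    by rewrite exprn_ege1// ler1n.
  by rewrite lerDl divr_ge0.
apply: (@le_trans _ _ ((2 * d%:R) ^+ m)).
  apply: lerXn2r; rewrite ?nnegrE ?addr_ge0 ?mulr_ge0//.
  by rewrite mulr_natl mulr2n lerD2r ler1n.
rewrite exprMn exprS natrX.
have h1 : 0 <= 2 ^+ m :> R by rewrite exprn_ge0.
have h2 : 0 <= d%:R ^+ m :> R by rewrite exprn_ge0.
nra.
Qed.

Lemma resonance_sum m g : (1 < m)%N -> 0 <= g -> 1 < m%:R * g ->
  exists2 C : R, 0 < C & forall k (th : R),
    \sum_(i < k.+1) (1 + `|th - (i ^ m + (k - i) ^ m)%:R|) `^ (- g) <= C.
Proof.
move=> m1 g0 r1; set r := m%:R * g in r1 *.
(* The power of [2 ^+ m.+1] is that of [half_power_bound], the factor [2] counts the two sides of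
   the nearest index, and the rest bounds the series with exponent [r]. *)
pose K : R := (2 ^+ m.+1) `^ g * (2 * (1 + (r - 1)^-1)).
have K0 : 0 < K.
  by rewrite mulr_gt0 ?powR_gt0 ?exprn_gt0// mulr_gt0// ltr_pwDl// invr_ge0 subr_ge0 ltW.
exists (2 * K) => [|k th]; first by rewrite mulr_gt0.
pose phi i := (i ^ m + (k - i) ^ m)%N.
pose G i : R := (1 + `|th - (phi i)%:R|) `^ (- g).
have G0 i : 0 <= G i by exact: powR_ge0.
have half : \sum_(i < k.+1 | (i + i <= k)%N) G i <= K.
  have P0 : (@ord0 k + @ord0 k <= k)%N by [].
  pose i0 := [arg min_(i < (@ord0 k) | (i + i <= k)%N) (`|th - (phi i)%:R| : R)]%O.
  (* If [phi i0] is the closest to [th], then [phi i] is at distance at least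
     [|i - i0| ^ m / 2] from [th]. *)
  have [i0k i0min] : (i0 + i0 <= k)%N /\
      forall i : 'I_k.+1, (i + i <= k)%N -> `|th - (phi i0)%:R| <= `|th - (phi i)%:R| :> R.
    by rewrite /i0; case: arg_minP => // i ik imin; split.
  have gap (i : 'I_k.+1) : (i + i <= k)%N ->
      ((((i - i0) + (i0 - i)) ^ m)%:R : R) <= `|(phi i0)%:R - (phi i)%:R|.
    move=> ik; have [ii0|/ltnW ii0] := leqP i i0.
      have := resonance_gap m1 ii0 i0k; rewrite -/(phi i) -/(phi i0) => h.
      rewrite (_ : (i - i0 + (i0 - i) = i0 - i)%N); last by lia.
      rewrite distrC; apply: le_trans (ler_norm _).
      by rewrite lerBrDr -natrD ler_nat.
    have := resonance_gap m1 ii0 ik; rewrite -/(phi i) -/(phi i0) => h.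
    rewrite (_ : (i - i0 + (i0 - i) = i - i0)%N); last by lia.
    apply: le_trans (ler_norm _).
    by rewrite lerBrDr -natrD ler_nat.
  apply: (@le_trans _ _ (\sum_(i < k.+1 | (i + i <= k)%N)
      (2 ^+ m.+1) `^ g * (1 + ((i - i0) + (i0 - i))%:R) `^ (- r))).
    apply: ler_sum => i ik; apply: le_trans (half_power_bound _ _ g0).
    apply: powRN_le => //.
    rewrite lerD2l ler_pdivrMr//; apply: (le_trans (gap i ik)).
    have := ler_distD th ((phi i0)%:R : R) (phi i)%:R.
    rewrite (distrC _ th); have := i0min i ik; lra.
  rewrite -mulr_sumr ler_wpM2l ?powR_ge0//.
  apply: (@le_trans _ _ (\sum_(i < k.+1) (1 + ((i - i0) + (i0 - i))%:R : R) `^ (- r))).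
    rewrite [leRHS](bigID (fun i : 'I_k.+1 => (i + i <= k)%N))/= lerDl.
    by rewrite sumr_ge0// => i _; exact: powR_ge0.
  apply: (le_trans (sum_distn_le (f := fun d => (1 + d%:R) `^ (- r)) _ (ltn_ord i0))).
    by move=> d; exact: powR_ge0.
  by rewrite ler_wpM2l// powR_sum_bound.
rewrite (bigID (fun i : 'I_k.+1 => (i + i <= k)%N))/= mulr_natl mulr2n lerD//.
apply: le_trans half.
(* The reflection [i -> k - i] preserves [phi] and maps the other half into the one already
   treated. *)
rewrite (reindex_inj rev_ord_inj)/=.
rewrite [leLHS]big_mkcond [leRHS]big_mkcond; apply: ler_sum => i _ /=.
have ik : (i <= k)%N by rewrite -ltnS.
rewrite subSS; case: ifPn => [h1|_]; case: ifPn => [h2|h2] //.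
- rewrite /phi (_ : (k - (k - i) = i)%N); last by lia.
  by rewrite /G /phi addnC.
- by exfalso; lia.
Qed.

End power_sums.

(** * The bound on the kernel sum *)

Section kernel.
Context {R : realType}.
Notation leb := (@lebesgue_measure R).

Lemma integral_powR1D (q : R) : 1 < q ->
  (\int[leb]_s ((1 + `|s|) `^ (- q))%:E = (2 / (q - 1))%:E)%E.
Proof.
move=> q1; set e := q - 1; have e0 : 0 < e by rewrite subr_gt0.
have cf : continuous (fun s : R => (1 + `|s|) `^ (- q)).
  have E : (fun s : R => (1 + `|s|) `^ (- q)) = (fun s => expR (- q * ln (1 + `|s|))).
    by apply/funext => s; rewrite /powR gt_eqF// ltr_pwDl.
  rewrite E => s; apply: continuous_comp; last exact: continuous_expR.
  apply: cvgM; first exact: cvg_cst.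
  apply: continuous_comp; last by apply: continuous_ln; rewrite ltr_pwDl.
  by apply: cvgD; [exact: cvg_cst|exact: norm_continuous].
rewrite ge0_symfun_integralT; last 3 first.
- by move=> s; exact: powR_ge0.
- exact: cf.
- by move=> s /=; rewrite normrN.
rewrite -set_itvcy EFinM; congr (_ * _)%E.
pose F (s : R) : R := - e^-1 * (1 + s) `^ (- e).
have dF (s : R) : 0 <= s -> is_derive s (1 : R) F ((1 + `|s|) `^ (- q)).
  move=> s0; have s1 : 0 < 1 + s by rewrite ltr_pwDl.
  have h : is_derive s (1 : R) (fun s => (1 + s) `^ (- e)) (- e * (1 + s) `^ (- e - 1)).
    have h1 : is_derive s (1 : R) (fun s : R => 1 + s) 1.
      by apply: is_derive_eq; rewrite add0r mulr1.
    have := @is_derive1_comp R (fun x => x `^ (- e)) (fun s : R => 1 + s) s _ _ (is_derive1_powR (- e) s1) h1.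
    by rewrite mulr1.
  have := @is_deriveZ _ _ _ _ (- e^-1) _ _ _ h; rewrite /F.
  rewrite /GRing.scale/= ger0_norm// mulrA mulrNN mulVf ?gt_eqF// mul1r.
  by rewrite (_ : - e - 1 = - q)// /e; ring.
have F0 : F s @[s --> +oo] --> (0 : R).
  rewrite -[X in _ --> X](mulr0 (- e^-1)); apply: cvgM; first exact: cvg_cst.
  have h : expR (- (e * ln (1 + s))) @[s --> +oo] --> (0 : R).
    apply: (@cvg_comp _ _ _ (fun s => e * ln (1 + s)) (fun t => expR (- t)) _ (pinfty_nbhs R)); last exact: cvgr_expR.
    apply/cvgryPge => M; near=> s.
    have s0 : 0 < s by near: s; apply: nbhs_pinfty_gt; rewrite num_real.
    rewrite -ler_pdivrMl// -ler_expR lnK ?posrE; last by rewrite ltr_pwDl// ltW.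
    by rewrite -lerBlDl; near: s; apply: nbhs_pinfty_ge; rewrite num_real.
  apply: cvg_trans h; apply: near_eq_cvg; near=> s.
  have s0 : 0 < s by near: s; apply: nbhs_pinfty_gt; rewrite num_real.
  by rewrite /powR gt_eqF ?mulNr// ltr_pwDl// ltW.
rewrite (@ge0_continuous_FTC2y R (fun s => (1 + `|s|) `^ (- q)) F 0 0)//.
- by rewrite -EFinB /F addr0 powR1 mulr1 sub0r opprK.
- exact: continuous_subspaceT.
- by move=> s s0; have [] := dF s (ltW s0).
- have : derivable F 0 1 by have [] := dF 0 (lexx 0).
  by move=> /derivable1_diffP/differentiable_continuous/cvg_at_right_filter.
- move=> s; rewrite in_itv/= andbT => s0.
  by rewrite derive1E; have [_] := dF s (ltW s0); apply.
Unshelve. all: by end_near. Qed.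

(** Here [1 + |.|] stands for the bracket, and [sg] is the sign of the frequencies: an odd power
    preserves it, so [k] can remain a natural number. *)
Definition bweight (sg : R) m p k t : R := (1 + `|t - sg * (k ^ m)%:R|) `^ p.

Lemma measurable_norm1D (c q : R) : measurable_fun [set: measurableTypeR R]
  (fun s : measurableTypeR R => (1 + `|s - c|) `^ q).
Proof.
apply: (measurableT_comp (measurable_powR q)).
apply: measurable_funD; first exact: measurable_cst.
apply: (measurableT_comp (@normr_measurable R setT)).
by apply: measurable_funB; [exact: measurable_id|exact: measurable_cst].
Qed.

Lemma integral_powR1D_sub (c q : R) : 1 < q ->
  (\int[leb]_s ((1 + `|s - c|) `^ (- q))%:E = (2 / (q - 1))%:E)%E.
Proof.
move=> q1; rewrite -(integral_powR1D q1).
rewrite -(ge0_integral_shift (- c) (f := fun s => ((1 + `|s|) `^ (- q))%:E))//.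
- apply/measurable_EFinP; have := measurable_norm1D 0 (- q).
  by apply: eq_measurable_fun => s _; rewrite subr0.
Qed.

Lemma bweight_kernel_bound (m : nat) (p : R) : (1 < m)%N ->
  1 + m%:R^-1 < 2 * p -> p <= 1 ->
  exists2 S0 : R, 0 < S0 & forall (sg : R) k tau, sg = 1 \/ sg = -1 ->
    (\sum_(i < k.+1) \int[leb]_s ((bweight sg m p i s)^-1 *
       (bweight sg m p (k - i)%N (tau - s))^-1)%:E <= S0%:E)%E.
Proof.
move=> m1 mp p1.
have mr0 : 0 < m%:R :> R by rewrite ltr0n; lia.
have mi0 : 0 < m%:R^-1 :> R by rewrite invr_gt0.
(* Midpoint of the interval from [1 / m] to [2 * p - 1], nonempty by hypothesis. Above [1 / m] the
   resonance sum converges, below [2 * p - 1] the integral in [s] does, and [p <= 1] gives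
   [g <= p]. *)
pose g := (m%:R^-1 + 2 * p - 1) / 2.
have g0 : 0 < g by rewrite /g; lra.
have gp : g <= p by rewrite /g; lra.
have q1 : 1 < 2 * p - g by rewrite /g; lra.
have mg : 1 < m%:R * g.
  by rewrite -ltr_pdivrMl// mulr1 /g; lra.
have [C C0 HC] := resonance_sum m1 (ltW g0) mg.
set q := 2 * p - g in q1.
(* [powR_pair_le] leaves two translates of the same power, each of integral [2 / (q - 1)]. *)
pose K : R := 2 `^ g * (2 * (2 / (q - 1))).
have K0 : 0 < K.
  by rewrite mulr_gt0 ?powR_gt0// mulr_gt0// divr_gt0// subr_gt0.
exists (K * C) => [|sg k tau sg1]; first by rewrite mulr_gt0.
have nsg x : `|sg * x| = `|x| by case: sg1 => ->; rewrite ?mul1r// mulN1r normrN.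
have sgg : sg * sg = 1 by case: sg1 => ->; rewrite ?mul1r// mulN1r opprK.
(* Up to sign, the distance between the centres [c1] and [c2] of the two weights. Multiplication by
   [sg] lets [resonance_sum] be used with natural powers for both signs. *)
pose D i := sg * tau - (i ^ m + (k - i) ^ m)%:R.
apply: (@le_trans _ _ (\sum_(i < k.+1) (K * (1 + `|D i|) `^ (- g))%:E)%E); last first.
  by rewrite sumEFin lee_fin -mulr_sumr ler_wpM2l ?(ltW K0)// HC.
apply: lee_sum => i _.
pose c1 := sg * (i ^ m)%:R; pose c2 := tau - sg * ((k - i) ^ m)%:R.
have Dc : `|D i| = `|c2 - c1|.
  rewrite -[RHS]nsg; congr `|_|.
  by rewrite /D /c1 /c2 !mulrBr !mulrA sgg !mul1r natrD; ring.
pose k0 := 2 `^ g * (1 + `|D i|) `^ (- g).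
have k00 : 0 <= k0 by rewrite mulr_ge0 ?powR_ge0.
have -> : (K * (1 + `|D i|) `^ (- g))%:E =
    (\int[leb]_s (k0 * ((1 + `|s - c1|) `^ (- q)) + k0 * ((1 + `|s - c2|) `^ (- q)))%:E)%E.
  rewrite ge0_integral_lin//.
  - rewrite !integral_powR1D_sub// -!EFinM -EFinD; congr EFin.
    by rewrite /K /k0; ring.
  - exact: measurable_norm1D.
  - exact: measurable_norm1D.
have E2 s : bweight sg m p (k - i) (tau - s) = (1 + `|s - c2|) `^ p.
  rewrite /bweight /c2 -(normrN (s - _)); congr ((1 + `|_|) `^ p); ring.
have E1 s : (bweight sg m p i s)^-1 * (bweight sg m p (k - i) (tau - s))^-1 =
    (1 + `|s - c1|) `^ (- p) * (1 + `|s - c2|) `^ (- p).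
  by rewrite E2 /bweight -!powRN.
apply: ge0_le_integral; first by [].
- by move=> s _; rewrite lee_fin E1 mulr_ge0 ?powR_ge0.
- apply/measurable_EFinP; under eq_fun do rewrite E1.
  by apply: measurable_funM; exact: measurable_norm1D.
- apply/measurable_EFinP; apply: measurable_funD;
    (apply: measurable_funM; [exact: measurable_cst|exact: measurable_norm1D]).
- move=> s _; rewrite lee_fin E1 -mulrDr /k0 -/q.
  apply: powR_pair_le => //.
  + by rewrite lerDl.
  + by rewrite lerDl.
  + rewrite Dc; have := ler_distD s c2 c1; rewrite (distrC c2 s).
    have := normr_ge0 (s - c1); lra.
  + exact: ltW.
Qed.

End kernel.

(** * Regularization *)

Section lipschitz.
Context {R : realType}.
Notation leb := (@lebesgue_measure R).
Notation RR := (measurableTypeR R * measurableTypeR R)%type.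

(* A Lipschitz function is a supremum of countably many cones, by density of
   the rational points. *)
Lemma lipschitz_measurable (g : R * R -> R) (L : R) :
  (forall z z', `|g z - g z'| <= L * (`|z.1 - z'.1| + `|z.2 - z'.2|)) ->
  measurable_fun [set: RR] (g : RR -> measurableTypeR R).
Proof.
move=> gL0; pose K := `|L| + 1.
have K0 : 0 < K by rewrite ltr_pwDr.
have gL z z' : `|g z - g z'| <= K * (`|z.1 - z'.1| + `|z.2 - z'.2|).
  by rewrite (le_trans (gL0 z z'))// ler_wpM2r ?addr_ge0// (le_trans (ler_norm L))// lerDl.
move=> _; apply: (measurability _ (RGenOInfty.measurableE R)) => //.
move=> _ [_ [a ->] <-]; rewrite setTI.
pose c (q1 q2 : rat) (z : RR) := g (ratr q1, ratr q2) - K * (`|z.1 - ratr q1| + `|z.2 - ratr q2|).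
have mc q1 q2 : measurable_fun [set: RR] (c q1 q2).
  apply: measurable_funB; first exact: measurable_cst.
  apply: measurable_funM; first exact: measurable_cst.
  apply: measurable_funD.
    apply: (measurableT_comp (@normr_measurable R setT)).
    by apply: measurable_funB; [exact: measurable_fst|exact: measurable_cst].
  apply: (measurableT_comp (@normr_measurable R setT)).
  by apply: measurable_funB; [exact: measurable_snd|exact: measurable_cst].
have -> : g @^-1` `]a, +oo[ =
    \bigcup_(q1 : rat) \bigcup_(q2 : rat) (c q1 q2 @^-1` `]a, +oo[).
  apply/seteqP; split => [z|z [q1 _ [q2 _]]] /=; rewrite !in_itv/= !andbT; last first.
    rewrite /c => h; apply: lt_le_trans h _.
    have := gL (ratr q1, ratr q2) z; rewrite /= ler_norml => /andP[_].
    by rewrite (distrC _ z.1) (distrC _ z.2); lra.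
  (* The cone at a nearby rational point loses the Lipschitz error twice, once in its apex and once
     in its slope, and each error involves two coordinates: hence the [4]. *)
  move=> az; pose e := (g z - a) / (4 * K).
  have e0 : 0 < e by rewrite divr_gt0 ?mulr_gt0// subr_gt0.
  have l1 : z.1 < z.1 + e by rewrite ltrDl.
  have [q1 h1] := rat_in_itvoo l1.
  have l2 : z.2 < z.2 + e by rewrite ltrDl.
  have [q2 h2] := rat_in_itvoo l2.
  exists q1 => //; exists q2 => //=; rewrite in_itv/= andbT /c.
  move: h1 h2; rewrite !in_itv/= => /andP[a1 b1] /andP[a2 b2].
  have n1 : `|z.1 - ratr q1| < e by rewrite ltr_norml; apply/andP; split; lra.
  have n2 : `|z.2 - ratr q2| < e by rewrite ltr_norml; apply/andP; split; lra.
  have := gL z (ratr q1, ratr q2); rewrite ler_norml => /andP[_] /= h.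
  have h3 : K * (`|z.1 - ratr q1| + `|z.2 - ratr q2|) < (g z - a) / 2.
    have -> : (g z - a) / 2 = K * (e + e) by rewrite /e; field; rewrite gt_eqF.
    by rewrite ltr_pM2l// ltrD.
  lra.
apply: bigcupT_measurable_rat => q1; apply: bigcupT_measurable_rat => q2.
by rewrite -[X in measurable X]setTI; apply: mc => //; exact: measurable_itv.
Qed.

Lemma directional_lipschitz (g : R * R -> R) (v : R * R) (M : R) :
  (forall z, derivable g z v) -> (forall z, `|'D_v g z| <= M) ->
  forall z a, `|g (z + a *: v) - g z| <= M * `|a|.
Proof.
move=> dg gM z a; pose h (s : R) := g (z + s *: v).
have dh (s : R) : is_derive s (1 : R) h ('D_v g (z + s *: v)).
  have E : (fun e : R => e^-1 *: ((h \o shift s) (e *: (1 : R)) - h s)) =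
      (fun e : R => e^-1 *: ((g \o shift (z + s *: v)) (e *: v) - g (z + s *: v))).
    apply/funext => e; congr (_ *: (_ - _)); rewrite /= /h; congr g.
    by rewrite scalerDl addrCA; congr (_ + _); rewrite [e *: 1]mulr1.
  apply: DeriveDef.
    by rewrite /derivable E; exact: dg.
  by rewrite /derive E.
have ch : continuous h.
  move=> s; have [d _] := dh s.
  by move/derivable1_diffP/differentiable_continuous : d.
have pos s1 s2 : s1 <= s2 -> `|h s2 - h s1| <= M * (s2 - s1).
  move=> s12; have [c _ ->] := MVT_segment s12 (fun x _ => dh x) (continuous_subspaceT ch).
  have d0 : 0 <= s2 - s1 by rewrite subr_ge0.
  by rewrite normrM (ger0_norm d0) ler_wpM2r.
have [a0|/ltW a0] := leP 0 a.
  by have := pos _ _ a0; rewrite subr0 /h scale0r addr0 (ger0_norm a0).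
by have := pos _ _ a0; rewrite sub0r /h scale0r addr0 distrC (ler0_norm a0).
Qed.

(* All that the estimate uses of a Schwartz function, in a form that is stable
   under differences. *)
Definition nice (f : R * R -> R[i]) := [/\ xperiodic f,
  exists M, forall z, normc (f z) * (1 + z.1 ^+ 2) <= M &
  exists L, forall z z', normc (f z - f z') <= L * (`|z.1 - z'.1| + `|z.2 - z'.2|)].

Lemma niceB f g : nice f -> nice g -> nice (fun z => f z - g z).
Proof.
move=> [pf [M fM] [L fL]] [pg [M' gM] [L' gL]]; split.
- by move=> t x; rewrite pf pg.
- exists (M + M') => z; rewrite (le_trans _ (lerD (fM z) (gM z)))// -mulrDl.
  rewrite ler_wpM2r ?addr_ge0 ?sqr_ge0//.
  by rewrite (le_trans (normc_triangle _ _))// normc_opp.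
- exists (L + L') => z z'; rewrite mulrDl (le_trans _ (lerD (fL z z') (gL z z')))//.
  have -> : f z - g z - (f z' - g z') = (f z - f z') + (- (g z - g z')) by ring.
  by rewrite (le_trans (normc_triangle _ _))// normc_opp.
Qed.

Lemma real_schwartz_nice (g : R * R -> R) : real_schwartz g ->
  (exists M, forall z, `|g z| * (1 + z.1 ^+ 2) <= M) /\
  (exists L, forall z z', `|g z - g z'| <= L * (`|z.1 - z'.1| + `|z.2 - z'.2|)).
Proof.
move=> gS; split.
  have [_ gd] := gS [::]; have [M0 h0] := gd 0%N; have [M2 h2] := gd 2%N.
  exists (M0 + M2) => z; rewrite mulrDr mulr1 lerD//.
    by have := h0 z; rewrite expr0 mul1r.
  by have := h2 z; rewrite real_normK ?num_real// mulrC.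
have dl d : exists M, forall z a, `|g (z + a *: basis_dir R d) - g z| <= M * `|a|.
  have [gd _] := gS [::]; have [_ gb] := gS [:: d]; have [M h] := gb 0%N.
  exists M; apply: directional_lipschitz => z; first exact: gd.
  by have := h z; rewrite expr0 mul1r.
have [M1 h1] := dl false; have [M2 h2] := dl true.
exists (`|M1| + `|M2|) => z z'.
(* The two points are joined through a corner, as derivatives are controlled along the axes only. *)
have -> : g z - g z' = (g (z.1, z.2) - g (z'.1, z.2)) + (g (z'.1, z.2) - g (z'.1, z'.2)).
  by case: z z' => ? ? [? ?] /=; ring.
have a1 : `|g (z.1, z.2) - g (z'.1, z.2)| <= M1 * `|z.1 - z'.1|.
  have := h1 (z'.1, z.2) (z.1 - z'.1); congr (`|g _ - _| <= _).
  by apply: injective_projections; rewrite /= /GRing.scale/=; ring.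
have a2 : `|g (z'.1, z.2) - g (z'.1, z'.2)| <= M2 * `|z.2 - z'.2|.
  have := h2 (z'.1, z'.2) (z.2 - z'.2); congr (`|g _ - _| <= _).
  by apply: injective_projections; rewrite /= /GRing.scale/=; ring.
rewrite (le_trans (ler_normD _ _))// (le_trans (lerD a1 a2))//.
have := normr_ge0 (z.1 - z'.1); have := normr_ge0 (z.2 - z'.2).
have := ler_norm M1; have := ler_norm M2; have := normr_ge0 M1; have := normr_ge0 M2.
move: (`|z.1 - z'.1|) (`|z.2 - z'.2|) (`|M1|) (`|M2|) => a b c d; nra.
Qed.

Lemma schwartz_nice (phi : schwartzFun R) : nice phi.
Proof.
have [[M1 h1] [L1 l1]] := real_schwartz_nice (schwartz_Re phi).
have [[M2 h2] [L2 l2]] := real_schwartz_nice (schwartz_Im phi).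
split; first exact: schwartz_periodic.
- exists (M1 + M2) => z; rewrite (le_trans _ (lerD (h1 z) (h2 z)))// -mulrDl.
  by rewrite ler_wpM2r ?addr_ge0 ?sqr_ge0// normc_le_ReIm.
- exists (L1 + L2) => z z'; rewrite mulrDl (le_trans _ (lerD (l1 z z') (l2 z z')))//.
  apply: le_trans (normc_le_ReIm _) _.
  by case: (phi z) (phi z') => [a b] [c d].
Qed.

Section nice_theory.
Variable f : R * R -> R[i].
Hypothesis nf : nice f.

Lemma nice_cmeasurable : @cmeasurable _ RR R f.
Proof.
have [_ _ [L fL]] := nf; split; apply: (@lipschitz_measurable _ L) => z z'.
- apply: le_trans (fL z z'); have := Re_le_normc (f z - f z').
  by case: (f z) (f z') => [a b] [c d].
- apply: le_trans (fL z z'); have := Im_le_normc (f z - f z').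
  by case: (f z) (f z') => [a b] [c d].
Qed.

Lemma nice_bounded : exists2 M, 0 <= M & forall z, normc (f z) <= M * pois 1 z.1 /\ normc (f z) <= M.
Proof.
have [_ [M fM] _] := nf.
have M0 : 0 <= M.
  by apply: le_trans (fM (0, 0)); rewrite mulr_ge0 ?normc_nneg ?addr_ge0 ?sqr_ge0.
exists M => // z; split.
  rewrite /pois mulr1 expr1n mulrA ler_pdivlMr ?ltr_pwDl ?sqr_ge0//.
  by rewrite (le_trans (fM z))// ler_peMr// ler1n.
by apply: le_trans (fM z); rewrite ler_peMr ?normc_nneg// lerDl sqr_ge0.
Qed.

End nice_theory.

End lipschitz.

Local Arguments conjc : simpl never.

(** * The Fejer kernel *)

Section fejer.
Context {R : realType}.
Notation leb := (@lebesgue_measure R).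
Notation RR := (measurableTypeR R * measurableTypeR R)%type.

(** Coefficients [1 - |k| / M] and mass [2 * pi] over a period for positive [M]. The squared modulus
    makes nonnegativity evident, while [fejerE] gives the Fourier expansion. *)
Definition fejer (M : nat) (x : R) : R :=
  M%:R^-1 * normc (\sum_(a < M) expi (a%:R * x)) ^+ 2.

Lemma fejer_ge0 M x : 0 <= fejer M x.
Proof. by rewrite mulr_ge0 ?invr_ge0 ?sqr_ge0. Qed.

Lemma fejerE M x : real_complex R (fejer M x) =
  real_complex R M%:R^-1 * \sum_(a < M) \sum_(b < M) expi ((a%:Z - b%:Z)%:~R * x).
Proof.
rewrite /fejer real_complexM -normc_mul_conj conjc_sum big_distrlr; congr (_ * _).
apply: eq_bigr => a _; apply: eq_bigr => b _ /=.
by rewrite conj_expi -expiD intrB mulrBl.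
Qed.

Lemma fejer_le M x : fejer M x <= M%:R.
Proof.
case: M => [|M]; first by rewrite /fejer invr0 mul0r.
rewrite /fejer ler_pdivrMl// -expr2; apply: lerXn2r; rewrite ?nnegrE ?normc_nneg//.
apply: le_trans (normc_sum _ _ _) _.
under eq_bigr do rewrite normc_expi.
by rewrite sumr_const card_ord.
Qed.

Lemma measurable_fejer M c : measurable_fun [set: measurableTypeR R] (fun y : measurableTypeR R => fejer M (c - y)).
Proof.
apply: measurable_funM; first exact: measurable_cst.
apply: measurable_funX; apply: measurable_normc; apply: cmeasurable_sum => a.
apply: cmeasurable_expi; apply: measurable_funM; first exact: measurable_cst.
by apply: measurable_funB; [exact: measurable_cst|exact: measurable_id].
Qed.

(** A geometric sum times [z - 1] has modulus at most [2], and [1 - cos x] is half the square of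
    that of [z - 1]. This expresses the concentration of the kernel near [0] without cutting the
    circle into near and far parts. *)
Lemma fejer_cos M x : (0 < M)%N -> fejer M x * (1 - cos x) <= 2 / M%:R.
Proof.
move=> M0; set z : R[i] := expi x.
have zE (a : nat) : expi (a%:R * x) = z ^+ a by rewrite mulrC expi_natmul.
have h1 : normc (z - 1) ^+ 2 = 2 * (1 - cos x).
  by rewrite normc_sqr /z /expi /= subr0 sqrrB1 sin2cos2; ring.
have h2 : normc (\sum_(a < M) expi (a%:R * x)) * normc (z - 1) <= 2.
  have -> : \sum_(a < M) expi (a%:R * x) = \sum_(a < M) z ^+ a.
    by apply: eq_bigr => a _; exact: zE.
  rewrite -normcM mulrC -subrX1.
  by rewrite (le_trans (normc_triangle _ _))// normc_opp normc1 normcX normc_expi expr1n.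
have h3 : normc (\sum_(a < M) expi (a%:R * x)) ^+ 2 * (2 * (1 - cos x)) <= 4.
  rewrite -h1 -exprMn; have -> : 4 = 2 ^+ 2 :> R by ring.
  by apply: lerXn2r; rewrite ?nnegrE ?mulr_ge0 ?normc_nneg.
rewrite /fejer -mulrA mulrC ler_wpM2r ?invr_ge0//; lra.
Qed.

Lemma cintable_fejer_circ M x : cintable leb (fun y => real_complex R (\1_circ y * fejer M (x - y))).
Proof.
apply: (@cintable_le _ (measurableTypeR R) _ leb _ (fun y => M%:R * \1_circ y)).
- apply: cmeasurable_real; apply: measurable_funM; first exact: measurable_indic_circ.
  exact: measurable_fejer.
- move=> y; have h0 := mulr_ge0 (indic_circ_ge0 y) (fejer_ge0 M (x - y)).
  rewrite normc_real (ger0_norm h0).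
  by rewrite mulrC ler_wpM2r ?indic_circ_ge0 ?fejer_le.
  - exact: (integrableZl_fin M%:R integrable_indic_circ).
Qed.

Lemma integral_fejer M x : (0 < M)%N ->
  (\int[leb]_y (\1_circ y * fejer M (x - y))%:E = (2 * pi)%:E)%E.
Proof.
move=> M0.
have : cint leb (fun y => real_complex R (\1_circ y * fejer M (x - y))) = real_complex R (2 * pi).
  transitivity (cint leb (fun y => \sum_(a < M) \sum_(b < M)
     (real_complex R M%:R^-1 * expi ((a%:Z - b%:Z)%:~R * x)) *
     (real_complex R (\1_circ y) * expi ((b%:Z - a%:Z)%:~R * y)))).
    apply: eq_cint => y; rewrite real_complexM fejerE mulrCA !mulr_sumr.
    apply: eq_bigr => a _; rewrite !mulr_sumr; apply: eq_bigr => b _.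
    have -> : expi ((a%:Z - b%:Z)%:~R * (x - y)) =
        expi ((a%:Z - b%:Z)%:~R * x) * expi ((b%:Z - a%:Z)%:~R * y) :> R[i].
      by rewrite -expiD; congr expi; rewrite !intrB; ring.
    ring.
  rewrite cint_sum; last first.
    by move=> a; apply: cintable_sum => b; apply: cintableZ; exact: cintable_circ_expi.
  transitivity (\sum_(a < M) real_complex R M%:R^-1 * real_complex R (2 * pi)).
    apply: eq_bigr => a _; rewrite cint_sum; last first.
      by move=> b; apply: cintableZ; exact: cintable_circ_expi.
    (* Only the zero frequency [a = b] survives integration over the circle. *)
    rewrite (bigD1 a)//= big1 ?addr0.
      rewrite cintZ; last exact: cintable_circ_expi.
      by rewrite cint_circ_expi !subrr eqxx mul1r mul0r expi0 mulr1.
    move=> b ba; rewrite cintZ; last exact: cintable_circ_expi.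
    rewrite cint_circ_expi subr_eq0 eqz_nat.
    rewrite (_ : (val b == val a) = false) ?mul0r ?mulr0//.
    by apply/negbTE.
  under eq_bigr do rewrite -real_complexM.
  rewrite -real_complex_sum; congr (real_complex R _).
  by rewrite sumr_const card_ord -[LHS]mulr_natl mulVKf// pnatr_eq0 -lt0n.
rewrite cint_real => /complexI <-.
rewrite /Rintegral fineK//; apply: integrable_fin_num => //.
exact: (cintable_Re (cintable_fejer_circ M x)).
Qed.

End fejer.

(** * Approximation by Poisson and Fejer means *)

Section regularization.
Context {R : realType}.
Notation leb := (@lebesgue_measure R).
Notation RR := (measurableTypeR R * measurableTypeR R)%type.
Notation nu := (@lebesgue_measure R \x @lebesgue_measure R)%E.

Lemma integral_prod_fin (a b : R -> R) (A B : R) :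
  measurable_fun [set: measurableTypeR R] a -> measurable_fun [set: measurableTypeR R] b ->
  (forall x, 0 <= a x) -> (forall x, 0 <= b x) ->
  (\int[leb]_x (a x)%:E = A%:E)%E -> (\int[leb]_x (b x)%:E = B%:E)%E ->
  (\int[nu]_z (a z.1 * b z.2)%:E = (A * B)%:E)%E.
Proof.
move=> ma mb a0 b0 iA iB.
have mab : measurable_fun [set: RR] (fun z : RR => (a z.1 * b z.2)%:E).
  apply/measurable_EFinP/measurable_funM.
    exact: (measurableT_comp ma measurable_fst).
  exact: (measurableT_comp mb measurable_snd).
have ab0 (z : RR) : (0 <= (a z.1 * b z.2)%:E)%E by rewrite lee_fin mulr_ge0.
have B0 : 0 <= B.
  by rewrite -lee_fin -iB; apply: integral_ge0 => x _; rewrite lee_fin.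
rewrite (fubini_tonelli1 _ mab ab0).
transitivity (\int[leb]_x (B * a x)%:E)%E; last first.
  by rewrite ge0_integralZl_fin// iA -EFinM mulrC.
apply: eq_integral => x _; rewrite /fubini_F/=.
by rewrite ge0_integralZl_fin// iB -EFinM mulrC.
Qed.

Variable f : R * R -> R[i].
Hypothesis nf : nice f.

(** The two error functions are those that the kernels absorb: [1 - cos] against Fejer, the rational
    function against Poisson. Near the point the Lipschitz bound gives [d]; away from it these
    functions are bounded below, so a multiple of them exceeds the oscillation of the bounded
    [f]. *)
Lemma nice_modulus (t x d : R) : circ x -> 0 < d ->
  exists2 C : R, 0 <= C & forall s y, circ y ->
    normc (f (s, y) - f (t, x)) <=
    d + C * (1 - cos (x - y)) + C * ((t - s) ^+ 2 / (1 + (t - s) ^+ 2)).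
Proof.
move=> cx d0; have [per _ [L0 fL0]] := nf; have [M M0 fM] := nice_bounded nf.
pose L := `|L0| + 1.
have L1 : 0 < L by rewrite ltr_pwDr.
have fL z z' : normc (f z - f z') <= L * (`|z.1 - z'.1| + `|z.2 - z'.2|).
  by rewrite (le_trans (fL0 z z'))// ler_wpM2r ?addr_ge0// (le_trans (ler_norm L0))// lerDl.
have f2M z z' : normc (f z - f z') <= 2 * M.
  rewrite (le_trans (normc_triangle _ _))// normc_opp mulr_natl mulr2n.
  by rewrite lerD// (fM _).2.
(* The cap at [1] keeps [h] below [pi], where the cosine is decreasing. *)
pose h := Num.min (d / (2 * L)) 1.
have h0 : 0 < h by rewrite lt_min divr_gt0 ?mulr_gt0//=.
have h1 : h <= 1 by rewrite ge_min lexx orbT.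
have hL : L * h <= d / 2.
  have : h <= d / (2 * L) by rewrite ge_min lexx.
  rewrite -(ler_pM2l L1); congr (_ <= _); field; by rewrite gt_eqF.
have hpi : h <= pi by rewrite (le_trans h1)// (le_trans _ (pi_ge2 R))// ler1n.
have ch : cos h < 1.
  rewrite -(cos0 R) ltr_cos// in_itv/= ?lexx ?pi_ge0//.
  by rewrite (ltW h0) hpi.
pose C1 := 2 * M / (1 - cos h).
pose C2 := 2 * M * (1 + h ^+ 2) / h ^+ 2.
have C10 : 0 <= C1 by rewrite divr_ge0 ?mulr_ge0// subr_ge0 ltW.
have C20 : 0 <= C2.
  by rewrite divr_ge0 ?sqr_ge0// !mulr_ge0// addr_ge0 ?sqr_ge0.
have tpart s : normc (f (s, x) - f (t, x)) <= d / 2 + C2 * ((t - s) ^+ 2 / (1 + (t - s) ^+ 2)).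
  have D0 : 0 < 1 + (t - s) ^+ 2 by rewrite ltr_pwDl// sqr_ge0.
  have [rh|/ltW rh] := leP `|t - s| h.
    apply: (@le_trans _ _ (d / 2)); last by rewrite lerDl mulr_ge0// divr_ge0 ?sqr_ge0// ltW.
    apply: (le_trans (fL _ _)); rewrite /= subrr normr0 addr0 distrC.
    by rewrite (le_trans _ hL)// ler_wpM2l// ltW.
  apply: (le_trans (f2M _ _)); rewrite -[leLHS]add0r lerD ?divr_ge0 ?(ltW d0)//.
  have rh2 : h ^+ 2 <= (t - s) ^+ 2.
    by rewrite -(real_normK (num_real (t - s))); apply: lerXn2r => //; rewrite nnegrE ltW.
  have h20 : 0 < h ^+ 2 by rewrite exprn_gt0.
  have -> : C2 * ((t - s) ^+ 2 / (1 + (t - s) ^+ 2)) =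
     2 * M * (((1 + h ^+ 2) * (t - s) ^+ 2) / (h ^+ 2 * (1 + (t - s) ^+ 2))).
    by rewrite /C2; field; rewrite !gt_eqF.
  rewrite -[leLHS]mulr1 ler_wpM2l ?mulr_ge0//.
  rewrite ler_pdivlMr ?mulr_gt0// mul1r; nra.
have xpart s e : `|e| <= pi -> normc (f (s, x + e) - f (s, x)) <= d / 2 + C1 * (1 - cos e).
  move=> epi; have [rh|/ltW rh] := leP `|e| h.
    apply: (@le_trans _ _ (d / 2)); last by rewrite lerDl mulr_ge0// subr_ge0 cos_le1.
    apply: (le_trans (fL _ _)); rewrite /= subrr normr0 add0r addrC addKr.
    by rewrite (le_trans _ hL)// ler_wpM2l// ltW.
  apply: (le_trans (f2M _ _)); rewrite -[leLHS]add0r lerD ?divr_ge0 ?(ltW d0)//.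
  have ce : cos e <= cos h.
    rewrite -(cos_norm e) leNgt ltr_cos ?in_itv/= ?normr_ge0 ?epi//.
      by rewrite -leNgt.
    by rewrite (ltW h0).
  rewrite /C1 -mulrA -[leLHS]mulr1 ler_wpM2l ?mulr_ge0//.
  by rewrite mulrC ler_pdivlMr ?subr_gt0// mul1r lerB.
exists (C1 + C2) => [|s y cy]; first exact: addr_ge0.
have xy : normc (f (s, y) - f (s, x)) <= d / 2 + C1 * (1 - cos (x - y)).
  have per2 (u : R) : f (s, u + 2 * pi) = f (s, u) by exact: per.
  have cosp (u : R) : cos (u + 2 * pi) = cos u by rewrite mulr_natl cosD2pi.
  rewrite -cosN opprB; move: cx cy => /= /andP[x0 x2] /andP[y0 y2].
  (* The difference [y - x] lies between [- 2 pi] and [2 pi]; a shift by a period brings it within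
     [pi] of [0], where [xpart] applies. *)
  have [e1|e1] := leP (y - x) (- pi).
    have := xpart s (y - x + 2 * pi).
    rewrite cosp (_ : x + (y - x + 2 * pi) = y + 2 * pi); last by ring.
    rewrite per2; apply; rewrite ler_norml; apply/andP; split; lra.
  have [e2|e2] := leP (y - x) pi.
    have := xpart s (y - x); rewrite (_ : x + (y - x) = y); last by ring.
    by apply; rewrite ler_norml; apply/andP; split; lra.
  have := xpart s (y - x - 2 * pi).
  rewrite -(cosp (y - x - 2 * pi)) subrK.
  rewrite -(per2 (x + (y - x - 2 * pi))) (_ : x + (y - x - 2 * pi) + 2 * pi = y); last by ring.
  apply; rewrite ler_norml; apply/andP; split; lra.
have -> : f (s, y) - f (t, x) = (f (s, y) - f (s, x)) + (f (s, x) - f (t, x)) by ring.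
apply: (le_trans (normc_triangle _ _)); apply: (le_trans (lerD xy (tpart s))).
have p1 : 0 <= 1 - cos (x - y) by rewrite subr_ge0 cos_le1.
have p2 : 0 <= (t - s) ^+ 2 / (1 + (t - s) ^+ 2) by rewrite divr_ge0 ?addr_ge0 ?sqr_ge0.
have := mulr_ge0 C10 p2; have := mulr_ge0 C20 p1; lra.
Qed.

End regularization.

Lemma normcB_le (R : realType) (z w : R[i]) : `|normc z - normc w| <= normc (z - w).
Proof.
have := normc_triangle (z - w) w; rewrite subrK => h1.
have := normc_triangle (w - z) z; rewrite subrK -(normc_opp (w - z)) opprB => h2.
by rewrite ler_norml; apply/andP; split; lra.
Qed.

Section reg.
Context {R : realType}.
Notation leb := (@lebesgue_measure R).
Notation RR := (measurableTypeR R * measurableTypeR R)%type.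
Notation nu := (@lebesgue_measure R \x @lebesgue_measure R)%E.
Variable f : R * R -> R[i].
Hypothesis nf : nice f.

(* Poisson means in [t] and Fejer means in [x], without the normalizing factor
   [(2 pi)^-2]. *)
Definition reg (e : R) (M : nat) (t x : R) : R[i] :=
  cint nu (fun z => real_complex R (pois e (t - z.1) * (\1_circ z.2 * fejer M (x - z.2))) * f z).

(** The numerator [r ^+ 2] cancels the peak, since [r ^+ 2 / (e ^+ 2 + r ^+ 2) <= 1]; what is left
    is [e] times the kernel at scale [1], whose mass is known. *)
Lemma pois_mul_le (e r : R) : 0 < e -> pois e r * (r ^+ 2 / (1 + r ^+ 2)) <= e * pois 1 r.
Proof.
move=> e0; rewrite /pois expr1n mulr1.
have r2 : 0 <= r ^+ 2 by rewrite sqr_ge0.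
have e2 : 0 < e ^+ 2 by rewrite exprn_gt0.
have -> : 2 * e / (e ^+ 2 + r ^+ 2) * (r ^+ 2 / (1 + r ^+ 2)) =
   e * (2 / (1 + r ^+ 2)) * (r ^+ 2 / (e ^+ 2 + r ^+ 2)).
  by field; rewrite !gt_eqF//; lra.
rewrite -[leRHS]mulr1 ler_wpM2l//.
  by rewrite mulr_ge0 ?(ltW e0)// divr_ge0// addr_ge0.
by rewrite ler_pdivrMr ?mul1r ?lerDr ?(ltW e2)//; lra.
Qed.

Lemma reg_close (e : R) M t x d C : 0 < e -> (0 < M)%N -> 0 <= d -> 0 <= C ->
  (forall s y, circ y -> normc (f (s, y) - f (t, x)) <=
    d + C * (1 - cos (x - y)) + C * ((t - s) ^+ 2 / (1 + (t - s) ^+ 2))) ->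
  normc (reg e M t x - real_complex R (2 * pi * (2 * pi)) * f (t, x)) <=
  2 * pi * (2 * pi) * (d + 2 / M%:R * C + C * e).
Proof.
move=> e0 M0 d0 C0 hf; have [B B0 fB] := nice_bounded nf.
pose a (e' : R) (s : R) := pois e' (t - s).
pose b (y : R) : R := \1_circ y * fejer M (x - y).
have a0 e' s : 0 < e' -> 0 <= a e' s by move=> e'0; rewrite /a pois_ge0// ltW.
have b0 y : 0 <= b y by exact: mulr_ge0 (indic_circ_ge0 _) (fejer_ge0 _ _).
have ma e' : 0 < e' -> measurable_fun [set: measurableTypeR R] (a e') by exact: measurable_pois_sub.
have mb : measurable_fun [set: measurableTypeR R] b.
  by apply: measurable_funM; [exact: measurable_indic_circ|exact: measurable_fejer].
have mi := @measurable_indic_circ R.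
have i0 := @indic_circ_ge0 R.
have a1 s := a0 1 s ltr01.
have ae s := a0 e s e0.
have Ik := integral_prod_fin (ma e e0) mb ae b0 (integral_pois_sub t e0) (integral_fejer x M0).
have I2 := integral_prod_fin (ma e e0) mi ae i0 (integral_pois_sub t e0) (@integral_indic_circ R).
have I3 := integral_prod_fin (ma 1 ltr01) mb a1 b0 (integral_pois_sub t ltr01) (integral_fejer x M0).
have mprod (u v : R -> R) : measurable_fun [set: measurableTypeR R] u -> measurable_fun [set: measurableTypeR R] v ->
    measurable_fun [set: RR] (fun z : RR => u z.1 * v z.2).
  move=> mu mv; apply: measurable_funM.
    exact: (measurableT_comp mu measurable_fst).
  exact: (measurableT_comp mv measurable_snd).
pose k (z : RR) := a e z.1 * b z.2.
have k0 z : 0 <= k z by rewrite /k mulr_ge0.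
have mk : measurable_fun [set: RR] k by apply: mprod => //; exact: ma.
have ki : nu.-integrable [set: RR] (fun z => (k z)%:E).
  apply/integrableP; split; first exact/measurable_EFinP.
  under eq_integral do rewrite gee0_abs ?lee_fin//.
  by rewrite Ik ltry.
have kfi : cintable nu (fun z => real_complex R (k z) * f z).
  apply: (@cintable_le _ RR _ nu _ (fun z => B * k z)).
  - apply: cmeasurableM; first exact: (cmeasurable_real mk).
    exact: nice_cmeasurable.
  - by move=> z; rewrite normcM normc_real (ger0_norm (k0 z)) mulrC ler_wpM2r// (fB z).2.
  - exact: integrableZl_fin.
have kci : cintable nu (fun z => real_complex R (k z)).
  apply: (@cintable_le _ RR _ nu _ k) => //.
  by move=> z; rewrite normc_real (ger0_norm (k0 z)).
have cE : real_complex R (2 * pi * (2 * pi)) * f (t, x) = cint nu (fun z => real_complex R (k z) * f (t, x)).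
  by rewrite cintZr// cint_real; congr (real_complex R _ * _); rewrite /Rintegral Ik.
have kfc : cintable nu (fun z => real_complex R (k z) * f (t, x)).
  by have := cintableZ (f (t, x)) kci; congr cintable; apply/funext => z; rewrite mulrC.
rewrite cE /reg -cintB//.
rewrite -lee_fin; apply: (le_trans (normc_cint_leE _)).
  have := cintableD kfi (cintableZ (-1) kfc); congr cintable; apply/funext => z.
  by rewrite mulN1r.
(* Majorants for the three error terms. In [g2] the Fejer factor has been spent on [1 - cos], in
   [g3] the Poisson factor on the rational function; all have integral [(2 pi) ^+ 2]. *)
pose g1 (z : RR) := k z.
pose g2 (z : RR) := a e z.1 * \1_circ z.2.
pose g3 (z : RR) := a 1 z.1 * b z.2.
have mg2 : measurable_fun [set: RR] g2 by apply: mprod => //; exact: ma.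
have mg3 : measurable_fun [set: RR] g3 by apply: mprod => //; exact: ma.
have g20 z : 0 <= g2 z by rewrite /g2 mulr_ge0.
have g30 z : 0 <= g3 z by rewrite /g3 mulr_ge0.
have dC0 : 0 <= 2 / M%:R * C by rewrite mulr_ge0// divr_ge0.
have Ce0 : 0 <= C * e by rewrite mulr_ge0// ltW.
have mg23 : measurable_fun [set: RR] (fun z => 2 / M%:R * C * g2 z + C * e * g3 z).
  by apply: measurable_funD; (apply: measurable_funM; [exact: measurable_cst|]).
have g230 z : 0 <= 2 / M%:R * C * g2 z + C * e * g3 z.
  by rewrite addr_ge0// mulr_ge0.
apply: (@le_trans _ _ (\int[nu]_z (d * k z + 1 * (2 / M%:R * C * g2 z + C * e * g3 z))%:E)%E); last first.
  rewrite ge0_integral_lin// ge0_integral_lin// Ik I2 I3 mul1e -!EFinM -!EFinD lee_fin.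
  by rewrite le_eqVlt; apply/orP; left; apply/eqP; ring.
apply: ge0_le_integral; first by [].
- by move=> z _; rewrite lee_fin normc_nneg.
- apply: measurable_normcE; apply: cmeasurableD; first exact: kfi.1.
  have := (cintableZ (-1) kfc).1; congr cmeasurable; apply/funext => z.
  by rewrite mulN1r.
- apply/measurable_EFinP; apply: measurable_funD.
    by apply: measurable_funM; [exact: measurable_cst|].
  by apply: measurable_funM; [exact: measurable_cst|].
move=> [s y] _; rewrite lee_fin mul1r.
rewrite -mulrBr normcM normc_real (ger0_norm (k0 _)).
have [ycirc|ycirc] := boolP (y \in circ); last first.
  have y0 : \1_circ y = 0 :> R by rewrite indicE (negbTE ycirc).
  rewrite {1 2}/k /g2 /g3 /b /= y0 !(mul0r, mulr0).
  by rewrite !addr0.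
have y1 : \1_circ y = 1 :> R by rewrite indicE ycirc.
move: ycirc; rewrite inE => cy.
have h1 := hf s y cy.
have h2 : b y * (1 - cos (x - y)) <= 2 / M%:R by rewrite /b y1 mul1r; exact: fejer_cos.
have h3 : a e s * ((t - s) ^+ 2 / (1 + (t - s) ^+ 2)) <= e * a 1 s by exact: pois_mul_le.
rewrite /g2 /g3 /k /= y1 mulr1.
apply: (le_trans (ler_wpM2l (k0 (s, y)) h1)); rewrite /k /=.
move: (ae s) (a1 s) (b0 y) h2 h3.
move: (a e s) (a 1 s) (b y) (1 - cos (x - y)) ((t - s) ^+ 2 / (1 + (t - s) ^+ 2)) (2 / M%:R).
clear -C0 d0 e0 => a' a'' b' u v w a'0 a''0 b'0 h2 h3.
have h4 : C * (a' * (b' * u)) <= C * (a' * w) by rewrite ler_wpM2l// ler_wpM2l.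
have h5 : C * (b' * (a' * v)) <= C * (b' * (e * a'')) by rewrite ler_wpM2l// ler_wpM2l.
lra.
Qed.

Lemma reg_cvg t x : circ x ->
  (fun n : nat => normc (reg n.+1%:R^-1 n.+1 t x)) @ \oo --> 2 * pi * (2 * pi) * normc (f (t, x)).
Proof.
move=> cx; apply/cvgrPdist_le => eps eps0.
pose P : R := 2 * pi * (2 * pi).
have P0 : 0 < P by rewrite !mulr_gt0 ?pi_gt0.
have d0 : 0 < eps / (2 * P) by rewrite divr_gt0// mulr_gt0.
have [C C0 hC] := nice_modulus nf t cx d0.
have : (fun n : nat => n.+1%:R^-1 : R) @ \oo --> (0 : R) by exact: cvg_harmonic.
have C1 : 0 < C + 1 by rewrite ltr_pwDr.
(* Half of [eps] is reserved for [d]. With [M = n + 1] and [e = h = 1 / (n + 1)] the other two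
   errors add up to [3 * C * h]; using [C + 1] keeps the divisor positive. *)
move/cvgrPdist_le; have c0 : 0 < eps / (2 * P * (3 * (C + 1))).
  by apply: divr_gt0 => //; apply: mulr_gt0; exact: mulr_gt0.
move=> /(_ _ c0); apply: filterS => n.
rewrite sub0r normrN ger0_norm ?invr_ge0// => hn.
have -> : 2 * pi * (2 * pi) * normc (f (t, x)) = normc (real_complex R P * f (t, x)).
  by rewrite normcM normc_real (ger0_norm (ltW P0)).
rewrite distrC (le_trans (normcB_le _ _))//.
have n0 : 0 < n.+1%:R^-1 :> R by rewrite invr_gt0.
apply: (le_trans (reg_close n0 (ltn0Sn n) (ltW d0) C0 hC)).
rewrite -/P; move: hn; set h : R := n.+1%:R^-1 => hn.
have {}hn : P * (3 * (C + 1)) * h <= eps / 2.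
  rewrite (le_trans (ler_wpM2l _ hn))//; first by apply: mulr_ge0; [exact: ltW|rewrite mulr_ge0// ltW].
  by rewrite le_eqVlt; apply/orP; left; apply/eqP; field; rewrite !gt_eqF.
have -> : P * (eps / (2 * P) + 2 / n.+1%:R * C + C * n.+1%:R^-1) = eps / 2 + 3 * P * C * h.
  by rewrite /h; field; rewrite !gt_eqF.
have : 0 <= P * h by rewrite mulr_ge0 ?(ltW P0) ?(ltW n0).
lra.
Qed.

End reg.

(** * The means as trigonometric sums of damped transforms *)

Section reg_fourier.
Context {R : realType}.
Notation leb := (@lebesgue_measure R).
Notation RR := (measurableTypeR R * measurableTypeR R)%type.
Notation nu := (@lebesgue_measure R \x @lebesgue_measure R)%E.

(** Fubini will be applied to the product of the frequency line with the whole plane, which must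
    therefore carry a sigma-finite measure. *)
Lemma sigma_finite_prod_lebesgue : sigma_finite [set: RR] (leb \x leb)%E.
Proof.
have /sigma_finiteP[F [TF ndF Foo]] := sigma_finiteT leb.
exists (fun n => F n `*` F n).
  rewrite -setXTT TF predeqE => -[x y]; split => [[/= [n _ Fnx] [k _ Gky]]|].
    exists (maxn n k) => //; split.
    - by move: x Fnx; exact/subsetPset/ndF/leq_maxl.
    - by move: y Gky; exact/subsetPset/ndF/leq_maxr.
  by move=> [n _ []/= ? ?]; split; exists n.
move=> k; have [? ?] := Foo k.
split; first exact: measurableX.
by rewrite product_measure1E// lte_mul_pinfty// ge0_fin_numE.
Qed.
Definition plane : {sigma_finite_measure set RR -> \bar R} :=
  HB.pack (leb \x leb)%E (Measure_isSigmaFinite.Build _ _ _ (leb \x leb)%E sigma_finite_prod_lebesgue).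

Lemma integral_strip_mkcond (g : R * R -> \bar R) :
  (\int[dtdx R]_(z in strip R) g z = \int[nu]_z ((\1_circ z.2)%:E * g z))%E.
Proof.
rewrite integral_mkcond; apply: eq_integral => z _; rewrite patchE indicE.
have -> : (z \in strip R) = (z.2 \in (circ : set R)).
  by apply/idP/idP; rewrite !inE; [move=> -[]|split].
by case: (_ \in _); rewrite ?mul1e ?mul0e.
Qed.

Lemma cintegralE (g : R * R -> R[i]) :
  cintegral g = cint nu (fun z => real_complex R (\1_circ z.2) * g z).
Proof.
rewrite /cintegral /cint /Rintegral !integral_strip_mkcond; congr Complex.
- congr fine; apply: eq_integral => z _; rewrite -EFinM; congr EFin.
  by case: (g z) => u v /=; rewrite mul0r subr0.
- congr fine; apply: eq_integral => z _; rewrite -EFinM; congr EFin.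
  by case: (g z) => u v /=; rewrite mul0r addr0.
Qed.

Variable f : R * R -> R[i].
Hypothesis nf : nice f.

Let fS (z : RR) := real_complex R (\1_circ z.2) * f z.

Lemma cintable_strip : cintable nu fS.
Proof.
have [M M0 fM] := nice_bounded nf.
pose h (z : RR) := pois 1 z.1 * (M * \1_circ z.2).
have mi := @measurable_indic_circ R.
have i0 := @indic_circ_ge0 R.
have mM : measurable_fun [set: measurableTypeR R] (fun y => M * \1_circ y).
  by apply: measurable_funM => //; exact: measurable_cst.
have h0 z : 0 <= h z by rewrite /h mulr_ge0 ?pois_ge0// mulr_ge0.
have Ih : (\int[nu]_z (h z)%:E = (2 * pi * (M * (2 * pi)))%:E)%E.
  apply: (integral_prod_fin (measurable_pois ltr01) mM).
  - by move=> x; rewrite pois_ge0.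
  - by move=> x; rewrite mulr_ge0.
  - exact: integral_pois.
  - by rewrite ge0_integralZl_fin// integral_indic_circ -EFinM.
apply: (@cintable_le _ RR _ nu _ h).
- apply: cmeasurableM; last exact: nice_cmeasurable.
  apply: (@cmeasurable_snd _ _ _ _ _ (fun y => real_complex R (\1_circ y))).
  exact: (cmeasurable_real mi).
- move=> z; rewrite normcM normc_real (ger0_norm (i0 _)) /h.
  rewrite (_ : pois 1 z.1 * (M * \1_circ z.2) = \1_circ z.2 * (M * pois 1 z.1)); last by ring.
  by rewrite ler_wpM2l// (fM z).1.
- apply/integrableP; split.
    apply/measurable_EFinP/measurable_funM.
      exact: (measurableT_comp (measurable_pois ltr01) measurable_fst).
    exact: (measurableT_comp mM measurable_snd).
  under eq_integral do rewrite gee0_abs ?lee_fin//.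
  by rewrite Ih ltry.
Qed.

Let fk (k : int) (z : RR) := expi (- (k%:~R * z.2)) * fS z.

Let mexp2 (c : R) : cmeasurable (fun z : RR => expi (c * z.2)).
Proof.
apply: cmeasurable_expi; apply: measurable_funM; first exact: measurable_cst.
exact: measurable_snd.
Qed.

Let fki k : cintable nu (fk k).
Proof.
apply: (cintableM (M := 1) cintable_strip); last by move=> z; rewrite normc_expi.
by have := mexp2 (- k%:~R); congr cmeasurable; apply/funext => z; rewrite mulNr.
Qed.

Let normc_fk k z : normc (fk k z) = normc (fS z).
Proof. by rewrite /fk normcM normc_expi mul1r. Qed.

Lemma stFourierE tau k : stFourier f tau k =
  real_complex R (2 * pi)^-1 * cint nu (fun z => expi (- (z.1 * tau)) * fk k z).
Proof.
rewrite /stFourier cintegralE; congr (_ * _); apply: eq_cint => z.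
by rewrite /fk /fS; ring.
Qed.

Section fixed_mode.
Variables (e t : R) (k : int).
Hypothesis e0 : 0 < e.

Let H (z : measurableTypeR R * RR) := real_complex R (abel e z.1) *
  (expi (t * z.1) * (expi (- (z.2.1 * z.1)) * fk k z.2)).

Let mH : cmeasurable H.
Proof.
apply: cmeasurableM.
  apply: (@cmeasurable_fst _ _ _ _ _ (fun y => real_complex R (abel e y))).
  by apply: cmeasurable_real; exact: measurable_abel.
apply: cmeasurableM.
  apply: cmeasurable_expi; apply: measurable_funM; first exact: measurable_cst.
  exact: measurable_fst.
apply: cmeasurableM.
  apply: cmeasurable_expi; apply: measurable_funN; apply: measurable_funM.
    exact: (measurableT_comp measurable_fst measurable_snd).
  exact: measurable_fst.
exact: (@cmeasurable_snd _ _ _ _ _ (fk k) (fki k).1).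
Qed.

Let HB x y : normc (H (x, y)) <= abel e x * normc (fS y).
Proof.
by rewrite /H normcM normc_real (ger0_norm (abel_ge0 _ _)) normcM normc_expi
  mul1r normcM normc_expi mul1r normc_fk.
Qed.

Let ai := integrable_abel e0.
Let bi := cintable_normc cintable_strip.
Let a0 := abel_ge0 e.
Let b0 z := normc_nneg (fS z).
Let Hi := @cintable_prod _ _ (measurableTypeR R) RR R leb plane H (abel e) (fun z => normc (fS z)) mH ai bi a0 b0 HB.
Let H1 x := @cintable_section1 _ _ (measurableTypeR R) RR R plane H (abel e) (fun z => normc (fS z)) mH bi HB x.
Let H2 y := @cintable_section2 _ _ (measurableTypeR R) RR R leb H (abel e) (fun z => normc (fS z)) mH ai HB y.

Let sec1 x : cint nu (fun z => H (x, z)) =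
  real_complex R (2 * pi) * (expi (t * x) * (real_complex R (abel e x) * stFourier f x k)).
Proof.
rewrite stFourierE.
have ci : cintable nu (fun z => expi (- (z.1 * x)) * fk k z).
  apply: (cintableM (M := 1) (fki k)); last by move=> z; rewrite normc_expi.
  apply: cmeasurable_expi; apply: measurable_funN; apply: measurable_funM.
    exact: measurable_fst.
  exact: measurable_cst.
transitivity (cint nu (fun z => (real_complex R (abel e x) * expi (t * x)) * (expi (- (z.1 * x)) * fk k z))).
  by apply: eq_cint => z; rewrite /H /= mulrA.
rewrite cintZ//; move: (cint nu _) => I.
have r1 : real_complex R (2 * pi) * real_complex R (2 * pi)^-1 = 1.
  by rewrite -real_complexM mulfV// gt_eqF// mulr_gt0 ?pi_gt0.
by rewrite -[LHS]mul1r -r1; ring.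
Qed.

Lemma cintable_abel_stFourier :
  cintable leb (fun tau => real_complex R (abel e tau) * stFourier f tau k).
Proof.
have h := cintable_cint Hi H1.
have mE : @cmeasurable _ (measurableTypeR R) _ (fun x : R => real_complex R (2 * pi)^-1 * expi (- t * x)).
  apply: cmeasurableM; first exact: cmeasurable_cst.
  by apply: cmeasurable_expi; exact: measurable_mull.
have := cintableM (M := normc (real_complex R (2 * pi)^-1)) h mE.
have E : (fun x => real_complex R (2 * pi)^-1 * expi (- t * x) * cint nu (fun y => H (x, y))) =
    (fun tau => real_complex R (abel e tau) * stFourier f tau k).
  apply/funext => x; rewrite sec1.
  have -> : real_complex R (2 * pi)^-1 * expi (- t * x) * (real_complex R (2 * pi) *
     (expi (t * x) * (real_complex R (abel e x) * stFourier f x k))) =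
     (real_complex R (2 * pi)^-1 * real_complex R (2 * pi)) * (expi (- t * x) * expi (t * x)) *
     (real_complex R (abel e x) * stFourier f x k) by ring.
  rewrite -expiD mulNr addNr expi0 -real_complexM mulVf ?gt_eqF ?mulr_gt0 ?pi_gt0//.
  by rewrite [real_complex R 1](rmorph1 (real_complex R)) !mul1r.
rewrite E; apply => x.
by rewrite normcM normc_expi mulr1.
Qed.

(** This replaces Fourier inversion: integrating first in the frequency turns the damped exponential
    into the Poisson kernel, so that no decay of the transform in [tau] is used. *)
Lemma ftr_abel_stFourier :
  real_complex R (2 * pi) * ftr (fun tau => real_complex R (abel e tau) * stFourier f tau k) t =
  cint nu (fun z => real_complex R (pois e (t - z.1)) * fk k z).
Proof.
rewrite /ftr -cintZ; last exact: (cintable_ftr t cintable_abel_stFourier).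
transitivity (cint leb (fun x => cint nu (fun z => H (x, z)))).
  by apply: eq_cint => x; rewrite sec1.
rewrite (cint_fubini Hi H1 H2); apply: eq_cint => z.
rewrite -(cint_abel_expi (t - z.1) e0) -cintZr; last exact: cintable_abel_expi.
apply: eq_cint => x; rewrite /H /=.
have -> : x * (t - z.1) = t * x + - (z.1 * x) by ring.
by rewrite expiD; ring.
Qed.

End fixed_mode.

Lemma bounded_stFourier (e : R) k : exists M, forall tau,
  normc (real_complex R (abel e tau) * stFourier f tau k) <= M * abel e tau.
Proof.
exists (normc (real_complex R (2 * pi)^-1) * \int[nu]_z normc (fS z)) => tau.
rewrite normcM normc_real (ger0_norm (abel_ge0 _ _)) mulrC ler_wpM2r ?abel_ge0//.
rewrite stFourierE normcM ler_wpM2l ?normc_nneg//.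
have ci : cintable nu (fun z => expi (- (z.1 * tau)) * fk k z).
  apply: (cintableM (M := 1) (fki k)); last by move=> z; rewrite normc_expi.
  apply: cmeasurable_expi; apply: measurable_funN; apply: measurable_funM.
    exact: measurable_fst.
  exact: measurable_cst.
apply: (le_trans (normc_cint_le ci)); rewrite le_eqVlt; apply/orP; left; apply/eqP.
by apply: eq_Rintegral => z _; rewrite normcM normc_expi mul1r normc_fk.
Qed.

(** Expanding the Fejer kernel makes the mean a trigonometric polynomial in [x] whose coefficients
    are transforms of integrable functions, as the estimate for one sign requires. *)
Lemma reg_ftr (e : R) M t x : 0 < e ->
  reg f e M t x = real_complex R (2 * pi) * (real_complex R M%:R^-1 *
    \sum_(a < M) \sum_(b < M) expi ((a%:Z - b%:Z)%:~R * x) *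
      ftr (fun tau => real_complex R (abel e tau) * stFourier f tau (a%:Z - b%:Z)) t).
Proof.
move=> e0.
have ci k : cintable nu (fun z => real_complex R (pois e (t - z.1)) * fk k z).
  apply: (cintableM (M := 2 * e / e ^+ 2) (fki k)).
    apply: (@cmeasurable_fst R _ _ (measurableTypeR R) (measurableTypeR R) (fun s => real_complex R (pois e (t - s)))).
    exact: (cmeasurable_real (measurable_pois_sub t e0)).
  by move=> z; rewrite normc_real ger0_norm ?pois_ge0 ?(ltW e0)// pois_le.
transitivity (cint nu (fun z => \sum_(a < M) \sum_(b < M)
   (real_complex R M%:R^-1 * expi ((a%:Z - b%:Z)%:~R * x)) *
     (real_complex R (pois e (t - z.1)) * fk (a%:Z - b%:Z) z))).
  apply: eq_cint => z; rewrite (real_complexM (pois _ _)) (real_complexM (\1_circ _)) fejerE.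
  rewrite 3!mulr_sumr mulr_suml; apply: eq_bigr => a _.
  rewrite 3!mulr_sumr mulr_suml; apply: eq_bigr => b _.
  rewrite mulrBr expiD /fk /fS; ring.
rewrite cint_sum; last by move=> a; apply: cintable_sum => b; exact: cintableZ.
rewrite 2!mulr_sumr; apply: eq_bigr => a _.
rewrite cint_sum; last by move=> b; exact: cintableZ.
rewrite 2!mulr_sumr; apply: eq_bigr => b _.
by rewrite cintZ// -ftr_abel_stFourier//; ring.
Qed.

End reg_fourier.

(** The difference [k] occurs [M - |k|] times, whence the Fejer coefficients; the case distinction
    in the second sum avoids counting [0] twice. The induction adds one row and one column to the
    square of pairs. *)
Lemma sum_differences (V : zmodType) (g : int -> V) M :
  \sum_(a < M) \sum_(b < M) g (a%:Z - b%:Z) =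
  \sum_(k < M) g k%:Z *+ (M - k) +
  \sum_(k < M) g (- k%:Z) *+ (if k == 0%N :> nat then 0%N else M - k)%N.
Proof.
elim: M => [|M ih]; first by rewrite !big_ord0 addr0.
have pos : \sum_(k < M.+1) g k%:Z *+ (M.+1 - k) =
    \sum_(k < M) g k%:Z *+ (M - k) + \sum_(b < M.+1) g (M%:Z - b%:Z).
  have -> : \sum_(b < M.+1) g (M%:Z - b%:Z) = \sum_(k < M.+1) g k%:Z.
    rewrite (reindex_inj rev_ord_inj)/=; apply: eq_bigr => k _; congr g.
    by have := ltn_ord k; lia.
  rewrite [in RHS]big_ord_recr big_ord_recr/= subSnn mulr1n addrA; congr (_ + _).
  rewrite -big_split/=; apply: eq_bigr => k _.
  by rewrite subSn ?mulrSr// ltnW.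
have neg : \sum_(k < M.+1) g (- k%:Z) *+ (if k == 0%N :> nat then 0%N else M.+1 - k)%N =
    \sum_(k < M) g (- k%:Z) *+ (if k == 0%N :> nat then 0%N else M - k)%N +
    \sum_(a < M) g (a%:Z - M%:Z).
  have -> : \sum_(a < M) g (a%:Z - M%:Z) = \sum_(k < M) g (- k.+1%:Z).
    rewrite (reindex_inj rev_ord_inj)/=; apply: eq_bigr => k _; congr g.
    by have := ltn_ord k; lia.
  have -> : \sum_(k < M) g (- k.+1%:Z) =
      \sum_(k < M.+1) g (- k%:Z) *+ (if k == 0%N :> nat then 0%N else 1%N).
    by rewrite big_ord_recl/= mulr0n add0r.
  have -> : \sum_(k < M) g (- k%:Z) *+ (if k == 0%N :> nat then 0%N else M - k)%N =
      \sum_(k < M.+1) g (- k%:Z) *+ (if k == 0%N :> nat then 0%N else M - k)%N.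
    by rewrite big_ord_recr/= subnn; case: ifP => _; rewrite mulr0n addr0.
  rewrite -big_split/=; apply: eq_bigr => k _; case: ifP => _.
    by rewrite !mulr0n addr0.
  have kM : (k <= M)%N by rewrite -ltnS.
  by rewrite subSn// mulrSr.
rewrite pos neg big_ord_recr/= addrACA -ih.
under eq_bigr do rewrite big_ord_recr/=.
by rewrite big_split/= -!addrA; congr (_ + _); rewrite addrC.
Qed.

Lemma sum_le_esum (R : realType) (I : choiceType) (a : I -> \bar R) (idx : nat -> I) M :
  injective idx -> (forall i, 0 <= a i)%E ->
  (\sum_(k < M) a (idx k) <= \esum_(i in [set: I]) a i)%E.
Proof.
move=> inj a0; apply: esum_ge; exists [set` map idx (iota 0 M)].
  by split => //; exact: finite_seq.
rewrite -fsbig_seq; last by rewrite map_inj_uniq ?iota_uniq.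
by rewrite big_map -(big_mkord xpredT (fun k => a (idx k))) /index_iota subn0.
Qed.

Lemma normcD4_le (R : realType) (z w : R[i]) :
  normc (z + w) ^+ 4 <= 8 * (normc z ^+ 4 + normc w ^+ 4).
Proof.
apply: (@le_trans _ _ ((normc z + normc w) ^+ 4)).
  by apply: lerXn2r; rewrite ?nnegrE ?addr_ge0 ?normc_nneg ?normc_triangle.
move: (normc z) (normc w) => a b.
rewrite -subr_ge0.
(* Convexity of the fourth power, made explicit by factoring out the double zero at [a = b]. *)
have -> : 8 * (a ^+ 4 + b ^+ 4) - (a + b) ^+ 4 =
    (a - b) ^+ 2 * (2 * (a ^+ 2 + b ^+ 2) + 5 * (a + b) ^+ 2) by ring.
by rewrite mulr_ge0 ?sqr_ge0// addr_ge0// mulr_ge0 ?addr_ge0 ?sqr_ge0.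
Qed.

Section strip_iterated.
Context {R : realType}.
Notation leb := (@lebesgue_measure R).
Notation RR := (measurableTypeR R * measurableTypeR R)%type.
Notation nu := (@lebesgue_measure R \x @lebesgue_measure R)%E.

Lemma measurable_indic_strip : measurable_fun [set: RR] (fun z : RR => \1_circ z.2 : R).
Proof. exact: (measurableT_comp measurable_indic_circ measurable_snd). Qed.

Lemma measurable_strip (g : RR -> R) : measurable_fun [set: RR] g ->
  measurable_fun [set: RR] (fun z : RR => \1_circ z.2 * g z).
Proof.
move=> mg; apply: measurable_funM => //; exact: measurable_indic_strip.
Qed.

Lemma integral_strip_iterated (g : RR -> R) : measurable_fun [set: RR] g ->
  (forall z, 0 <= g z) ->
  (\int[nu]_z (\1_circ z.2 * g z)%:E =
   \int[leb]_t \int[leb]_(x in circ) (g (t, x))%:E)%E.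
Proof.
move=> mg g0.
have m1 : measurable_fun [set: RR] (fun z : RR => (\1_circ z.2 * g z)%:E).
  by apply/measurable_EFinP; exact: measurable_strip.
have p1 (z : RR) : (0 <= (\1_circ z.2 * g z)%:E)%E.
  by rewrite lee_fin mulr_ge0 ?indic_circ_ge0.
rewrite (fubini_tonelli1 _ m1 p1); apply: eq_integral => t _.
by rewrite integral_circ_mkcond /fubini_F.
Qed.

Lemma integral_strip_normcD4 (u v : RR -> R[i]) (B : \bar R) :
  cmeasurable u -> cmeasurable v -> (0 <= B)%E ->
  (\int[nu]_z (\1_circ z.2 * normc (u z) ^+ 4)%:E <= B)%E ->
  (\int[nu]_z (\1_circ z.2 * normc (v z) ^+ 4)%:E <= B)%E ->
  (\int[nu]_z (\1_circ z.2 * normc (u z + v z) ^+ 4)%:E <= 16%:E * B)%E.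
Proof.
move=> mu mv B0 hu hv.
have m4 (w : RR -> R[i]) : cmeasurable w -> measurable_fun [set: RR] (fun z => \1_circ z.2 * normc (w z) ^+ 4).
  by move=> mw; apply: measurable_strip; apply: measurable_funX; exact: measurable_normc.
have i0 := @indic_circ_ge0 R.
have n4 (w : RR -> R[i]) z : 0 <= \1_circ z.2 * normc (w z) ^+ 4.
  by rewrite mulr_ge0// exprn_ge0 ?normc_nneg.
have lin := ge0_integral_lin nu (ler0n R 8) (ler0n R 8) (m4 _ mu) (m4 _ mv) (n4 u) (n4 v).
apply: (@le_trans _ _ (8%:E * B + 8%:E * B)%E); last first.
  by rewrite -ge0_muleDl ?lee_fin// -EFinD lee_wpmul2r// lee_fin; lra.
have e8 : (0 <= 8%:E :> \bar R)%E by rewrite lee_fin.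
apply: le_trans (leeD (lee_wpmul2l e8 hu) (lee_wpmul2l e8 hv)).
rewrite -lin; apply: ge0_le_integral; first by [].
- by move=> z _; rewrite lee_fin; exact: (n4 (fun z => u z + v z)).
- by apply/measurable_EFinP; apply: m4; exact: cmeasurableD.
- apply/measurable_EFinP; apply: measurable_funD;
    (apply: measurable_funM; [exact: measurable_cst|exact: m4]).
- move=> z _; rewrite lee_fin.
  have := ler_wpM2l (i0 z.2) (normcD4_le (u z) (v z)).
  by congr (_ <= _); ring.
Qed.

End strip_iterated.

(** * The a priori estimate *)

Section apriori.
Context {R : realType}.
Notation leb := (@lebesgue_measure R).
Notation RR := (measurableTypeR R * measurableTypeR R)%type.
Notation nu := (@lebesgue_measure R \x @lebesgue_measure R)%E.

Lemma jap_ge1 (x : R) : 1 <= jap x.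
Proof. by rewrite /jap -{1}(sqrtr1 R) ler_wsqrtr// lerDl sqr_ge0. Qed.

Lemma jap_ge (x : R) : 1 + `|x| <= 2 * jap x.
Proof.
have h : `|x| <= jap x.
  by rewrite /jap -sqrtr_sqr ler_wsqrtr// lerDr.
by have := jap_ge1 x; lra.
Qed.

Lemma measurable_jap_powR (c q : R) :
  measurable_fun [set: measurableTypeR R] (fun t => jap (t - c) `^ q).
Proof.
apply: (measurableT_comp (measurable_powR q)).
apply: (measurableT_comp (continuous_measurable_fun (@sqrt_continuous R))).
apply: measurable_funD; first exact: measurable_cst.
apply: measurable_funX.
by apply: measurable_funB; [exact: measurable_id|exact: measurable_cst].
Qed.

Variables (j : nat) (b : R).
Hypothesis j1 : (1 <= j)%N.
Hypothesis hb : (j%:R + 1) / (2 * (2 * j%:R + 1)) < b.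

Let m := (2 * j + 1)%N.
(** The cap is what [bweight_kernel_bound] asks for. As the bracket is at least [1], lowering the
    exponent only lowers the weight, so large [b] needs no separate treatment. *)
Let p := Num.min (2 * b) 1.

Let m1 : (1 < m)%N. Proof. rewrite /m; lia. Qed.

Let b0 : 0 < b.
Proof. by apply: le_lt_trans hb; rewrite divr_ge0// ?addr_ge0// mulr_ge0// addr_ge0// mulr_ge0. Qed.

Let p1 : p <= 1. Proof. by rewrite /p ge_min lexx orbT. Qed.
Let p0 : 0 <= p. Proof. by rewrite /p le_min ler01 andbT mulr_ge0// ltW. Qed.
Let pb : p <= 2 * b. Proof. by rewrite /p ge_min lexx. Qed.

(** For [2 * b <= 1] this is the hypothesis on [b]; otherwise [p = 1] and it says that [m] exceeds
    [1]. *)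
Let mp : 1 + m%:R^-1 < 2 * p.
Proof.
have mE : m%:R = 2 * j%:R + 1 :> R by rewrite /m natrD natrM.
have mR : 1 < m%:R :> R by rewrite ltr1n.
have m0 : 0 < m%:R :> R by lra.
rewrite /p; case: (leP (2 * b) 1) => _; last first.
  have : m%:R^-1 < 1 :> R by rewrite invf_lt1.
  lra.
move: hb; rewrite -mE ltr_pdivrMr ?mulr_gt0// => h.
rewrite -(ltr_pM2r m0) mulrDl mul1r mulVf ?gt_eqF//.
have -> : 2 * (2 * b) * m%:R = 2 * (b * (2 * m%:R)) by ring.
rewrite mE; move: h; rewrite mE; lra.
Qed.

Let weight_le (s : int) k tau : s = 1 \/ s = -1 ->
  bweight (s%:~R : R) m p k tau <=
  2 `^ p * jap (tau - (s * k%:Z)%:~R ^+ m) `^ (2 * b).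
Proof.
move=> s1.
(* Oddness of [m = 2 * j + 1] lets the sign pass through the power. *)
have -> : (s * k%:Z)%:~R ^+ m = s%:~R * (k ^ m)%:R :> R.
  rewrite intrM exprMn -pmulrn natrX; congr (_ * _).
  case: s1 => ->; first by rewrite expr1n.
  by rewrite mulrN1z -signr_odd /m oddD oddM.
rewrite /bweight; set y := tau - _.
have y0 : 0 < jap y by rewrite (lt_le_trans _ (jap_ge1 y)).
apply: (@le_trans _ _ ((2 * jap y) `^ p)).
  by apply: ge0_ler_powR; rewrite ?nnegrE ?addr_ge0 ?mulr_ge0 ?(ltW y0)// jap_ge.
rewrite powRM ?(ltW y0)//; apply: ler_wpM2l; first exact: powR_ge0.
by apply: ler_powR; [exact: jap_ge1|exact: pb].
Qed.

Section fixed_function.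
Variable f : R * R -> R[i].
Hypothesis nf : nice f.

Let term (k : int) : \bar R :=
  (\int[leb]_tau (jap (k%:~R : R) `^ (2 * 0)
         * jap (tau - k%:~R ^+ m) `^ (2 * b)
         * normc (stFourier f tau k) ^+ 2)%:E)%E.

Let Ef : \bar R := (\esum_(k in [set: int]) term k)%E.

Let term0 k : (0 <= term k)%E.
Proof.
by apply: integral_ge0 => t _; rewrite lee_fin mulr_ge0 ?sqr_ge0// mulr_ge0 ?powR_ge0.
Qed.

Let Ef0 : (0 <= Ef)%E. Proof. exact: esum_ge0. Qed.

Let measurable_stF k : @cmeasurable _ (measurableTypeR R) _ (fun tau => stFourier f tau k).
Proof.
have h := (cintable_abel_stFourier nf 0 k (@ltr01 R)).1.
have mI : @cmeasurable _ (measurableTypeR R) _ (fun t : R => real_complex R (expR `|t|)).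
  apply: cmeasurable_real; apply: continuous_measurable_fun => t.
  by apply: continuous_comp; [exact: norm_continuous|exact: continuous_expR].
have := cmeasurableM mI h; congr cmeasurable; apply/funext => t.
rewrite mulrA -real_complexM /abel -expRD mul1r subrr expR0.
by rewrite [real_complex R 1](rmorph1 (real_complex R)) mul1r.
Qed.

Variable S0 : R.
Hypothesis S00 : 0 < S0.
Hypothesis HS : forall (sg : R) k tau, sg = 1 \/ sg = -1 ->
    (\sum_(i < k.+1) \int[leb]_s ((bweight sg m p i s)^-1 *
       (bweight sg m p (k - i)%N (tau - s))^-1)%:E <= S0%:E)%E.

(** The first factor is the square of the [2 * pi] built into [A] below; the second is the loss in
    [weight_le]. *)
Let K1 : R := (2 * pi) ^+ 2 * 2 `^ p.

Let K10 : 0 <= K1. Proof. by rewrite /K1 mulr_ge0 ?sqr_ge0 ?powR_ge0. Qed.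

Section fixed_level.
Variables (e : R) (M : nat).
Hypothesis e0 : 0 < e.

Let Fa (k : int) (tau : R) := real_complex R (abel e tau) * stFourier f tau k.
Let A (s : int) (c : nat -> R) (k : nat) (tau : R) :=
  real_complex R (2 * pi * c k) * Fa (s * k%:Z) tau.

Let Fai k : cintable leb (Fa k).
Proof. exact: (cintable_abel_stFourier nf 0 k e0). Qed.

(** The damping and the coefficients [c] lie between [0] and [1], so they can be discarded inside
    the weighted norms: this is why the bound depends on neither [e] nor [M]. *)
Lemma half_bound (s : int) (c : nat -> R) : s = 1 \/ s = -1 ->
  (forall k, 0 <= c k <= 1) -> (forall k, (M <= k)%N -> c k = 0) ->
  (\int[leb]_t \int[leb]_(x in circ)
     (normc (\sum_(k < M) expi ((s * k%:Z)%:~R * x) * ftr (A s c k) t) ^+ 4)%:E <=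
   ((2 * pi) ^+ 2 * S0)%:E * ((K1%:E * Ef) * (K1%:E * Ef)))%E.
Proof.
move=> s1 c01 cM.
have s0 : s != 0 by case: s1 => ->.
have sR : (s%:~R : R) = 1 \/ (s%:~R : R) = -1 by case: s1 => ->; [left|right; rewrite mulrN1z].
have Ai k : cintable leb (A s c k) by exact: cintableZ.
have Ab k : exists B, forall t, normc (A s c k t) <= B.
  have [B hB] := bounded_stFourier nf e (s * k%:Z).
  exists (normc (real_complex R (2 * pi * c k)) * `|B|) => t.
  rewrite normcM ler_wpM2l ?normc_nneg// (le_trans (hB t))//.
  rewrite (le_trans (ler_wpM2r (abel_ge0 _ _) (ler_norm B)))//.
  by rewrite ler_piMr// /abel expR_le1 oppr_le0 mulr_ge0// ltW.
have An k t : (M <= k)%N -> A s c k t = 0.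
  move=> /cM ck; rewrite /A ck mulr0.
  by rewrite [real_complex R 0](rmorph0 (real_complex R)) mul0r.
have mw k : measurable_fun [set: measurableTypeR R] (bweight (s%:~R : R) m p k).
  exact: measurable_norm1D.
have w0 k t : 0 < bweight (s%:~R : R) m p k t.
  by rewrite /bweight powR_gt0// ltr_pwDl.
have core := integral_strip_normc4 s0 Ai Ab An mw w0 S00 (fun k tau => HS k tau sR).
apply: (le_trans core); apply: lee_wpmul2l.
  by rewrite lee_fin mulr_ge0 ?sqr_ge0// ltW.
have S : (\sum_(k < M) \int[leb]_tau (bweight s%:~R m p k tau * normc (A s c k tau) ^+ 2)%:E <= K1%:E * Ef)%E.
  apply: (@le_trans _ _ (\sum_(k < M) K1%:E * term (s * k%:Z))%E); last first.
    rewrite -ge0_sume_distrr; last by move=> k _; exact: term0.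
    apply: lee_wpmul2l; first by rewrite lee_fin.
    apply: (sum_le_esum (idx := fun k : nat => s * k%:Z)) => // k k'.
    by move/(mulfI s0) => -[].
  apply: lee_sum => k _.
  have mF2 : measurable_fun [set: measurableTypeR R] (fun t => normc (stFourier f t (s * k%:Z)) ^+ 2).
    by apply: measurable_funX; exact: (measurable_normc (measurable_stF _)).
  rewrite /term -ge0_integralZl_fin//; last 2 first.
  - apply: measurable_funM => //; apply: measurable_funM; first exact: measurable_cst.
    exact: measurable_jap_powR.
  - by move=> t; rewrite mulr_ge0 ?sqr_ge0// mulr_ge0 ?powR_ge0.
  apply: ge0_le_integral; first by [].
  - by move=> t _; rewrite lee_fin mulr_ge0 ?sqr_ge0// ltW.
  - apply/measurable_EFinP; apply: measurable_funM; first exact: mw.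
    by apply: measurable_funX; exact: (measurable_normc (Ai k).1).
  - apply/measurable_EFinP; apply: measurable_funM; first exact: measurable_cst.
    apply: measurable_funM => //; apply: measurable_funM; first exact: measurable_cst.
    exact: measurable_jap_powR.
  move=> t _; rewrite lee_fin mulr0 powRr0 mul1r.
  have nA : normc (A s c k t) <= 2 * pi * normc (stFourier f t (s * k%:Z)).
    have /andP[c0 c1] := c01 k.
    rewrite /A /Fa normcM normcM !normc_real (ger0_norm (abel_ge0 _ _)).
    have a1 : abel e t <= 1 by rewrite /abel expR_le1 oppr_le0 mulr_ge0// ltW.
    have a0 := abel_ge0 e t.
    have pp : 0 <= 2 * pi :> R by rewrite mulr_ge0 ?pi_ge0.
    have n0 := normc_nneg (stFourier f t (s * k%:Z)).
    rewrite (ger0_norm (mulr_ge0 pp c0)); move: (normc _) n0 => n n0.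
    rewrite (_ : 2 * pi * c k * (abel e t * n) = 2 * pi * (c k * abel e t * n)); last by ring.
    rewrite ler_wpM2l// -[leRHS]mul1r ler_wpM2r//.
    by rewrite mulr_ile1.
  have nA2 : normc (A s c k t) ^+ 2 <= (2 * pi) ^+ 2 * normc (stFourier f t (s * k%:Z)) ^+ 2.
    by rewrite -exprMn; apply: lerXn2r; rewrite ?nnegrE ?mulr_ge0 ?normc_nneg ?pi_ge0.
  have w1 := weight_le k t s1.
  apply: (@le_trans _ _ (2 `^ p * jap (t - (s * k%:Z)%:~R ^+ m) `^ (2 * b) *
     ((2 * pi) ^+ 2 * normc (stFourier f t (s * k%:Z)) ^+ 2))).
    by apply: ler_pM => //; [exact: ltW|exact: sqr_ge0].
  by rewrite le_eqVlt; apply/orP; left; apply/eqP; rewrite /K1; ring.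
by apply: lee_pmul => //; apply: sume_ge0 => k _; apply: integral_ge0 => t _;
  rewrite lee_fin mulr_ge0 ?sqr_ge0// ltW.
Qed.

Hypothesis M0 : (0 < M)%N.

Let cp (k : nat) : R := (M - k)%:R / M%:R.
(* The frequency [0] is counted among the nonnegative ones. *)
Let cn (k : nat) : R := if k == 0%N then 0 else (M - k)%:R / M%:R.

Let cp01 k : 0 <= cp k <= 1.
Proof.
rewrite /cp divr_ge0//= ler_pdivrMr ?ltr0n// mul1r ler_nat.
exact: leq_subr.
Qed.

Let cn01 k : 0 <= cn k <= 1.
Proof. by rewrite /cn; case: ifP => _; [rewrite lexx ler01|exact: cp01]. Qed.

Let cpM k : (M <= k)%N -> cp k = 0.
Proof. by rewrite /cp -subn_eq0 => /eqP ->; rewrite mul0r. Qed.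

Let cnM k : (M <= k)%N -> cn k = 0.
Proof. by move=> Mk; rewrite /cn; case: ifP => // _; exact: cpM. Qed.

Let U (s : int) (c : nat -> R) (z : RR) : R[i] :=
  \sum_(k < M) expi ((s * k%:Z)%:~R * z.2) * ftr (A s c k) z.1.

Let reg_split z : reg f e M z.1 z.2 = U 1 cp z + U (-1) cn z.
Proof.
rewrite reg_ftr//.
pose G (k : int) := expi (k%:~R * z.2) * ftr (Fa k) z.1.
rewrite -/(\sum_(a < M) \sum_(b < M) G (a%:Z - b%:Z)) sum_differences !mulrDr.
have ftrA s c k : ftr (A s c k) z.1 = real_complex R (2 * pi * c k) * ftr (Fa (s * k%:Z)) z.1.
  rewrite /ftr -cintZ; last exact: cintable_ftr.
  by apply: eq_cint => t; rewrite /A; ring.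
have real_n (n : nat) (w : R[i]) : w *+ n = real_complex R n%:R * w.
  by rewrite (rmorph_nat (real_complex R)) mulr_natl.
congr (_ + _); rewrite !mulr_sumr; apply: eq_bigr => k _; rewrite ftrA.
- by rewrite real_n /G mul1r /cp !real_complexM; ring.
- rewrite real_n /G mulN1r /cn; case: ifP => _.
    by rewrite mulr0 [real_complex R 0](rmorph0 (real_complex R)) !(mul0r, mulr0).
  by rewrite !real_complexM; ring.
Qed.

Let mU s c : @cmeasurable _ RR R (U s c).
Proof.
apply: cmeasurable_sum => k; apply: cmeasurableM.
  apply: cmeasurable_expi; apply: measurable_funM; first exact: measurable_cst.
  exact: measurable_snd.
apply: (@cmeasurable_fst R _ _ (measurableTypeR R) (measurableTypeR R) (ftr (A s c k))).
by apply: cmeasurable_ftr; apply: cintableZ; exact: Fai.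
Qed.

Lemma measurable_reg : @cmeasurable _ RR R (fun z => reg f e M z.1 z.2).
Proof.
have := cmeasurableD (mU 1 cp) (mU (-1) cn); congr cmeasurable.
by apply/funext => z; rewrite reg_split.
Qed.

Lemma reg_integral_le :
  (\int[nu]_z (\1_circ z.2 * normc (reg f e M z.1 z.2) ^+ 4)%:E <=
   16%:E * (((2 * pi) ^+ 2 * S0)%:E * ((K1%:E * Ef) * (K1%:E * Ef))))%E.
Proof.
set B := (X in (_ <= _ * X)%E).
have B0 : (0 <= B)%E.
  have KE0 : (0 <= K1%:E * Ef)%E by apply: mule_ge0 => //; rewrite lee_fin.
  apply: mule_ge0; last exact: mule_ge0.
  by rewrite lee_fin mulr_ge0 ?sqr_ge0// ltW.
have m4 s c : measurable_fun [set: RR] (fun z => normc (U s c z) ^+ 4).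
  by apply: measurable_funX; exact: (measurable_normc (mU s c)).
have n4 (w : R[i]) : 0 <= normc w ^+ 4 by rewrite exprn_ge0 ?normc_nneg.
have i0 := @indic_circ_ge0 R.
have h1 : (\int[nu]_z (\1_circ z.2 * normc (U 1 cp z) ^+ 4)%:E <= B)%E.
  by rewrite integral_strip_iterated//; apply: half_bound => //; left.
have h2 : (\int[nu]_z (\1_circ z.2 * normc (U (-1) cn z) ^+ 4)%:E <= B)%E.
  by rewrite integral_strip_iterated//; apply: half_bound => //; right.
rewrite (_ : (fun z => _) = (fun z : RR => (\1_circ z.2 * normc (U 1 cp z + U (-1) cn z) ^+ 4)%:E)).
  exact: (integral_strip_normcD4 (mU 1 cp) (mU (-1) cn) B0 h1 h2).
by apply/funext => z; rewrite reg_split.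
Qed.

End fixed_level.

(** The means converge to [(2 pi) ^+ 2] times [f] because the kernels are not normalized, hence the
    constant on the left. *)
Lemma strip_normc4_le :
  (((2 * pi * (2 * pi)) ^+ 4)%:E * \int[nu]_z (\1_circ z.2 * normc (f z) ^+ 4)%:E <=
   16%:E * (((2 * pi) ^+ 2 * S0)%:E * ((K1%:E * Ef) * (K1%:E * Ef))))%E.
Proof.
set P := 2 * pi * (2 * pi).
have P0 : 0 <= P by rewrite !mulr_ge0 ?pi_ge0.
have n4 (w : R[i]) : 0 <= normc w ^+ 4 by rewrite exprn_ge0 ?normc_nneg.
rewrite -ge0_integralZl_fin ?exprn_ge0//; last 2 first.
- apply: measurable_strip; apply: measurable_funX.
  exact: (measurable_normc (nice_cmeasurable nf)).
- by move=> z; rewrite mulr_ge0 ?indic_circ_ge0 ?n4.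
apply: (@fatou_cvg_le _ RR R nu (fun n z => (\1_circ z.2 * normc (reg f n.+1%:R^-1 n.+1 z.1 z.2) ^+ 4)%:E)).
- move=> n; apply/measurable_EFinP; apply: measurable_strip; apply: measurable_funX.
  have n0 : 0 < n.+1%:R^-1 :> R by rewrite invr_gt0.
  exact: (measurable_normc (measurable_reg n.+1 n0)).
- by move=> n z; rewrite lee_fin mulr_ge0 ?indic_circ_ge0.
- move=> z; apply: cvg_EFin; first exact: nearW.
  have [zc|zc] := boolP (z.2 \in circ); last first.
    have z0 : \1_circ z.2 = 0 :> R by rewrite indicE (negbTE zc).
    rewrite z0 mul0r mulr0; under eq_fun do rewrite mul0r.
    exact: cvg_cst.
  have z1 : \1_circ z.2 = 1 :> R by rewrite indicE zc.
  rewrite z1 mul1r; under eq_fun do rewrite mul1r.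
  rewrite -exprMn; move: zc; rewrite inE => zc.
  have := @reg_cvg R f nf z.1 z.2 zc; rewrite -/P -surjective_pairing => h.
  by apply: (@cvg_comp _ _ _ _ (fun x : R => x ^+ 4) _ _ _ h); exact: exprn_continuous.
- by move=> n; apply: reg_integral_le; rewrite ?invr_gt0.
Qed.

End fixed_function.

(** A real bound [x] on the norm keeps extended reals out of the conclusion. Applied to differences,
    the estimate turns Cauchy sequences for the norm into Cauchy sequences in L^4. *)
Lemma strichartz_apriori : exists2 K : R, 0 < K &
  forall f x, nice f -> 0 <= x -> (Xnorm_fun j 0 b f <= x%:E)%E ->
  (\int[nu]_z (\1_circ z.2 * normc (f z) ^+ 4)%:E <= (K * x ^+ 4)%:E)%E.
Proof.
have [S0 S00 HS] := bweight_kernel_bound m1 mp p1.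
pose P : R := 2 * pi * (2 * pi).
have pi0 : 0 < 2 * pi :> R by rewrite mulr_gt0 ?pi_gt0.
have P0 : 0 < P ^+ 4 by rewrite exprn_gt0// mulr_gt0.
pose K1 : R := (2 * pi) ^+ 2 * 2 `^ p.
have K10 : 0 < K1 by rewrite mulr_gt0 ?exprn_gt0 ?powR_gt0.
(* [P ^+ 4] undoes the missing normalization, [16] comes from adding the two signs, and
   [K1 * (2 * pi)] is the constant in front of [x ^+ 2] in the bound of each energy factor. *)
pose K := (P ^+ 4)^-1 * (16 * ((2 * pi) ^+ 2 * S0 * (K1 * (2 * pi) * (K1 * (2 * pi))))).
exists K => [|f x nf x0].
  have h1 : 0 < K1 * (2 * pi) by exact: mulr_gt0.
  apply: mulr_gt0; first by rewrite invr_gt0.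
  apply: mulr_gt0 => //; apply: mulr_gt0; last exact: mulr_gt0.
  by apply: mulr_gt0 => //; rewrite exprn_gt0.
have := strip_normc4_le nf S00 HS.
rewrite -/P -/K1 /Xnorm_fun; set E := (\esum_(k in _) _)%E => main hX.
have E0 : (0 <= E)%E.
  apply: esum_ge0 => k _; apply: integral_ge0 => t _.
  by rewrite lee_fin mulr_ge0 ?sqr_ge0// mulr_ge0 ?powR_ge0.
have Ex : (E <= (2 * pi * x ^+ 2)%:E)%E.
  have : ((2 * pi)^-1%:E * E <= (x ^+ 2)%:E)%E.
    rewrite -lee_sqrt ?lee_fin ?sqr_ge0//.
    by apply: (le_trans hX); rewrite /sqrte /= sqrtr_sqr ger0_norm.
  move=> /(lee_wpmul2l (_ : 0 <= (2 * pi)%:E)%E); rewrite lee_fin (ltW pi0) => /(_ isT).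
  by rewrite muleA -EFinM mulfV ?gt_eqF// mul1e -EFinM.
have K1E : (K1%:E * E <= (K1 * (2 * pi) * x ^+ 2)%:E)%E.
  rewrite (_ : K1 * (2 * pi) * x ^+ 2 = K1 * (2 * pi * x ^+ 2)); last by ring.
  by rewrite (EFinM K1); apply: lee_wpmul2l => //; rewrite lee_fin ltW.
have K1E0 : (0 <= K1%:E * E)%E by rewrite mule_ge0// lee_fin ltW.
have rhs : (16%:E * (((2 * pi) ^+ 2 * S0)%:E * ((K1%:E * E) * (K1%:E * E))) <=
   (P ^+ 4 * (K * x ^+ 4))%:E)%E.
  have -> : P ^+ 4 * (K * x ^+ 4) = 16 * ((2 * pi) ^+ 2 * S0 *
      (K1 * (2 * pi) * x ^+ 2 * (K1 * (2 * pi) * x ^+ 2))).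
    by rewrite /K; field; rewrite gt_eqF// mulr_gt0.
  rewrite (EFinM 16); apply: lee_wpmul2l; first by rewrite lee_fin.
  rewrite (EFinM ((2 * pi) ^+ 2 * S0)); apply: lee_wpmul2l.
    by rewrite lee_fin mulr_ge0 ?sqr_ge0// ltW.
  by rewrite (EFinM (K1 * (2 * pi) * x ^+ 2)); exact: lee_pmul.
have := le_trans main rhs.
by rewrite (EFinM (P ^+ 4)) lee_pmul2l// ?lte_fin.
Qed.

End apriori.

(** * Passage to the limit *)

Section complex_limsup.
Context {R : realType}.

Lemma cvgn_geometric (u : R^nat) (c : R) : 0 <= c ->
  (forall k, `|u k.+1 - u k| <= c * 2^-1 ^+ k) -> cvgn u.
Proof.
move=> c0 uc.
have cg : cvgn (series (geometric c 2^-1)).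
  by apply: is_cvg_geometric_series; rewrite ger0_norm ?invr_ge0// invf_lt1 ?ltr1n.
have ct : cvgn [normed series (telescope u)].
  apply: (series_le_cvg _ _ _ cg) => n.
  - exact: normr_ge0.
  - by rewrite /geometric mulr_ge0// exprn_ge0// invr_ge0.
  - exact: uc.
have cs := normed_cvg ct.
have -> : u = (fun n => u 0%N + series (telescope u) n).
  by apply/funext => n; rewrite -eq_sum_telescope.
by apply: is_cvgD => //; exact: is_cvg_cst.
Qed.

(* Defined without any convergence assumption, so that the limit of a sequence
   of measurable functions is measurable everywhere. *)
Definition climsup (u : nat -> R[i]) : R[i] :=
  Complex (fine (limn_esup (fun k => (complex.Re (u k))%:E)))
          (fine (limn_esup (fun k => (complex.Im (u k))%:E))).

Lemma fine_limn_esup (u : R^nat) : cvgn u ->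
  u @ \oo --> fine (limn_esup (fun k => (u k)%:E)).
Proof.
move=> /cvg_ex[l ul].
have ul' : (fun k => (u k)%:E) @ \oo --> l%:E by apply: cvg_EFin => //; exact: nearW.
by have [_ ->] := cvg_limn_einf_sup ul'.
Qed.

Lemma climsup_cvg (u : nat -> R[i]) (c : R) : 0 <= c ->
  (forall k, normc (u k.+1 - u k) <= c * 2^-1 ^+ k) ->
  (fun k => normc (u k - climsup u)) @ \oo --> (0 : R).
Proof.
move=> c0 uc.
have cr : cvgn (fun k => complex.Re (u k)).
  apply: (cvgn_geometric c0) => k; apply: le_trans (uc k).
  by have := Re_le_normc (u k.+1 - u k); case: (u k.+1) (u k) => [a b] [a' b'].
have ci : cvgn (fun k => complex.Im (u k)).
  apply: (cvgn_geometric c0) => k; apply: le_trans (uc k).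
  by have := Im_le_normc (u k.+1 - u k); case: (u k.+1) (u k) => [a b] [a' b'].
have hr := fine_limn_esup cr; have hi := fine_limn_esup ci.
apply: (@squeeze_cvgr _ _ _ _ (fun=> 0)
  (fun k => `|complex.Re (u k) - complex.Re (climsup u)| + `|complex.Im (u k) - complex.Im (climsup u)|)).
- apply: nearW => k; rewrite normc_nneg; move: (climsup u) => w.
  apply: le_trans (normc_le_ReIm (u k - w)) _.
  by case: (u k) w => [a b] [a' b'].
- exact: cvg_cst.
- rewrite -[X in _ --> X]addr0; apply: cvgD.
    by have := cvg_norm ((subr_cvg0 _ _).2 hr); rewrite normr0; exact.
  by have := cvg_norm ((subr_cvg0 _ _).2 hi); rewrite normr0; exact.
Qed.

Lemma climsup_cmeasurable d (T : measurableType d) (f : nat -> T -> R[i]) :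
  (forall n, cmeasurable (f n)) -> cmeasurable (fun z => climsup (f ^~ z)).
Proof.
move=> mf; split.
  apply: (measurableT_comp (@fine_measurable R setT measurableT)).
  by apply: measurable_fun_limn_esup => n; apply/measurable_EFinP; exact: (mf n).1.
apply: (measurableT_comp (@fine_measurable R setT measurableT)).
by apply: measurable_fun_limn_esup => n; apply/measurable_EFinP; exact: (mf n).2.
Qed.

End complex_limsup.

(** * Completeness of L^4 *)

Section ae_fatou.
Context d (T : measurableType d) (R : realType).
Variable mu : {measure set T -> \bar R}.
Local Open Scope ereal_scope.

Lemma ae_fatou_cvg_le (f : (T -> \bar R)^nat) (g : T -> \bar R) K :
  (forall n, measurable_fun [set: T] (f n)) -> (forall n x, 0 <= f n x) ->
  measurable_fun [set: T] g -> (forall x, 0 <= g x) ->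
  {ae mu, forall x, (f n x) @[n --> \oo] --> g x} ->
  (\forall n \near \oo, \int[mu]_x f n x <= K) -> \int[mu]_x g x <= K.
Proof.
move=> mf f0 mg g0 fg [N _ fK].
pose h n := f (n + N)%N.
have hK n : \int[mu]_x h n x <= K by apply: fK; rewrite /= leq_addl.
apply: le_trans (limn_einf_le hK).
apply: le_trans (fatou mu measurableT (fun n => mf (n + N)%N) (fun n x _ => f0 _ x)).
apply: ae_ge0_le_integral => //.
- move=> x _; rewrite limn_einf_lim; apply: lime_ge; first exact: is_cvg_einfs.
  by apply: nearW => n; apply: le_ereal_inf_tmp => _ [m _ <-]; exact: f0.
(* The lower limit is written as the opposite of an upper limit, whose measurability is known. *)
- rewrite (_ : (fun _ => _) = (fun x => - limn_esup (fun n => - h n x))); last first.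
    apply/funext => x; rewrite -limn_einfN; congr limn_einf.
    by apply/funext => n /=; rewrite oppeK.
  apply: measurableT_comp => //; apply: measurable_fun_limn_esup => n.
  by apply: measurableT_comp => //; exact: mf.
- apply: filterS fg => x fx _.
  have hx : (h n x) @[n --> \oo] --> g x by rewrite (cvg_shiftn N (f ^~ x)).
  by have [-> _] := cvg_limn_einf_sup hx.
Qed.

End ae_fatou.

Lemma cmeasurableB d (T : measurableType d) (R : realType) (f g : T -> R[i]) :
  cmeasurable f -> cmeasurable g -> cmeasurable (fun z => f z - g z).
Proof.
move=> mf mg; apply: cmeasurableD => //.
have := cmeasurableM (cmeasurable_cst T (-1)) mg.
by congr cmeasurable; apply/funext => z; rewrite mulN1r.
Qed.

Section weighted_L4.
Context d (T : measurableType d) (R : realType).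
Variable mu : {measure set T -> \bar R}.
Variable w : T -> R.
Hypothesis mw : measurable_fun [set: T] w.
Hypothesis w01 : forall z, w z = 0 \/ w z = 1.

Let w0 z : 0 <= w z. Proof. by case: (w01 z) => ->. Qed.

Let I (g : T -> R[i]) := (\int[mu]_z (w z * normc (g z) ^+ 4)%:E)%E.

Let m4 (g : T -> R[i]) : cmeasurable g ->
  measurable_fun [set: T] (fun z => w z * normc (g z) ^+ 4).
Proof.
by move=> mg; apply: measurable_funM => //; apply: measurable_funX; exact: measurable_normc.
Qed.

Let n4 (g : T -> R[i]) z : 0 <= w z * normc (g z) ^+ 4.
Proof. by rewrite mulr_ge0// exprn_ge0 ?normc_nneg. Qed.

(** The series of [16 ^+ k] times the fourth powers has integral at most [1], so its sum [G] is
    finite almost everywhere. Every term is below [G], and a fourth root turns [16 ^+ k] into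
    [2 ^+ k]. *)
Lemma ae_geometric (ph : nat -> T -> R[i]) : (forall n, cmeasurable (ph n)) ->
  (forall k, I (fun z => (ph k.+1 z - ph k z)%R) <= (16^-1 ^+ k * (1 / (2 ^ k.+1)%:R))%:E)%E ->
  {ae mu, forall z, w z = 1 -> exists2 c, 0 <= c &
    forall k, normc (ph k.+1 z - ph k z) <= c * 2^-1 ^+ k}.
Proof.
move=> mph Ik.
pose D k z : R := 16 ^+ k * (w z * normc (ph k.+1 z - ph k z) ^+ 4).
have e16 k : 0 <= 16 ^+ k :> R by rewrite exprn_ge0.
have D0 k z : 0 <= D k z by exact: mulr_ge0 (e16 k) (n4 (fun z => ph k.+1 z - ph k z) z).
have mD k : measurable_fun [set: T] (fun z => w z * normc (ph k.+1 z - ph k z) ^+ 4).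
  by apply: (m4 (cmeasurableB _ _)).
have mDE k : measurable_fun [set: T] (fun z => (D k z)%:E).
  by apply/measurable_EFinP; apply: measurable_funM => //; exact: measurable_cst.
pose G z := (\sum_(k <oo) (D k z)%:E)%E.
have G0 z : (0 <= G z)%E by apply: nneseries_ge0 => k _ _; rewrite lee_fin.
have DG k z : ((D k z)%:E <= G z)%E.
  have h := @nneseries_lim_ge _ (fun k => (D k z)%:E) xpredT 0%N k.+1 (fun n _ _ => D0 n z).
  apply: le_trans h; rewrite big_nat_recr//=; apply: leeDr.
  by apply: sume_ge0 => i _; rewrite lee_fin.
have iG : mu.-integrable [set: T] G.
  apply/integrableP; split.
    by apply: ge0_emeasurable_sum => // k z _ _; rewrite lee_fin.
  under eq_integral do rewrite gee0_abs//.
  rewrite integral_nneseries//; last by move=> n z _; rewrite lee_fin.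
  apply: (@le_lt_trans _ _ 1%:E); last exact: ltry.
  apply: le_trans (@epsilon_trick0 R 1 xpredT ler01).
  apply: lee_nneseries => [i _ _|i _].
    by apply: integral_ge0 => z _; rewrite lee_fin.
  rewrite (@ge0_integralZl_fin _ _ _ mu (16 ^+ i))//; last exact: (n4 (fun z => ph i.+1 z - ph i z)).
  have h : (0 <= (16 ^+ i)%:E :> \bar R)%E by rewrite lee_fin.
  apply: le_trans (lee_wpmul2l h (Ik i)) _.
  rewrite -EFinM lee_fin; move: (1 / _) => c.
  by rewrite mulrA -(exprMn i (16 : R)) mulfV ?expr1n ?mul1r// pnatr_eq0.
apply: filterS (integrable_ae measurableT iG) => z /(_ Logic.I) Gz wz.
(* [1 + G] serves as an upper bound for the fourth root of [G], so that no root has to be taken. *)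
exists (1 + fine (G z)); first by rewrite addr_ge0// fine_ge0.
move=> k; have := DG k z; rewrite -(fineK Gz) lee_fin /D wz mul1r.
have : 0 <= fine (G z) by exact: fine_ge0.
have := normc_nneg (ph k.+1 z - ph k z).
move: (normc _) (fine _) => a g a0 g0.
rewrite exprVn ler_pdivlMr ?exprn_gt0// (_ : 16 = 2 ^+ 4); last by ring.
rewrite -exprM mulnC exprM -exprMn mulrC; set y := a * _.
have y0 : 0 <= y by rewrite mulr_ge0// exprn_ge0.
move=> yg; have [//|gy] := leP y (1 + g).
have y1 : 1 <= y ^+ 3 by rewrite exprn_ege1//; lra.
have : y <= y ^+ 4 by rewrite exprSr ler_peMl.
by lra.
Qed.

Lemma L4_complete (phi : nat -> T -> R[i]) : (forall n, cmeasurable (phi n)) ->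
  (forall e : R, 0 < e -> exists N : nat, forall m n : nat, (N <= m)%N -> (N <= n)%N ->
     (I (fun z => (phi m z - phi n z)%R) <= e%:E)%E) ->
  exists s : nat -> nat, let f z := climsup (fun k => phi (s k) z) in
    (forall e : R, 0 < e -> \forall n \near \oo, (I (fun z => (f z - phi n z)%R) <= e%:E)%E) /\
    (forall B, (\forall n \near \oo, (I (phi n) <= B)%E) -> (I f <= B)%E).
Proof.
move=> mphi cphi.
have ek (k : nat) : 0 < 16^-1 ^+ k * (1 / (2 ^ k.+1)%:R) :> R.
  by rewrite mulr_gt0 ?exprn_gt0 ?invr_gt0// divr_gt0// ltr0n expn_gt0.
have [N hN] := choice (fun k => cphi _ (ek k)).
(* Adding up all thresholds makes both [s k] and [s k.+1] exceed [N k], and the summand [k] makes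
   [s] tend to infinity. *)
pose s k := (k + \sum_(i < k.+1) N i)%N.
have Ns k : (N k <= s k)%N by rewrite /s big_ord_recr/=; lia.
have Ns1 k : (N k <= s k.+1)%N by rewrite /s big_ord_recr/= big_ord_recr/=; lia.
have ks k : (k <= s k)%N by rewrite /s leq_addr.
exists s => f.
pose ph k z := phi (s k) z.
have mph k : cmeasurable (ph k) by exact: mphi.
have mf : cmeasurable f by exact: climsup_cmeasurable.
have aef := ae_geometric mph (fun k => hN k _ _ (Ns1 k) (Ns k)).
(* Taking [g = phi n] gives the convergence of the whole sequence, and [g = 0] the bound on the
   limit. *)
have main (g : T -> R[i]) B : cmeasurable g ->
    (\forall k \near \oo, (I (fun z => (ph k z - g z)%R) <= B)%E) -> (I (fun z => (f z - g z)%R) <= B)%E.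
  move=> mg; apply: ae_fatou_cvg_le.
  - by move=> n; apply/measurable_EFinP; apply: (m4 (cmeasurableB _ _)).
  - by move=> n z; rewrite lee_fin; exact: (n4 (fun z => ph n z - g z)).
  - by apply/measurable_EFinP; apply: (m4 (cmeasurableB _ _)).
  - by move=> z; rewrite lee_fin; exact: (n4 (fun z => f z - g z)).
  apply: filterS aef => z hz; apply: cvg_EFin; first exact: nearW.
  case: (w01 z) => wz.
    by rewrite wz mul0r; under eq_fun do rewrite mul0r; exact: cvg_cst.
  have [c c0 /(climsup_cvg c0)] := hz wz; rewrite -/(f z) => hc.
  rewrite wz mul1r; under eq_fun do rewrite mul1r.
  have hn : (fun k => normc (ph k z - g z)) @ \oo --> normc (f z - g z).
    apply/subr_cvg0/norm_cvg0P.
    apply: (@squeeze_cvgr _ _ _ _ (fun=> 0) (fun k => normc (ph k z - f z))) => //.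
      apply: nearW => k; rewrite normr_ge0/=.
      apply: le_trans (normcB_le _ _) _.
      by have -> : ph k z - g z - (f z - g z) = ph k z - f z by ring.
    exact: cvg_cst.
  by apply: (@cvg_comp _ _ _ _ (fun x : R => x ^+ 4) _ _ _ hn); exact: exprn_continuous.
split.
  move=> e /cphi[M hM]; exists M => // n /= Mn; apply: main => //.
  by exists M => // k /= Mk; apply: hM => //; exact: leq_trans (ks k).
move=> B [M _ hM].
have := main (fun=> 0) B (cmeasurable_cst T 0); rewrite /I.
under eq_integral do rewrite subr0.
apply; exists M => // k /= Mk; under eq_integral do rewrite subr0.
by apply: hM => /=; exact: leq_trans (ks k).
Qed.

End weighted_L4.

(** Substitute for Hoelder's inequality with exponents [4] and [4/3]: [a <= l + a ^+ 4 / l ^+ 3],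
    since one of the two terms always dominates. The test function [c] then enters only through its
    integral and its bound [M]. *)
Lemma weighted_young (R : realType) (l a c M : R) : 0 < l -> 0 <= a -> 0 <= c <= M ->
  a * c <= l * c + M * l ^- 3 * a ^+ 4.
Proof.
move=> l0 a0 /andP[c0 cM].
have l3 : 0 < l ^+ 3 by rewrite exprn_gt0.
have h : a <= l + a ^+ 4 / l ^+ 3.
  have [al|/ltW la] := leP a l; first by rewrite ler_wpDr// divr_ge0 ?exprn_ge0// ltW.
  rewrite ler_wpDl ?(ltW l0)// ler_pdivlMr// (exprS a 3) ler_wpM2l//.
  by apply: lerXn2r; rewrite ?nnegrE// ltW.
apply: (le_trans (ler_wpM2r c0 h)); rewrite mulrDl lerD2l.
have q0 : 0 <= a ^+ 4 / l ^+ 3 by rewrite divr_ge0 ?exprn_ge0// ltW.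
apply: (le_trans (ler_wpM2l q0 cM)).
by rewrite le_eqVlt; apply/orP; left; apply/eqP; ring.
Qed.

(** * Pairing with test functions *)

Section strip_L4.
Context {R : realType}.
Notation RR := (measurableTypeR R * measurableTypeR R)%type.
Notation nu := (@lebesgue_measure R \x @lebesgue_measure R)%E.

Definition strip4 (g : RR -> R[i]) : \bar R :=
  (\int[nu]_z (\1_circ z.2 * normc (g z) ^+ 4)%:E)%E.

Lemma strip4_ge0 g : (0 <= strip4 g)%E.
Proof.
apply: integral_ge0 => z _.
by rewrite lee_fin mulr_ge0 ?indic_circ_ge0 ?exprn_ge0 ?normc_nneg.
Qed.

Lemma L4norm_funE (g : RR -> R[i]) : L4norm_fun g = (strip4 g `^ 4^-1)%E.
Proof.
rewrite /L4norm_fun unlock /Lnorm; congr (_ `^ _)%E.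
apply: eq_integral => -[t x] _; rewrite patchE indicE.
have -> : ((t, x) \in strip R) = (x \in (circ : set R)).
  by apply/idP/idP; rewrite !inE; [move=> -[]|split].
case: (_ \in _).
  by rewrite gee0_abs ?lee_fin ?normc_nneg// poweR_EFin mul1r powR_mulrn ?normc_nneg.
by rewrite abse0 mul0r poweR_EFin powR0 ?pnatr_eq0.
Qed.

Let w (z : RR) : R := \1_circ z.2.
Let w0 z : 0 <= w z. Proof. exact: indic_circ_ge0. Qed.
Let mw : measurable_fun [set: RR] w.
Proof. exact: measurable_indic_strip. Qed.

Section pairing.
Variable p : RR -> R[i].
Hypothesis np : nice p.

Lemma pairing_le (M : R) : (forall z, normc (p z) <= M) ->
  forall (g : RR -> R[i]) (l : R), @cmeasurable _ RR R g -> 0 < l ->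
  (\int[nu]_z (normc (real_complex R (w z) * (g z * p z)))%:E <=
   l%:E * \int[nu]_z (normc (real_complex R (w z) * p z))%:E +
   (M * l ^- 3)%:E * strip4 g)%E.
Proof.
move=> pM g l mg l0.
have M0 : 0 <= M by apply: le_trans (pM (0, 0)); exact: normc_nneg.
have mwp : @cmeasurable _ RR R (fun z => real_complex R (w z) * p z).
  by apply: cmeasurableM; [exact: cmeasurable_real|exact: nice_cmeasurable].
have mwgp : @cmeasurable _ RR R (fun z => real_complex R (w z) * (g z * p z)).
  apply: cmeasurableM; first exact: cmeasurable_real.
  by apply: cmeasurableM => //; exact: nice_cmeasurable.
have m1 := measurable_normc mwp.
have m2 : measurable_fun [set: RR] (fun z => w z * normc (g z) ^+ 4).
  by apply: measurable_funM => //; apply: measurable_funX; exact: measurable_normc.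
have M3 : 0 <= M * l ^- 3 by rewrite mulr_ge0// invr_ge0 exprn_ge0// ltW.
have g4 z : 0 <= w z * normc (g z) ^+ 4 by rewrite mulr_ge0// exprn_ge0 ?normc_nneg.
rewrite /strip4 -(ge0_integral_lin nu (ltW l0) M3 m1 m2 (fun z => normc_nneg _) g4).
apply: ge0_le_integral; first by [].
- by move=> z _; rewrite lee_fin normc_nneg.
- exact: measurable_normcE.
- apply/measurable_EFinP; apply: measurable_funD;
    (apply: measurable_funM; [exact: measurable_cst|]); [exact: m1|exact: m2].
move=> z _; rewrite lee_fin !normcM normc_real (ger0_norm (w0 z)).
have pM' : 0 <= normc (p z) <= M by rewrite normc_nneg pM.
have := ler_wpM2l (w0 z) (weighted_young l0 (normc_nneg (g z)) pM').
by congr (_ <= _); ring.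
Qed.

Lemma pairing_cintable (g : RR -> R[i]) : @cmeasurable _ RR R g -> (strip4 g < +oo)%E ->
  cintable nu (fun z => real_complex R (w z) * (g z * p z)).
Proof.
move=> mg goo; have [M M0 pM] := nice_bounded np.
split.
  apply: cmeasurableM; first exact: cmeasurable_real.
  by apply: cmeasurableM => //; exact: nice_cmeasurable.
apply: (le_lt_trans (pairing_le (fun z => (pM z).2) mg ltr01)).
have [_ poo] := cintable_strip np.
rewrite mul1e expr1n invr1 mulr1; apply: lte_add_pinfty; first exact: poo.
by apply: lte_mul_pinfty => //; rewrite lee_fin.
Qed.

Lemma pairing_small (g : nat -> RR -> R[i]) : (forall n, @cmeasurable _ RR R (g n)) ->
  (forall e : R, 0 < e -> \forall n \near \oo, (strip4 (g n) <= e%:E)%E) ->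
  forall e : R, 0 < e -> \forall n \near \oo,
    normc (cint nu (fun z => real_complex R (w z) * (g n z * p z))) <= e.
Proof.
move=> mg g0 e e0; have [M M0 pM] := nice_bounded np.
have [_ poo] := cintable_strip np.
set P := (\int[nu]_z (normc (real_complex R (w z) * p z))%:E)%E.
have P0 : (0 <= P)%E by apply: integral_ge0 => z _; rewrite lee_fin normc_nneg.
have Pfin : P \is a fin_num by rewrite ge0_fin_numE.
(* [l] makes the term with the test function at most [e / 2], and [e'] does the same for the L^4
   term; the added [1] keeps the denominators positive. *)
pose l := e / (2 * (1 + fine P)).
have fP0 : 0 <= fine P by exact: fine_ge0.
have l0 : 0 < l by rewrite divr_gt0// mulr_gt0// ltr_pwDl.
have l3 : 0 < l ^+ 3 by rewrite exprn_gt0.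
pose e' := e / 2 / (1 + M * l ^- 3).
have M3 : 0 <= M * l ^- 3 by rewrite mulr_ge0// invr_ge0 ltW.
have e'0 : 0 < e' by rewrite divr_gt0 ?divr_gt0// ltr_pwDl.
apply: filterS (g0 _ e'0) => n gn.
have goo : (strip4 (g n) < +oo)%E by apply: le_lt_trans gn _; exact: ltry.
rewrite -lee_fin; apply: (le_trans (normc_cint_leE (pairing_cintable (mg n) goo))).
apply: (le_trans (pairing_le (fun z => (pM z).2) (mg n) l0)).
have h : (0 <= (M * l ^- 3)%:E :> \bar R)%E by rewrite lee_fin.
apply: (le_trans (leeD2l _ (lee_wpmul2l h gn))).
rewrite -/P -(fineK Pfin) -!EFinM -EFinD lee_fin.
have frac (q : R) : 0 <= q -> e / 2 * (q / (1 + q)) <= e / 2.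
  move=> q0; apply: ler_piMr; first by rewrite divr_ge0// ltW.
  by rewrite ler_pdivrMr ?mul1r ?ltr_pwDl// lerDr.
have a1 : l * fine P <= e / 2.
  apply: le_trans (frac _ fP0); rewrite le_eqVlt; apply/orP; left; apply/eqP.
  by rewrite /l; field; rewrite gt_eqF// ltr_pwDl.
have a2 : M * l ^- 3 * e' <= e / 2.
  apply: le_trans (frac _ M3); rewrite le_eqVlt; apply/orP; left; apply/eqP.
  rewrite /e'; move: (M * l ^- 3) M3 => q q0; field.
  by rewrite gt_eqF// ltr_pwDl.
lra.
Qed.

End pairing.

End strip_L4.

(** * The limit in L^4 represents the distribution *)

Section limit_bound.
Context {R : realType}.
Notation RR := (measurableTypeR R * measurableTypeR R)%type.
Notation nu := (@lebesgue_measure R \x @lebesgue_measure R)%E.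

Lemma represents_strip4 (f : RR -> R[i]) (u : distr R) : xperiodic f ->
  @cmeasurable _ RR R f -> (strip4 f < +oo)%E ->
  (forall psi, u psi = distr_of f psi) -> represents f u.
Proof.
move=> pf mf foo uf; split; [exact: pf|exact: mf.1|exact: mf.2|].
move=> psi; split; last exact: uf.
have np := schwartz_nice psi.
have mfp : @cmeasurable _ RR R (fun z => f z * psi z).
  by apply: cmeasurableM => //; exact: nice_cmeasurable.
have [_ poo] := pairing_cintable np mf foo.
apply/integrableP; split.
  by apply: (@measurable_funTS _ _ RR _ _); exact: measurable_normcE.
rewrite integral_strip_mkcond; apply: le_lt_trans poo.
apply: ge0_le_integral; first by [].
- by move=> z _; rewrite mule_ge0 ?lee_fin ?indic_circ_ge0.
- apply: emeasurable_funM.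
    apply/measurable_EFinP.
    exact: measurable_indic_strip.
  by apply: measurableT_comp => //; exact: measurable_normcE.
- apply: measurable_normcE; apply: cmeasurableM => //.
  apply: cmeasurable_real.
  exact: measurable_indic_strip.
move=> z _; rewrite gee0_abs ?lee_fin ?normc_nneg//.
change (\1_circ z.2 * normc (f z * psi z) <= normc (real_complex R (\1_circ z.2) * (f z * psi z))).
by rewrite (normcM (real_complex R _)) normc_real ger0_norm ?indic_circ_ge0.
Qed.

(** The fourth power is at most [M ^+ 3] times the modulus, which is integrable on the strip. *)
Lemma strip4_nice (f : RR -> R[i]) : nice f -> (strip4 f < +oo)%E.
Proof.
move=> nf; have [M M0 fM] := nice_bounded nf; have [mwf foo] := cintable_strip nf.
have mw := @measurable_indic_strip R.
have mf := nice_cmeasurable nf.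
have M3 : 0 <= M ^+ 3 by rewrite exprn_ge0.
apply: (@le_lt_trans _ _ ((M ^+ 3)%:E *
    \int[nu]_z (normc (real_complex R (\1_circ z.2) * f z))%:E)%E); last first.
  by apply: lte_mul_pinfty; rewrite ?lee_fin.
rewrite -ge0_integralZl_fin//; [|exact: measurable_normc|by move=> z; exact: normc_nneg].
apply: ge0_le_integral; first by [].
- by move=> z _; rewrite lee_fin mulr_ge0 ?indic_circ_ge0 ?exprn_ge0 ?normc_nneg.
- apply/measurable_EFinP; apply: measurable_funM => //; apply: measurable_funX.
  exact: measurable_normc.
- apply/measurable_EFinP; apply: measurable_funM; first exact: measurable_cst.
  exact: measurable_normc.
move=> z _; rewrite lee_fin normcM normc_real ger0_norm ?indic_circ_ge0// [leRHS]mulrCA.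
rewrite ler_wpM2l ?indic_circ_ge0// exprSr ler_wpM2r ?normc_nneg//.
by apply: lerXn2r; rewrite ?nnegrE ?normc_nneg// (fM z).2.
Qed.

Lemma distr_ofB (f g : RR -> R[i]) (psi : schwartzFun R) :
  @cmeasurable _ RR R f -> (strip4 f < +oo)%E ->
  @cmeasurable _ RR R g -> (strip4 g < +oo)%E ->
  distr_of f psi - distr_of g psi =
  cint nu (fun z => real_complex R (\1_circ z.2) * ((f z - g z) * psi z)).
Proof.
move=> mf foo mg goo; rewrite /distr_of !cintegralE.
rewrite -cintB; [|exact: (pairing_cintable (schwartz_nice psi))..].
by apply: eq_cint => z; rewrite -mulrBr -mulrBl.
Qed.

Variables (j : nat) (b K : R).
Hypothesis K0 : 0 < K.
Hypothesis HK : forall f x, nice f -> 0 <= x -> (Xnorm_fun j 0 b f <= x%:E)%E ->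
  (strip4 f <= (K * x ^+ 4)%:E)%E.

Lemma L4norm_limit_le (phi : nat -> schwartzFun R) (u : distr R) (x : R) :
  Xapprox j 0 b phi u -> 0 <= x ->
  (fun n => Xnorm_fun j 0 b (phi n)) @ \oo --> x%:E ->
  (L4norm u <= (K `^ 4^-1 * x)%:E)%E.
Proof.
move=> [cphi uphi] x0 Xx.
have nphi n := schwartz_nice (phi n).
have mphi n : @cmeasurable _ RR R (phi n) by exact: nice_cmeasurable.
have cI (e : R) : 0 < e -> exists N : nat, forall m n : nat, (N <= m)%N -> (N <= n)%N ->
    (strip4 (fun z => (phi m z - phi n z)%R) <= e%:E)%E.
  (* The cap at [1] gives [dl ^+ 4 <= dl], so that [K * dl ^+ 4 <= e] without a fourth root. *)
  move=> e0; pose dl := Num.min 1 (e / K).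
  have dl0 : 0 < dl by rewrite lt_min ltr01 divr_gt0.
  have [N hN] := cphi _ dl0; exists N => m n Nm Nn.
  apply: le_trans (HK (niceB (nphi m) (nphi n)) (ltW dl0) (ltW (hN m n Nm Nn))) _.
  have d1 : dl <= 1 by rewrite ge_min lexx.
  have d2 : dl <= e / K by rewrite ge_min lexx orbT.
  rewrite lee_fin mulrC -ler_pdivlMr//; apply: le_trans d2.
  by rewrite exprS ler_piMr ?(ltW dl0)// exprn_ile1// ltW.
have mw := @measurable_indic_strip R.
have w01 (z : RR) : \1_circ z.2 = 0 :> R \/ \1_circ z.2 = 1 :> R.
  by rewrite indicE; case: (_ \in _); [right|left].
have [s] := @L4_complete _ RR R nu _ mw w01 _ mphi cI.
set f := (f in let _ := f in _); move=> /= [fphi fB].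
have mf : @cmeasurable _ RR R f.
  by apply: climsup_cmeasurable => n; exact: mphi.
(* [climsup] depends only on the values at the given point, so periodicity is inherited exactly,
   even where the sequence does not converge. *)
have pf : xperiodic f.
  move=> t y; rewrite /f; congr climsup; apply/funext => k.
  exact: schwartz_periodic.
(* The norms only tend to [x], so they are eventually below [x + dl] for any slack [dl], which is
   removed at the end. *)
have fle dl : 0 < dl -> (strip4 f <= (K * (x + dl) ^+ 4)%:E)%E.
  move=> dl0; apply: fB.
  have hx : \forall n \near \oo, (Xnorm_fun j 0 b (phi n) < (x + dl)%:E)%E.
    apply: (Xx [set y | (y < (x + dl)%:E)%E]); apply: open_nbhs_nbhs; split.
      exact: open_ereal_lt_ereal.
    by rewrite /= lte_fin ltrDl.
  apply: filterS hx => n /ltW hn; apply: HK (nphi n) _ hn.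
  by rewrite addr_ge0// ltW.
have foo : (strip4 f < +oo)%E by apply: le_lt_trans (fle 1 ltr01) _; exact: ltry.
(* Against a fixed test function, [phi n] is close to [f] by convergence in L^4 and to [u] by
   convergence as distributions, so [f] and [u] have the same pairing. *)
have rf : represents f u.
  apply: represents_strip4 => // psi.
  have np := schwartz_nice psi.
  have small := pairing_small np (fun n => cmeasurableB mf (mphi n)) fphi.
  apply/eqP; rewrite -subr_eq0; apply/eqP/eq0_normc/eqP.
  rewrite eq_le normc_nneg andbT; apply/ler_addgt0Pr => e e0; rewrite add0r.
  have e20 : 0 < e / 2 by rewrite divr_gt0.
  have h1 := small _ e20.
  have h2 : \forall n \near \oo, normc (distr_of (phi n) psi - u psi) < e / 2.
    exact: (cvgr_lt _ (uphi psi) _ e20).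
  have [n [n1 n2]] := filter_ex (filterI h1 h2).
  move: n1; rewrite -distr_ofB//; last exact: strip4_nice.
  move=> n1; move/ltW : n2 => n2.
  rewrite -normc_opp (_ : - _ = (distr_of f psi - distr_of (phi n) psi) +
    (distr_of (phi n) psi - u psi)); last by ring.
  by apply: le_trans (normc_triangle _ _) _; lra.
apply: (@le_trans _ _ (L4norm_fun f)); first by apply: ereal_inf_lbound; exists f.
rewrite L4norm_funE; apply/lee_addgt0Pr => e e0.
have C0 : 0 < K `^ 4^-1 by exact: powR_gt0.
(* Chosen so that, after the fourth root, the slack contributes exactly [e]. *)
pose dl := e / K `^ 4^-1.
have dl0 : 0 < dl by rewrite divr_gt0.
have xd : 0 <= x + dl by rewrite addr_ge0// ltW.
have E : ((K * (x + dl) ^+ 4)%:E `^ 4^-1)%E = ((K `^ 4^-1 * x)%:E + e%:E)%E.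
  rewrite poweR_EFin powRM ?(ltW K0) ?exprn_ge0// -(powR_mulrn 4 xd) -powRrM mulfV ?pnatr_eq0//.
  by rewrite powRr1// -EFinD mulrDr /dl mulrCA mulfV ?mulr1 ?gt_eqF.
rewrite -E; apply: gt0_ler_poweR.
- by rewrite invr_ge0.
- by rewrite in_itv/= strip4_ge0 leey.
- by rewrite in_itv/= leey lee_fin mulr_ge0 ?exprn_ge0// ltW.
- exact: fle.
Qed.

End limit_bound.

Theorem lemma3p1 (R : realType) (j : nat) (b : R) :
  (1 <= j)%N ->
  (j%:R + 1) / (2 * (2 * j%:R + 1)) < b ->
  exists C : R, 0 < C /\
    forall u : distr R, Xspace j 0 b u ->
      (L4norm u <= C%:E * Xnorm j 0 b u)%E.
Proof.
move=> j1 hb; have [K K0 HK] := strichartz_apriori j1 hb.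
have C0 : 0 < K `^ 4^-1 by exact: powR_gt0.
exists (K `^ 4^-1); split => // u _.
(* With the constant moved to the left, the claim is a lower bound for an infimum, and each
   approximating sequence can be treated on its own. *)
rewrite -lee_pdivrMl//; apply: le_ereal_inf_tmp => l [phi [uphi phil]].
rewrite lee_pdivrMl//.
have l0 : (0 <= l)%E.
  rewrite -(cvg_lim _ phil)//; apply: lime_ge; first by apply/cvg_ex; exists l.
  by apply: nearW => n; exact: sqrte_ge0.
case: l l0 phil => [x x0 phix|_ _|//].
  rewrite -EFinM; exact: (L4norm_limit_le K0 HK uphi).
by rewrite gt0_muley ?lte_fin// leey.
Qed.
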